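(* Let $f(z)$ be a non-constant meromorphic solution of $$f(z)^n P(z,f)=Q(z,f),$$ where $n$ is a positive integer and $P(z,f)$ and $Q(z,f)$ are difference polynomials in $f(z)$, and let $\delta<1$ and $\varepsilon>0$. If the degree of $Q(z,f)$ as a polynomial in $f(z)$ and its shifts is at most $n$, then $$m\big(r,P(z,f)\big) = o\left(\frac{T(r+|c|,f)^{1+\varepsilon}}{r^\delta}\right) +o(T(r,f))$$ as $r\to\infty$ outside of a possible exceptional set of $r$ with finite logarithmic measure.
   Context: Meromorphic means meromorphic in the whole complex plane. $m(r,g)$ and $T(r,g)$ denote the Nevanlinna proximity function and the Nevanlinna characteristic function of a meromorphic function $g$. A set $E\subset(0,\infty)$ has finite logarithmic measure if $\int_E\frac{dr}{r}<\infty$. A difference polynomial in $f(z)$ is a function which is a polynomial in finitely many shifts $f(z+c_j)$, with $c_j\in\mathbb{C}$ ($c_j=0$ allowed), whose coefficients $a_\lambda(z)$ are meromorphic functions such that $T(r,a_\lambda)=o(T(r,f))$ as $r\to\infty$ except possibly for a set of $r$ having finite logarithmic measure. The notation $|c|$ stands for $|c|:=\max\{|c_j|\}$, the maximum being taken over all the shifts $c_j$ occurring in the difference polynomials involved. *)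

(* Defs.v *)
From HB Require Import structures.
From mathcomp Require Import all_boot all_order all_algebra.
From mathcomp Require Import finmap all_classical all_reals all_analysis.
From mathcomp Require Import complex.

Set Implicit Arguments.
Unset Strict Implicit.
Unset Printing Implicit Defensive.

Import Order.TTheory GRing.Theory Num.Theory.
Import numFieldNormedType.Exports.
Import ComplexField.Normc.

Local Open Scope classical_set_scope.
Local Open Scope ring_scope.
Local Open Scope complex_scope.

(* [R[i]] gets the topology and norm of a [numFieldType] over itself, so that
   [derivable g z 1] is complex differentiability of [g] at [z]. *)
HB.instance Definition _ (R : rcfType) := NormedModule.copy R[i] R[i]^o.

(* A meromorphic function is represented by any total function that agrees with
   it off a closed discrete set; the values on that set (in particular at the
   poles) are irrelevant: [meromorphic], the pole orders and the Nevanlinna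
   functions do not depend on them, and equality of meromorphic functions is
   [mero_eq]. *)

Definition holomorphic_at (R : realType) (g : R[i] -> R[i]) (z0 : R[i]) : Prop :=
  \forall z \near z0, derivable g z 1.

Definition laurent_at (R : realType) (f : R[i] -> R[i]) (z0 : R[i]) (k : nat)
    (g : R[i] -> R[i]) : Prop :=
  holomorphic_at g z0 /\ \forall z \near z0^', f z = g z / (z - z0) ^+ k.

Definition meromorphic (R : realType) (f : R[i] -> R[i]) : Prop :=
  forall z0, exists k g, laurent_at f z0 k g.

Definition mero_eq (R : realType) (f g : R[i] -> R[i]) : Prop :=
  forall z0, \forall z \near z0^', f z = g z.

(* Multiplicity of [z0] as a pole: the [k] such that
   [f z = g z / (z - z0) ^+ k] near [z0] with [g] holomorphic and [g z0 != 0].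
   There is no such [k] at a zero of [f] (or if [f] vanishes identically), where
   the default value 0 is the right one. *)
Definition pole_order (R : realType) (f : R[i] -> R[i]) (z0 : R[i]) : nat :=
  xget 0%N [set k | exists2 g, laurent_at f z0 k g & g z0 != 0].

(* n(r, f) *)
Definition pole_count (R : realType) (f : R[i] -> R[i]) (r : R) : R :=
  \sum_(z \in [set z : R[i] | normc z <= r]) ((pole_order f z)%:R : R).

(* N(r, f) *)
Definition counting_fun (R : realType) (f : R[i] -> R[i]) (r : R) : R :=
  \int[@lebesgue_measure R]_(t in `]0, r]) ((pole_count f t - pole_count f 0) / t)
  + pole_count f 0 * ln r.

Definition circle_pt (R : realType) (r t : R) : R[i] :=
  (r * cos t) +i* (r * sin t).

(* The library has [ln x <= 0] for all [x <= 1], including [x = 0], so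
   [Num.max 0 (ln x)] is log^+ x for all [x >= 0]. *)
Definition logp (R : realType) (x : R) : R := Num.max 0 (ln x).

(* m(r, f) *)
Definition proximity (R : realType) (f : R[i] -> R[i]) (r : R) : R :=
  (2 * pi)^-1 *
  \int[@lebesgue_measure R]_(t in `[0, 2 * pi]) logp (normc (f (circle_pt r t))).

(* T(r, f) *)
Definition characteristic (R : realType) (f : R[i] -> R[i]) (r : R) : R :=
  proximity f r + counting_fun f r.

Definition finite_log_measure (R : realType) (E : set R) : Prop :=
  [/\ E `<=` `]0, +oo[, measurable E &
      (\int[@lebesgue_measure R]_(r in E) (r^-1)%:E < +oo)%E].

Canonical pinfty_filter_on (R : numFieldType) := FilterType (pinfty_nbhs R) _.

(* The filter "r tends to +oo, r not in E". *)
Notation infty_off E := (within (~` E) (pinfty_nbhs _)).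

(* The formal sum over the multi-indices l in [dp_supp] of
   a_l(z) \prod_j f(z + c_j)^(l_j), with c = [dp_shift] and a = [dp_coef].
   The c_j are not required to be distinct (if they are, [dp_degree] is the degree
   as a polynomial in the shifts; otherwise it is that of the given expression).
   [is_diffpoly f P] says that the a_l are admissible coefficients relative to
   [f]. *)
Record diffpoly (R : realType) := DiffPoly {
  dp_size : nat;
  dp_shift : 'I_dp_size -> R[i];
  dp_supp : {fset {ffun 'I_dp_size -> nat}};
  dp_coef : {ffun 'I_dp_size -> nat} -> R[i] -> R[i]
}.

Definition dp_eval (R : realType) (P : diffpoly R) (f : R[i] -> R[i]) (z : R[i]) :
    R[i] :=
  \sum_(l <- dp_supp P) dp_coef l z * \prod_(j < dp_size P) f (z + dp_shift j) ^+ l j.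

Definition is_diffpoly (R : realType) (f : R[i] -> R[i]) (P : diffpoly R) : Prop :=
  forall l, l \in dp_supp P ->
    meromorphic (dp_coef l) /\
    exists2 E : set R, finite_log_measure E &
      characteristic (dp_coef l) =o_ (infty_off E) characteristic f.

Definition dp_terms (R : realType) (P : diffpoly R) :
    seq {ffun 'I_(dp_size P) -> nat} :=
  [seq l <- dp_supp P | `[< ~ mero_eq (dp_coef l) (cst 0) >]].

Definition dp_degree (R : realType) (P : diffpoly R) : nat :=
  (\max_(l <- dp_terms P) \sum_(j < dp_size P) l j)%N.

(* max |c_j| over the shifts that occur in a nonzero term of [P] *)
Definition dp_maxshift (R : realType) (P : diffpoly R) : R :=
  \big[Num.max/0]_(j < dp_size P | has (fun l : {ffun _} => l j != 0%N) (dp_terms P))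
    normc (dp_shift j).

(* Main.v *)
(** Where |f| <= 1 the terms of P(z,f), and where |f| > 1 those of Q(z,f)/f^n, are bounded by
    coefficients times powers of the quotients f(z + c_j)/f(z). So m(r,P) is at most a sum of
    m(r,a_l) = o(T(r,f)) and of multiples of m(r, f(z + c_j)/f), and everything rests on the
    difference analogue of the lemma on the logarithmic derivative.

    On a disc of radius r1 > r + c write f = F prod(z - q)/prod(z - p) with F zero-free. The
    Schwarz formula compares log|F| at z + c_j and z, and each linear factor costs a multiple of
    |z - q|^-d, whose circle mean is O(r^-d) for d < 1 uniformly in q by Kolmogorov's trick. This
    bounds m(r, f(z + c_j)/f) in terms of T(r1,f) and of the number of zeros and poles in the
    disc. With r1 - (r + c) of size r T(r + c,f)^(-eps/3), a Borel growth argument makes the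
    characteristics at r + c and near r1 comparable off a set of finite logarithmic measure.

    Circle means are only taken for radii whose circle meets neither zeros nor poles: the
    integrands are then continuous, and the other radii form a countable set. The means of a
    holomorphic function do not depend on the radius because in the coordinate log z an annulus is
    a rectangle, to which Goursat's bisection applies; Cauchy's formula, the Poisson and Jensen
    formulas and the first main theorem follow from this. *)
Require Import Defs.
From HB Require Import structures.
From mathcomp Require Import all_boot all_order all_algebra.
From mathcomp Require Import finmap all_classical all_reals all_analysis.
From mathcomp Require Import complex.
From mathcomp Require Import measurable_realfun ring lra.
Set Implicit Arguments.
Unset Strict Implicit.
Unset Printing Implicit Defensive.
Import Order.TTheory GRing.Theory Num.Theory.
Import numFieldNormedType.Exports.
Import ComplexField.Normc.
Local Open Scope classical_set_scope.
Local Open Scope ring_scope.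
Local Open Scope complex_scope.
Local Notation Re := complex.Re.
Local Notation Im := complex.Im.

(** * Continuity and differentiability on [R[i]] *)

Section complex_local.
Variable R : realType.
Implicit Types (z w : R[i]) (f g h : R[i] -> R[i]) (P Q : R[i] -> Prop).

(** The exponent [eps] pays for three losses, each a factor [T(r + c)^(eps/3)]: one when pole counts
    are bounded by counting functions on a slightly larger circle, two from the squared distance
    between the circles in the Schwarz kernel. The factor [ln (2 * r1)], lost in comparing
    [|ln |F||] with [f], costs [r^(1 - d)] of the gain [1 / r] of that kernel, which leaves [r^-d].
    Taking [d] strictly between [delta] and 1 then turns a bound into a little-o. Two obstacles
    shape the rest. The growth argument wants a monotone function, but characteristics are only
    compared on circles free of zeros and poles, so a supremum over such radii takes their place.
    And a representative of a meromorphic function has arbitrary values on a discrete set, so the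
    equation, and the vanishing of a zero coefficient, hold pointwise only off such a set, whose
    radii join the exceptional set. Uniform continuity, finiteness of discrete sets and
    connectedness all come from the bisection principle [box_ind] that also proves Goursat's
    theorem. *)

Lemma normc_ge0 z : 0 <= normc z.
Proof. by case: z => a b; rewrite /normc sqrtr_ge0. Qed.

Lemma normc_eq0 z : (normc z == 0) = (z == 0).
Proof.
by apply/eqP/eqP => [/eq0_normc //|->]; rewrite normc0.
Qed.

Lemma normc_gt0 z : (0 < normc z) = (z != 0).
Proof. by rewrite lt_neqAle normc_ge0 andbT eq_sym normc_eq0. Qed.

Lemma normcR (x : R) : normc x%:C = `|x|.
Proof. by rewrite /normc/= expr0n addr0 sqrtr_sqr. Qed.

Lemma normcBC z w : normc (z - w) = normc (w - z).
Proof. by rewrite -normcN opprB. Qed.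

Lemma normcX z n : normc (z ^+ n) = normc z ^+ n.
Proof.
by elim: n => [|n IH]; [rewrite !expr0 normc1 | rewrite !exprS normcM IH].
Qed.

Lemma normcD z w : normc (z + w) <= normc z + normc w.
Proof. exact: le_normcD. Qed.

Lemma normcB z w : normc (z - w) <= normc z + normc w.
Proof. by rewrite -(normcN w) le_normcD. Qed.

Lemma normc_geB z w : normc z - normc w <= normc (z - w).
Proof. by rewrite lerBlDr -{1}[z](subrK w) le_normcD. Qed.

Lemma normc_dist z w : `|normc z - normc w| <= normc (z - w).
Proof. by rewrite ler_norml normc_geB lerNl opprB normcBC normc_geB. Qed.

Lemma ger_Re z : `|Re z| <= normc z.
Proof. by case: z => a b /=; rewrite -sqrtr_sqr ler_sqrt ?lerDl ?sqr_ge0 ?addr_ge0 ?sqr_ge0. Qed.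

Lemma ger_Im z : `|Im z| <= normc z.
Proof. by case: z => a b /=; rewrite -sqrtr_sqr ler_sqrt ?lerDr ?sqr_ge0 ?addr_ge0 ?sqr_ge0. Qed.

Lemma normc_leRI z : normc z <= `|Re z| + `|Im z|.
Proof.
case: z => a b /=; rewrite -[leRHS]ger0_norm ?addr_ge0// -sqrtr_sqr ler_sqrt ?sqr_ge0//.
rewrite sqrrD !real_normK ?num_real// addrAC lerDl.
by rewrite mulrn_wge0// mulr_ge0.
Qed.

Lemma sqr_normcE z : normc z ^+ 2 = Re z ^+ 2 + Im z ^+ 2.
Proof. by case: z => a b /=; rewrite sqr_sqrtr ?addr_ge0 ?sqr_ge0. Qed.

Lemma ReD z w : Re (z + w) = Re z + Re w. Proof. by case: z w => ? ? []. Qed.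
Lemma ImD z w : Im (z + w) = Im z + Im w. Proof. by case: z w => ? ? []. Qed.
Lemma ReN z : Re (- z) = - Re z. Proof. by case: z. Qed.
Lemma ImN z : Im (- z) = - Im z. Proof. by case: z. Qed.
Lemma ReB z w : Re (z - w) = Re z - Re w. Proof. by rewrite ReD ReN. Qed.
Lemma ImB z w : Im (z - w) = Im z - Im w. Proof. by rewrite ImD ImN. Qed.
Lemma normc_circle (r t : R) : normc (circle_pt r t) = `|r|.
Proof.
by rewrite /circle_pt /normc/= !exprMn -mulrDr cos2Dsin2 mulr1 sqrtr_sqr.
Qed.

Lemma normc_conj z : normc z^*%C = normc z.
Proof. by case: z => a b /=; rewrite sqrrN. Qed.

Lemma mulcJ z : z * z^*%C = (normc z ^+ 2)%:C.
Proof.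
rewrite sqr_normcE; case: z => a b; simpc.
by congr Complex; rewrite ?expr2 //; ring.
Qed.

(** Radii are real here; in the normed structure of [R[i]] over itself they are elements of
    [R[i]]. *)
Definition cnear z P := exists2 e : R, 0 < e & forall w, normc (w - z) < e -> P w.

Lemma cnearP z P : (\forall w \near z, P w) <-> cnear z P.
Proof.
split=> [/nbhs_ballP[[e1 e2] /=]|[e e0 H]].
  rewrite ltcE/= => /andP[/eqP -> e0] H; exists e1 => // w we.
  by apply: H; rewrite /ball/= distrC -ltcR in we *.
apply/nbhs_ballP; exists (e%:C) => /=; first by rewrite ltcE/= eqxx.
by move=> w; rewrite /ball/= distrC => h; apply: H; rewrite -ltcR.
Qed.

Lemma dcnearP z P : (\forall w \near z^', P w) <-> cnear z (fun w => w != z -> P w).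
Proof. by rewrite -cnearP; split. Qed.

Lemma cnearI z P Q : cnear z P -> cnear z Q -> cnear z (fun w => P w /\ Q w).
Proof.
move=> [e e0 H] [e' e'0 H']; exists (Num.min e e'); first by rewrite lt_min e0.
by move=> w; rewrite lt_min => /andP[? ?]; split; [apply: H | apply: H'].
Qed.

Lemma cnearS z P Q : (forall w, P w -> Q w) -> cnear z P -> cnear z Q.
Proof. by move=> PQ [e e0 H]; exists e => // w /H /PQ. Qed.

Lemma cnearT z P : (forall w, P w) -> cnear z P.
Proof. by move=> H; exists 1. Qed.

Lemma cnear_self z P : cnear z P -> P z.
Proof. by move=> [e e0]; apply; rewrite subrr normc0. Qed.

Lemma cnear_near z P : cnear z P -> cnear z (fun w => cnear w P).
Proof.
move=> [e e0 H]; exists e => // w we; exists (e - normc (w - z)).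
  by rewrite subr_gt0.
move=> v vw; apply: H; rewrite -[v](subrK w) -addrA.
by rewrite (le_lt_trans (normcD _ _))// -ltrBrDr.
Qed.

Lemma cnear_out z (r : R) : r < normc z -> cnear z (fun w => r < normc w).
Proof.
move=> zr; exists (normc z - r); first by rewrite subr_gt0.
move=> w; rewrite normcBC ltrBrDr -ltrBrDl => H; apply: lt_le_trans H _.
by rewrite lerBlDr addrC -lerBlDr normc_geB.
Qed.

Lemma cnear_neq z w : z != w -> cnear z (fun v => v != w).
Proof.
move=> zw; exists (normc (z - w)); first by rewrite normc_gt0 subr_eq0.
by move=> v; apply: contraTneq => ->; rewrite normcBC ltxx.
Qed.

Definition rcont (u : R[i] -> R) z :=
  forall e : R, 0 < e -> cnear z (fun w => `|u w - u z| < e).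

Definition ccont f z := forall e : R, 0 < e -> cnear z (fun w => normc (f w - f z) < e).

Lemma ccont_cst (c : R[i]) z : ccont (fun=> c) z.
Proof. by move=> e e0; exists 1 => // w _; rewrite subrr normc0. Qed.

Lemma ccont_id z : ccont (fun w => w) z.
Proof. by move=> e e0; exists e. Qed.

Lemma ccontD f g z : ccont f z -> ccont g z -> ccont (fun w => f w + g w) z.
Proof.
move=> cf cg e e0; have e20 : 0 < e / 2 by rewrite divr_gt0.
apply: cnearS (cnearI (cf _ e20) (cg _ e20)) => w [H1 H2].
rewrite (_ : f w + g w - _ = (f w - f z) + (g w - g z)); last by ring.
by rewrite (le_lt_trans (normcD _ _))// [e]splitr ltrD.
Qed.

Lemma ccontN f z : ccont f z -> ccont (fun w => - f w) z.
Proof.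
move=> cf e e0; apply: cnearS (cf _ e0) => w.
by rewrite -normcN opprB opprK addrC.
Qed.

Lemma ccontB f g z : ccont f z -> ccont g z -> ccont (fun w => f w - g w) z.
Proof. by move=> cf cg; apply: ccontD => //; apply: ccontN. Qed.

Lemma ccont_comp f g z : ccont g z -> ccont f (g z) -> ccont (fun w => f (g w)) z.
Proof.
move=> cg cf e e0; have [d d0 H] := cf _ e0.
by apply: cnearS (cg _ d0) => w /H.
Qed.

Lemma ccont_bounded f z : ccont f z -> cnear z (fun w => normc (f w) < normc (f z) + 1).
Proof.
move=> /(_ 1 ltr01); apply: cnearS => w H.
by rewrite -ltrBlDl (le_lt_trans _ H)// normc_geB.
Qed.

Lemma ccontM f g z : ccont f z -> ccont g z -> ccont (fun w => f w * g w) z.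
Proof.
move=> cf cg e e0.
set A := normc (f z) + 1; set B := normc (g z) + 1.
have A0 : 0 < A by rewrite ltr_wpDl ?normc_ge0.
have B0 : 0 < B by rewrite ltr_wpDl ?normc_ge0.
have eA : 0 < e / 2 / A by rewrite !divr_gt0.
have eB : 0 < e / 2 / B by rewrite !divr_gt0.
apply: cnearS (cnearI (ccont_bounded cf) (cnearI (cf _ eB) (cg _ eA))) => w [H1 [H2 H3]].
rewrite (_ : f w * g w - _ = f w * (g w - g z) + (f w - f z) * g z); last by ring.
rewrite (le_lt_trans (normcD _ _))// !normcM [e]splitr ltr_leD//.
  rewrite (@le_lt_trans _ _ (A * normc (g w - g z)))//.
    by rewrite ler_wpM2r ?normc_ge0// ltW.
  by rewrite mulrC -ltr_pdivlMr.
rewrite (@le_trans _ _ (normc (f w - f z) * B))//.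
  by rewrite ler_wpM2l ?normc_ge0// lerDl.
by rewrite -ler_pdivlMr// ltW.
Qed.

Lemma ccontV f z : ccont f z -> f z != 0 -> ccont (fun w => (f w)^-1) z.
Proof.
move=> cf fz e e0; have n0 : 0 < normc (f z) by rewrite normc_gt0.
set a := normc (f z) in n0 *.
have a2 : 0 < a / 2 by rewrite divr_gt0.
have ea : 0 < e * (a / 2 * a) by rewrite !mulr_gt0// divr_gt0.
apply: cnearS (cnearI (cf _ a2) (cf _ ea)) => w [H1 H2].
have fw : a / 2 < normc (f w).
  have := normc_geB (f z) (f w); rewrite normcBC -/a; move: H1; lra.
have fw0 : f w != 0 by rewrite -normc_gt0 (lt_trans a2).
rewrite (_ : _ - _ = - (f w - f z) / (f w * f z)); last by field; rewrite fw0 fz.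
rewrite normcM normcN normcV normcM -/a ltr_pdivrMr; last by rewrite mulr_gt0// (lt_trans a2).
rewrite (lt_trans H2)// ltr_pM2l// ltr_pM2r//.
Qed.

Lemma ccont_div f g z : ccont f z -> ccont g z -> g z != 0 -> ccont (fun w => f w / g w) z.
Proof. by move=> cf cg gz; apply: ccontM => //; exact: ccontV. Qed.

Lemma ccont_near f g z : cnear z (fun w => f w = g w) -> ccont f z -> ccont g z.
Proof.
move=> H cf e e0; have <- := cnear_self H.
by apply: cnearS (cnearI H (cf _ e0)) => w [<-].
Qed.

Lemma ccontJ z : ccont (fun w => w^*%C) z.
Proof. by move=> e e0; exists e => // w; rewrite -rmorphB normc_conj. Qed.

Lemma ccontX f n z : ccont f z -> ccont (fun w => f w ^+ n) z.
Proof.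
move=> cf; elim: n => [|n IH]; first exact: (@ccont_cst 1).
by move: (ccontM cf IH); apply: ccont_near; apply: cnearT => w; rewrite exprS.
Qed.

Lemma ccont_sum (I : Type) (s : seq I) (F : I -> R[i] -> R[i]) z :
  (forall i, ccont (F i) z) -> ccont (fun w => \sum_(i <- s) F i w) z.
Proof.
move=> H; elim: s => [|i s IH].
  by apply: (ccont_near _ (ccont_cst 0 z)); apply: cnearT => w; rewrite big_nil.
by apply: (ccont_near _ (ccontD (H i) IH)); apply: cnearT => w; rewrite big_cons.
Qed.

Lemma ccont_prod (I : Type) (s : seq I) (F : I -> R[i] -> R[i]) z :
  (forall i, ccont (F i) z) -> ccont (fun w => \prod_(i <- s) F i w) z.
Proof.
move=> H; elim: s => [|i s IH].
  by apply: (ccont_near _ (ccont_cst 1 z)); apply: cnearT => w; rewrite big_nil.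
by apply: (ccont_near _ (ccontM (H i) IH)); apply: cnearT => w; rewrite big_cons.
Qed.

Lemma ccont_neq0 f z : ccont f z -> f z != 0 -> cnear z (fun w => f w != 0).
Proof.
move=> cf fz; have n0 : 0 < normc (f z) by rewrite normc_gt0.
apply: cnearS (cf _ n0) => w; apply: contraTneq => ->.
by rewrite sub0r normcN ltxx.
Qed.

Lemma rcont_Re f z : ccont f z -> rcont (fun w => Re (f w)) z.
Proof.
by move=> cf e e0; apply: cnearS (cf e e0) => w; apply: le_lt_trans; rewrite -ReB ger_Re.
Qed.

Lemma rcont_Im f z : ccont f z -> rcont (fun w => Im (f w)) z.
Proof.
by move=> cf e e0; apply: cnearS (cf e e0) => w; apply: le_lt_trans; rewrite -ImB ger_Im.
Qed.

Lemma rcont_normc f z : ccont f z -> rcont (fun w => normc (f w)) z.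
Proof.
by move=> cf e e0; apply: cnearS (cf e e0) => w; apply: le_lt_trans; rewrite normc_dist.
Qed.

Lemma rcont_comp (u : R[i] -> R) (v : R -> R) z :
  rcont u z -> {for (u z), continuous v} -> rcont (fun w => v (u w)) z.
Proof.
move=> cu /cvgrPdist_lt cv e e0; have /nbhs_ballP[d /= d0 H] := cv _ e0.
apply: cnearS (cu _ d0) => w uw; rewrite distrC; apply: H.
by rewrite /ball/= distrC.
Qed.

Lemma rcontC (u : R[i] -> R) z : rcont u z <-> ccont (fun w => (u w)%:C) z.
Proof.
by split=> H e e0; apply: cnearS (H e e0) => w; rewrite -rmorphB normcR.
Qed.

(* Caratheodory's form of differentiability: no division by [w - z]. *)
Definition cdiff f z := exists2 p, ccont p z & forall w, f w = f z + p w * (w - z).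

Lemma cdiff_cont f z : cdiff f z -> ccont f z.
Proof.
move=> [p cp H]; apply: (@ccont_near (fun w => f z + p w * (w - z))).
  by apply: cnearT => w; rewrite [RHS]H.
apply: ccontD; first exact: ccont_cst.
by apply: ccontM => //; apply: ccontB; [exact: ccont_id | exact: ccont_cst].
Qed.

Lemma cdiff_near f g z : cnear z (fun w => f w = g w) -> cdiff f z -> cdiff g z.
Proof.
move=> H [p cp fp].
(* Off [z] the slope is forced to be the difference quotient of [g]; it agrees with [p] only near
   [z], which is enough for continuity. *)
exists (fun w => if w == z then p z else (g w - g z) / (w - z)).
  apply: ccont_near cp; apply: cnearS (H) => w fg.
  case: eqP => [->//|/eqP wz]; rewrite -fg -(cnear_self H) fp; field.
  by rewrite subr_eq0.
move=> w; case: eqP => [->|/eqP wz]; first by rewrite subrr mulr0 addr0.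
by field; rewrite subr_eq0.
Qed.

Lemma cdiff_cst (c : R[i]) z : cdiff (fun=> c) z.
Proof. by exists (fun=> 0); [exact: ccont_cst | move=> w; rewrite mul0r addr0]. Qed.

Lemma cdiff_id z : cdiff (fun w => w) z.
Proof. by exists (fun=> 1); [exact: ccont_cst | move=> w; rewrite mul1r addrC subrK]. Qed.

Lemma cdiffD f g z : cdiff f z -> cdiff g z -> cdiff (fun w => f w + g w) z.
Proof.
move=> [p cp fp] [q cq gq]; exists (fun w => p w + q w); first exact: ccontD.
by move=> w; rewrite fp gq; ring.
Qed.

Lemma cdiffM f g z : cdiff f z -> cdiff g z -> cdiff (fun w => f w * g w) z.
Proof.
move=> df dg; have cg := cdiff_cont dg; move: df dg => [p cp fp] [q cq gq].
exists (fun w => p w * g w + f z * q w).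
  by apply: ccontD; apply: ccontM => //; exact: ccont_cst.
by move=> w; rewrite fp gq; ring.
Qed.

Lemma cdiffN f z : cdiff f z -> cdiff (fun w => - f w) z.
Proof.
move=> [p cp fp]; exists (fun w => - p w); first exact: ccontN.
by move=> w; rewrite fp; ring.
Qed.

Lemma cdiffB f g z : cdiff f z -> cdiff g z -> cdiff (fun w => f w - g w) z.
Proof. by move=> df dg; apply: cdiffD => //; exact: cdiffN. Qed.

Lemma cdiffV f z : cdiff f z -> f z != 0 -> cdiff (fun w => (f w)^-1) z.
Proof.
move=> df fz; have cf := cdiff_cont df; move: df => [p cp fp].
(* [cdiff] asks for its identity at every [w], and the slope [- p w / (f z * f w)] fails it where
   [f w = 0]. The function is altered at those points, all away from [z], so that the identity is
   immediate there. *)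
apply: (@cdiff_near (fun w => if f w == 0 then (f z)^-1 + - p w / (f z * f z) * (w - z) else (f w)^-1)).
  by apply: cnearS (ccont_neq0 cf fz) => w /negbTE ->.
rewrite /cdiff (negbTE fz).
exists (fun w => - p w / (f z * (if f w == 0 then f z else f w))).
  apply: ccont_div; first exact: ccontN.
    apply: ccontM; first exact: ccont_cst.
    by apply: ccont_near (cf); apply: cnearS (ccont_neq0 cf fz) => w /negbTE ->.
  by rewrite (negbTE fz) mulf_neq0.
move=> w; case: eqP => [//|/eqP fw]; rewrite [in RHS]mulNr.
have -> : p w = (f w - f z) / (w - z) + (if w == z then p w else 0).
  case: eqP => [->|/eqP wz]; first by rewrite !subrr mul0r add0r.
  by rewrite [in RHS]fp; field; rewrite subr_eq0.
case: eqP => [->|/eqP wz]; first by rewrite !subrr mulr0 addr0.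
by field; rewrite fz fw subr_eq0 wz.
Qed.

Lemma cdiff_div f g z : cdiff f z -> cdiff g z -> g z != 0 -> cdiff (fun w => f w / g w) z.
Proof. by move=> df dg gz; apply: cdiffM => //; exact: cdiffV. Qed.

Lemma cdiff_comp f g z : cdiff g z -> cdiff f (g z) -> cdiff (fun w => f (g w)) z.
Proof.
move=> dg; have cg := cdiff_cont dg; move: dg => [q cq gq] [p cp fp].
exists (fun w => p (g w) * q w).
  by apply: ccontM => //; exact: ccont_comp.
move=> w; rewrite fp [g w - g z](_ : _ = q w * (w - z)) ?mulrA//.
by rewrite gq addrC addKr.
Qed.

Lemma cdiffX f n z : cdiff f z -> cdiff (fun w => f w ^+ n) z.
Proof.
move=> df; elim: n => [|n IH]; first exact: (@cdiff_cst 1).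
by move: (cdiffM df IH); apply: cdiff_near; apply: cnearT => w; rewrite exprS.
Qed.

Lemma cdiff_prod (I : Type) (s : seq I) (F : I -> R[i] -> R[i]) z :
  (forall i, cdiff (F i) z) -> cdiff (fun w => \prod_(i <- s) F i w) z.
Proof.
move=> H; elim: s => [|i s IH].
  by apply: (cdiff_near _ (cdiff_cst 1 z)); apply: cnearT => w; rewrite big_nil.
by apply: (cdiff_near _ (cdiffM (H i) IH)); apply: cnearT => w; rewrite big_cons.
Qed.

Lemma cdiff_epsl f z (l : R[i]) :
  (forall e : R, 0 < e -> cnear z (fun w => normc (f w - f z - l * (w - z)) <= e * normc (w - z))) ->
  exists p, [/\ ccont p z, p z = l & forall w, f w = f z + p w * (w - z)].
Proof.
move=> H; exists (fun w => if w == z then l else (f w - f z) / (w - z)); split.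
- move=> e e0; rewrite eqxx; have e20 : 0 < e / 2 by rewrite divr_gt0.
  apply: cnearS (H _ e20) => w; case: eqP => [_ _|/eqP wz].
    by rewrite subrr normc0.
  have wz0 : w - z != 0 by rewrite subr_eq0.
  rewrite (_ : _ / _ - l = (f w - f z - l * (w - z)) / (w - z)); last by field.
  rewrite normcM normcV -ler_pdivrMr ?normc_gt0// => /le_lt_trans; apply.
  by rewrite ltr_pdivrMr// ltr_pMr// ltr1n.
- by rewrite eqxx.
- move=> w; case: eqP => [->|/eqP wz]; first by rewrite subrr mulr0 addr0.
  by field; rewrite subr_eq0.
Qed.

Lemma cdiff_eps f z (l : R[i]) :
  (forall e : R, 0 < e -> cnear z (fun w => normc (f w - f z - l * (w - z)) <= e * normc (w - z))) ->
  cdiff f z.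
Proof. by move=> /cdiff_epsl[p [cp _ fp]]; exists p. Qed.

Lemma derivable_eps f z : derivable f z 1 ->
  exists l : R[i], forall e : R, 0 < e ->
  cnear z (fun w => normc (f w - f z - l * (w - z)) <= e * normc (w - z)).
Proof.
move=> /cvg_ex[/= l /cvgrPdist_lt fl]; exists l => e e0.
have e0' : 0 < e%:C by rewrite ltcE/= eqxx.
have /nbhs_ballP[[d1 d2] /=] := fl _ e0'.
rewrite ltcE/= => /andP[/eqP -> d0] H; exists d1 => // w wd.
have [->|wz] := eqVneq w z; first by rewrite !subrr mulr0 subr0 normc0 mulr0.
have wz0 : w - z != 0 by rewrite subr_eq0.
have := H (w - z); rewrite /ball/= sub0r normrN -ltcR in wd *.
move=> /(_ wd wz0); rewrite (_ : _ *: 1 + z = w); last by rewrite scaler1 subrK.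
rewrite ltcE/= => /andP[_] {}H.
rewrite -ler_pdivrMr ?normc_gt0// -normcV -normcM -normcN ltW//.
apply: le_lt_trans H; rewrite le_eqVlt; apply/orP; left; apply/eqP.
by congr normc; rewrite /GRing.scale/=; field.
Qed.

Lemma derivable_cdiff f z : derivable f z 1 -> cdiff f z.
Proof. by move=> /derivable_eps[l /cdiff_eps]. Qed.

Lemma cdiff_derivable f z : cdiff f z -> derivable f z 1.
Proof.
move=> [p cp fp]; apply/cvg_ex; exists (p z); apply/cvgrPdist_lt => -[e1 e2].
rewrite ltcE/= => /andP[/eqP -> e0]; have [d d0 H] := cp _ e0.
apply/nbhs_ballP; exists d%:C => /=; first by rewrite ltcE/= eqxx.
move=> w; rewrite /ball/= sub0r normrN => wd w0.
rewrite ltcE/= eqxx/= (_ : _ - _ = p z - p (w + z)).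
  by rewrite normcBC; apply: H; rewrite addrK -ltcR.
rewrite (_ : _ *: 1 + z = w + z); last by rewrite scaler1.
by rewrite fp addrK addrAC subrr add0r /GRing.scale/= [p _ * w]mulrC mulKf.
Qed.

End complex_local.

(** * Real integrals over segments *)

Section real_integral.
Variable R : realType.
Notation mu := (@lebesgue_measure R).
Implicit Types (f g : R -> R) (a b c : R).

Definition contI a b f := forall t, a <= t <= b -> {for t, continuous f}.

Lemma contI_within a b f : contI a b f -> {within `[a, b], continuous f}.
Proof.
by move=> cf; apply: continuous_in_subspaceT => t; rewrite inE/= in_itv/=; exact: cf.
Qed.

Lemma contI_integrable a b f : contI a b f -> mu.-integrable `[a, b] (EFin \o f).
Proof.
move=> cf; apply: continuous_compact_integrable; first exact: segment_compact.
exact: contI_within.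
Qed.

Lemma contI_sub a b c d f : a <= c -> d <= b -> contI a b f -> contI c d f.
Proof. by move=> ac db cf t /andP[ct td]; apply: cf; rewrite (le_trans ac)// (le_trans td). Qed.

Lemma contI_cst a b c : contI a b (fun=> c).
Proof. by move=> t _; exact: cvg_cst. Qed.

Lemma contID a b f g : contI a b f -> contI a b g -> contI a b (fun t => f t + g t).
Proof. by move=> cf cg t tab; apply: cvgD; [exact: cf | exact: cg]. Qed.

Lemma contIN a b f : contI a b f -> contI a b (fun t => - f t).
Proof. by move=> cf t tab; apply: cvgN; exact: cf. Qed.

Lemma contIM a b f g : contI a b f -> contI a b g -> contI a b (fun t => f t * g t).
Proof. by move=> cf cg t tab; apply: cvgM; [exact: cf | exact: cg]. Qed.

Lemma eq_Rint a b f g : (forall t, a <= t <= b -> f t = g t) ->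
  \int[mu]_(t in `[a, b]) f t = \int[mu]_(t in `[a, b]) g t.
Proof. by move=> H; apply: eq_Rintegral => t; rewrite inE/= in_itv/=; exact: H. Qed.

Lemma RintD a b f g : contI a b f -> contI a b g ->
  \int[mu]_(t in `[a, b]) (f t + g t) =
  \int[mu]_(t in `[a, b]) f t + \int[mu]_(t in `[a, b]) g t.
Proof. by move=> cf cg; rewrite RintegralD//; exact: contI_integrable. Qed.

Lemma RintZ a b f k : contI a b f ->
  \int[mu]_(t in `[a, b]) (k * f t) = k * \int[mu]_(t in `[a, b]) f t.
Proof. by move=> cf; rewrite RintegralZl//; exact: contI_integrable. Qed.

Lemma RintN a b f : contI a b f ->
  \int[mu]_(t in `[a, b]) (- f t) = - \int[mu]_(t in `[a, b]) f t.
Proof. by move=> cf; rewrite -mulN1r -RintZ//; apply: eq_Rint => t _; rewrite mulN1r. Qed.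

Lemma RintB a b f g : contI a b f -> contI a b g ->
  \int[mu]_(t in `[a, b]) (f t - g t) =
  \int[mu]_(t in `[a, b]) f t - \int[mu]_(t in `[a, b]) g t.
Proof. by move=> cf cg; rewrite RintD ?RintN//; exact: contIN. Qed.

Lemma le_Rint a b f g : contI a b f -> contI a b g ->
  (forall t, a <= t <= b -> f t <= g t) ->
  \int[mu]_(t in `[a, b]) f t <= \int[mu]_(t in `[a, b]) g t.
Proof.
move=> cf cg H; apply: le_Rintegral; [by []|exact: contI_integrable| exact: contI_integrable|].
by move=> t; rewrite /= in_itv/=; apply: H.
Qed.

Lemma Rint_cst a b k : a <= b -> \int[mu]_(t in `[a, b]) k = k * (b - a).
Proof.
move=> ab; rewrite Rintegral_cst//.
congr (_ * _); transitivity (fine (if a < b then (b%:E - a%:E)%E else 0%E)).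
  by congr fine; rewrite -lte_fin; exact: (lebesgue_measure_itv `[a, b]).
have [//|ba] := ltP a b; have -> : a = b by apply/eqP; rewrite eq_le ab ba.
by rewrite subrr.
Qed.

Lemma Rint_pt a f : \int[mu]_(t in `[a, a]) f t = 0.
Proof. by rewrite set_itv1 Rintegral_set1. Qed.

Lemma Rint_split a b c f : a <= c -> c <= b -> contI a b f ->
  \int[mu]_(t in `[a, b]) f t =
  \int[mu]_(t in `[a, c]) f t + \int[mu]_(t in `[c, b]) f t.
Proof.
move=> ac cb cf.
have := @Rintegral_itvB R f (BLeft a) (BRight b) c (contI_integrable cf).
rewrite !bnd_simp => /(_ ac cb) H.
have <- : \int[mu]_(x in `]c, b]) f x = \int[mu]_(x in `[c, b]) f x; last by rewrite -H addrC subrK.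
apply: Rintegral_itv_obnd_cbnd.
apply: (integrableS _ _ _ (contI_integrable (contI_sub ac (lexx b) cf))) => //.
by apply: subset_itvr; rewrite bnd_simp.
Qed.

Lemma normr_Rint a b f M : a <= b -> contI a b f ->
  (forall t, a <= t <= b -> `|f t| <= M) ->
  `|\int[mu]_(t in `[a, b]) f t| <= M * (b - a).
Proof.
move=> ab cf H; rewrite -(Rint_cst _ ab) ler_norml -RintN; last exact: contI_cst.
apply/andP; split; apply: le_Rint => //; try exact: contI_cst.
  by move=> t /H; rewrite ler_norml => /andP[].
by move=> t /H; rewrite ler_norml => /andP[].
Qed.

Lemma Rint_FTC a b f F : a <= b -> contI a b f ->
  (forall t, a <= t <= b -> is_derive t 1 F (f t)) ->
  \int[mu]_(t in `[a, b]) f t = F b - F a.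
Proof.
rewrite le_eqVlt => /predU1P[<-|ab] cf dF; first by rewrite Rint_pt subrr.
have ab' := ltW ab.
have cF t : a <= t <= b -> {for t, continuous F}.
  by move=> /dF dt; apply: differentiable_continuous; apply/derivable1_diffP; case: dt.
rewrite /Rintegral (@continuous_FTC2 _ f F)//.
- exact: contI_within.
- split.
  + by move=> t; rewrite in_itv/= => /andP[at' tb]; have [] := dF t; rewrite ?(ltW at') ?(ltW tb).
  + by apply: cvg_at_right_filter; apply: cF; rewrite lexx.
  + by apply: cvg_at_left_filter; apply: cF; rewrite lexx ab'.
- move=> t; rewrite in_itv/= => /andP[at' tb].
  by rewrite derive1E; apply: derive_val; apply: dF; rewrite (ltW at') (ltW tb).
Qed.

Lemma Rint_affine a b k l : a <= b ->
  \int[mu]_(t in `[a, b]) (k + l * t) = k * (b - a) + l * (b ^+ 2 - a ^+ 2) / 2.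
Proof.
move=> ab; pose F (t : R) : R := k * t + l / 2 * t ^+ 2.
transitivity (F b - F a); last by rewrite /F; field.
apply: Rint_FTC => //.
- by apply: contID; [exact: contI_cst | apply: contIM; [exact: contI_cst | move=> t _; exact: cvg_id]].
- by move=> t _; apply: is_derive_eq; rewrite /GRing.scale/=; field.
Qed.

Lemma is_derive_eps f (x l : R) : is_derive x 1 f l ->
  forall e : R, 0 < e -> exists2 d : R, 0 < d &
  forall h, `|h| < d -> `|f (x + h) - f x - l * h| <= e * `|h|.
Proof.
move=> [df fl] e e0; move: df => /cvg_ex[/= k H].
have kl : k = l by rewrite -fl; apply/esym/cvg_lim.
move: H => /cvgrPdist_lt/(_ _ e0)/nbhs_ballP[d /= d0 H]; exists d => // h hd.
have [->|h0] := eqVneq h 0; first by rewrite addr0 subrr !mulr0 subr0 normr0 mulr0.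
have := H h; rewrite /ball/= sub0r normrN => /(_ hd h0).
rewrite scaler1 [h + x]addrC -kl => /ltW; rewrite /GRing.scale/=.
rewrite -(ler_pM2r (x := `|h|)) ?normr_gt0// -normrM => K.
apply: le_trans K; rewrite -normrN (_ : - (f (x + h) - f x - k * h) = (k - h^-1 * (f (x + h) - f x)) * h)//.
by field.
Qed.

End real_integral.

(** * Exponential and logarithm *)

Section exp_log.
Variable R : realType.
Implicit Types (z w : R[i]) (x t : R).

Definition cexp z : R[i] := circle_pt (expR (Re z)) (Im z).

Lemma cexpD z w : cexp (z + w) = cexp z * cexp w.
Proof.
rewrite /cexp /circle_pt ReD ImD expRD cosD sinD; simpc.
by congr Complex; ring.
Qed.

Lemma cexp0 : cexp 0 = 1.
Proof. by rewrite /cexp /circle_pt expR0 cos0 sin0 mulr1 mulr0. Qed.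

Lemma normc_cexp z : normc (cexp z) = expR (Re z).
Proof. by rewrite normc_circle ger0_norm// expR_ge0. Qed.

Lemma cexp_neq0 z : cexp z != 0.
Proof. by rewrite -normc_gt0 normc_cexp expR_gt0. Qed.

Lemma circle_ptE r t : 0 < r -> circle_pt r t = cexp (ln r +i* t).
Proof. by move=> r0; rewrite /cexp /= lnK. Qed.

(** The derivative of [cexp] at 0, from the first-order expansions of [expR], [cos] and [sin];
    [cexpD] carries it to the other points. *)
Lemma cexp_eps0 e : 0 < e ->
  cnear 0 (fun h => normc (cexp h - 1 - h) <= e * normc h).
Proof.
move=> e0.
(* The error terms add up to at most [6 * e1 * normc h]; [e1 <= 1] keeps [expR a] below 2. *)
have e10 : 0 < Num.min 1 (e / 6) by rewrite lt_min ltr01/= divr_gt0.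
set e1 := Num.min 1 (e / 6) in e10.
have e11 : e1 <= 1 by rewrite ge_min lexx.
have e1e : 6 * e1 <= e by rewrite mulrC -ler_pdivlMr// ge_min lexx orbT.
have [d1 d10 H1] := is_derive_eps (is_derive_expR (0 : R)) e10.
have [d2 d20 H2] := is_derive_eps (is_derive_sin (0 : R)) e10.
have [d3 d30 H3] := is_derive_eps (is_derive_cos (0 : R)) e10.
exists (Num.min (e1 / 2) (Num.min d1 (Num.min d2 d3))).
  by rewrite !lt_min d10 d20 d30 divr_gt0.
move=> [a b]; rewrite subr0 !lt_min => /and4P[h0 h1 h2 h3].
have la := ger_Re (a +i* b); have lb := ger_Im (a +i* b); rewrite /= in la lb.
have {H1} := H1 a (le_lt_trans la h1).
have {H2} := H2 b (le_lt_trans lb h2).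
have {H3} := H3 b (le_lt_trans lb h3).
rewrite !add0r expR0 cos0 sin0 oppr0 mul0r !(subr0, addr0) !mul1r => H3 H2 H1.
apply: (le_trans (normc_leRI _)).
rewrite /cexp /circle_pt; simpc.
have A : `|expR a - 1| <= 2 * `|a|.
  rewrite -[expR a - 1](subrK a) (le_trans (ler_normD _ _))//.
  rewrite mulrDl mul1r lerD2r (le_trans H1)// ler_piMl//.
have A1 : `|expR a - 1| <= e1.
  rewrite (le_trans A)// mulrC -ler_pdivlMr// ltW// (le_lt_trans la)//.
have B : expR a <= 2.
  have := ler_norm (expR a - 1); move: A1 e11; lra.
have e0a := expR_ge0 a.
have S1 : `|expR a * cos b - 1 - a| <= e1 * `|a| + 2 * (e1 * `|b|).
  rewrite (_ : _ - a = (expR a - 1 - a) + expR a * (cos b - 1)); last by ring.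
  rewrite (le_trans (ler_normD _ _))// lerD// normrM (ger0_norm e0a) ler_pM//.
have S2 : `|expR a * sin b - b| <= 2 * (e1 * `|b|) + e1 * `|b|.
  rewrite (_ : _ - b = expR a * (sin b - b) + (expR a - 1) * b); last by ring.
  rewrite (le_trans (ler_normD _ _))// !normrM (ger0_norm e0a) lerD//.
    by rewrite ler_pM.
  by rewrite ler_wpM2r.
rewrite /=; apply: (@le_trans _ _ (6 * e1 * normc (a +i* b))); last first.
  by rewrite ler_wpM2r ?normc_ge0.
rewrite (le_trans (lerD S1 S2))//.
have X1 := ler_wpM2l (ltW e10) la; have X2 := ler_wpM2l (ltW e10) lb.
rewrite -[6 * e1 * _]mulrA /=; move: X1 X2; lra.
Qed.

Lemma cexp_diff z : exists p, [/\ ccont p z, p z = cexp z &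
  forall w, cexp w = cexp z + p w * (w - z)].
Proof.
apply: cdiff_epsl => e e0.
have e'0 : 0 < e / normc (cexp z) by rewrite divr_gt0// normc_gt0 cexp_neq0.
have [d d0 H] := cexp_eps0 e'0; exists d => // w wz.
have := H (w - z); rewrite subr0 => /(_ wz).
have -> : cexp w = cexp z * cexp (w - z) by rewrite -cexpD addrC subrK.
rewrite (_ : _ - cexp z * (w - z) = cexp z * (cexp (w - z) - 1 - (w - z))); last by ring.
rewrite normcM mulrAC ler_pdivlMr; first by rewrite mulrC.
by rewrite normc_gt0 cexp_neq0.
Qed.

Lemma cdiff_cexp z : cdiff cexp z.
Proof. by have [p [cp _ H]] := cexp_diff z; exists p. Qed.

(* The principal logarithm for [0 < Re z] only. *)
Definition cLog z : R[i] := ln (normc z) +i* atan (Im z / Re z).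

Lemma cLogK z : 0 < Re z -> cexp (cLog z) = z.
Proof.
case: z => x y /= x0; have n0 : 0 < normc (x +i* y).
  by rewrite normc_gt0; apply: contraTneq x0 => -[-> _]; rewrite ltxx.
have N : normc (x +i* y) = x * Num.sqrt (1 + (y / x) ^+ 2).
  have xx : x = Num.sqrt (x ^+ 2) by rewrite sqrtr_sqr ger0_norm// ltW.
  rewrite /= {2}xx -sqrtrM ?sqr_ge0//.
  by congr Num.sqrt; field; rewrite gt_eqF.
have sq0 : 0 < Num.sqrt (1 + (y / x) ^+ 2).
  by rewrite sqrtr_gt0 ltr_pwDl// sqr_ge0.
rewrite /cexp /cLog /circle_pt lnK ?posrE//= -/(normc (x +i* y)) N.
have C := cos_atan (y / x).
have S : sin (atan (y / x)) = y / x * (Num.sqrt (1 + (y / x) ^+ 2))^-1.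
  rewrite -C -{2}[y / x]atanK /tan divfK// C invr_eq0 gt_eqF//.
rewrite C S; congr Complex; field; rewrite ?gt_eqF//.
Qed.

Lemma ccont_RI (f : R[i] -> R[i]) z :
  rcont (fun w => Re (f w)) z -> rcont (fun w => Im (f w)) z -> ccont f z.
Proof.
move=> cr ci e e0; have e20 : 0 < e / 2 by rewrite divr_gt0.
apply: cnearS (cnearI (cr _ e20) (ci _ e20)) => w [H1 H2].
by rewrite (le_lt_trans (normc_leRI _))// ReB ImB [e]splitr ltrD.
Qed.

Lemma rcontM (u v : R[i] -> R) z : rcont u z -> rcont v z -> rcont (fun w => u w * v w) z.
Proof.
move=> /rcontC cu /rcontC cv; apply/rcontC; apply: ccont_near (ccontM cu cv).
by apply: cnearT => w; rewrite rmorphM.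
Qed.

Lemma rcontD (u v : R[i] -> R) z : rcont u z -> rcont v z -> rcont (fun w => u w + v w) z.
Proof.
move=> /rcontC cu /rcontC cv; apply/rcontC; apply: ccont_near (ccontD cu cv).
by apply: cnearT => w; rewrite rmorphD.
Qed.

Lemma ccont_cLog z : 0 < Re z -> ccont cLog z.
Proof.
move=> z0; have n0 : 0 < normc z by rewrite (lt_le_trans z0)// (le_trans (ler_norm _))// ger_Re.
apply: ccont_RI => /=.
  apply: (rcont_comp (u := @normc R)); first exact/rcont_normc/ccont_id.
  exact: continuous_ln.
apply: (rcont_comp (u := fun w => Im w / Re w)); last exact: continuous_atan.
apply: rcontM; first exact/rcont_Im/ccont_id.
apply: (rcont_comp (u := fun w => Re w)); first exact/rcont_Re/ccont_id.
by apply: inv_continuous; rewrite gt_eqF.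
Qed.

Lemma cnear_Re_gt0 z : 0 < Re z -> cnear z (fun w => 0 < Re w).
Proof.
move=> z0; apply: cnearS (rcont_Re (ccont_id z) z0) => w.
by rewrite ltr_norml => /andP[H _]; move: H; lra.
Qed.

(** The slope of [cexp] at [cLog z], composed with the continuous [cLog], is nonzero near [z]; its
    reciprocal is a slope for [cLog]. *)
Lemma cdiff_cLog z : 0 < Re z -> cdiff cLog z.
Proof.
move=> z0; have [p [cp pz H]] := cexp_diff (cLog z).
have cpl : ccont (fun w => p (cLog w)) z by apply: ccont_comp => //; exact: ccont_cLog.
have p0 : p (cLog z) != 0 by rewrite pz cexp_neq0.
apply: (@cdiff_near _ (fun w => cLog z + (p (cLog w))^-1 * (w - z))).
  apply: cnearS (cnearI (cnear_Re_gt0 z0) (ccont_neq0 cpl p0)) => w [w0 pw].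
  have := H (cLog w); rewrite !cLogK// => E.
  have -> : w - z = p (cLog w) * (cLog w - cLog z) by rewrite {1}E addrC addKr.
  by field.
exists (fun w => (p (cLog w))^-1); first exact: ccontV.
by move=> w; rewrite subrr mulr0 addr0.
Qed.

Lemma curve_cont (u : R[i] -> R) (a b : R -> R) t :
  rcont u (a t +i* b t) -> {for t, continuous a} -> {for t, continuous b} ->
  {for t, continuous (fun s => u (a s +i* b s))}.
Proof.
move=> cu ca cb; apply/cvgrPdist_lt => e e0; have [d d0 H] := cu _ e0.
have d20 : 0 < d / 2 by rewrite divr_gt0.
move/cvgrPdist_lt : ca => /(_ _ d20) na; move/cvgrPdist_lt : cb => /(_ _ d20) nb.
near=> s; rewrite distrC; apply: H; simpc.
rewrite (le_lt_trans (normc_leRI _))//= [d]splitr ltrD//.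
  by rewrite distrC; near: s.
by rewrite distrC; near: s.
Unshelve. all: by end_near. Qed.

Lemma circle_cont (u : R[i] -> R) r t : rcont u (circle_pt r t) ->
  {for t, continuous (fun s => u (circle_pt r s))}.
Proof.
move=> cu; apply: (@curve_cont u (fun s => r * cos s) (fun s => r * sin s)) => //.
  by apply: cvgM; [exact: cvg_cst | exact: continuous_cos].
by apply: cvgM; [exact: cvg_cst | exact: continuous_sin].
Qed.

End exp_log.

(** * Goursat's theorem in logarithmic coordinates *)

Section goursat.
Variable R : realType.
Notation mu := (@lebesgue_measure R).
Implicit Types (G H : R[i] -> R[i]) (x y w h : R).

Lemma half_pow_lt (W d : R) : 0 < d -> exists n, W / 2 ^+ n < d.
Proof.
move=> d0; have [n Hn] : exists n : nat, W / d < n%:R.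
  exists (Num.truncn (`|W / d|)).+1; rewrite (le_lt_trans (ler_norm _))//.
  exact: truncnS_gt.
exists n; rewrite ltr_pdivrMr ?exprn_gt0// mulrC -ltr_pdivrMr// (lt_le_trans Hn)//.
by rewrite -natrX ler_nat ltnW// ltn_expl.
Qed.

(* Bisection: a counterexample box would contain a nested sequence of
   counterexamples shrinking to a point. *)
Lemma box_ind (P : R -> R -> R -> R -> Prop) (X Y W H : R) :
  (forall x y w h, P x y (w / 2) (h / 2) -> P (x + w / 2) y (w / 2) (h / 2) ->
     P x (y + h / 2) (w / 2) (h / 2) -> P (x + w / 2) (y + h / 2) (w / 2) (h / 2) ->
     P x y w h) ->
  0 <= W -> 0 <= H ->
  (forall a b, X <= a <= X + W -> Y <= b <= Y + H ->
     exists2 d, 0 < d & forall x y w h, x <= a <= x + w -> y <= b <= y + h ->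
       w < d -> h < d -> P x y w h) ->
  P X Y W H.
Proof.
move=> Psplit W0 H0 Ploc; apply: contrapT => nP.
pose wn n := W / 2 ^+ n; pose hn n := H / 2 ^+ n.
have wS n : wn n.+1 = wn n / 2 by rewrite /wn exprS invfM mulrCA mulrC.
have hS n : hn n.+1 = hn n / 2 by rewrite /hn exprS invfM mulrCA mulrC.
have wn0 n : 0 <= wn n by rewrite divr_ge0// exprn_ge0.
have hn0 n : 0 <= hn n by rewrite divr_ge0// exprn_ge0.
(* Boxes on which [P] holds are included, with a dummy successor, so that [choice] yields a single
   function. *)
have step (np : nat * (R * R)) : exists q : R * R,
   [/\ (~ P np.2.1 np.2.2 (wn np.1) (hn np.1) -> ~ P q.1 q.2 (wn np.1.+1) (hn np.1.+1)),
    np.2.1 <= q.1, q.1 + wn np.1.+1 <= np.2.1 + wn np.1,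
    np.2.2 <= q.2 & q.2 + hn np.1.+1 <= np.2.2 + hn np.1].
  case: np => n [x y] /=.
  have w20 : 0 <= wn n / 2 by rewrite -wS.
  have h20 : 0 <= hn n / 2 by rewrite -hS.
  have wn2 : wn n = wn n / 2 + wn n / 2 by rewrite -splitr.
  have hn2 : hn n = hn n / 2 + hn n / 2 by rewrite -splitr.
  rewrite wS hS.
  have [Q|nQ] := pselect (exists q : R * R, [/\ ~ P q.1 q.2 (wn n / 2) (hn n / 2),
    x <= q.1, q.1 + wn n / 2 <= x + wn n, y <= q.2 & q.2 + hn n / 2 <= y + hn n]).
    by case: Q => q [? ? ? ? ?]; exists q; split.
  have F q1 q2 : x <= q1 -> q1 + wn n / 2 <= x + wn n -> y <= q2 ->
     q2 + hn n / 2 <= y + hn n -> P q1 q2 (wn n / 2) (hn n / 2).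
    by move=> ? ? ? ?; apply: contrapT => nPq; apply: nQ; exists (q1, q2).
  exists (x, y); split => //=; [|by rewrite lerD2l; lra|by rewrite lerD2l; lra].
  by case; apply: Psplit; apply: F => //; lra.
have [f Hf] := choice step.
pose s := fix s n := if n is m.+1 then f (m, s m) else (X, Y).
have nPs n : ~ P (s n).1 (s n).2 (wn n) (hn n).
  elim: n => [|n IH]; first by rewrite /wn /hn /= expr0 !divr1.
  by have [+ _ _ _ _] := Hf (n, s n); apply.
have sub (u : nat -> R) (v : nat -> R) : (forall n, 0 <= v n) ->
   (forall n, u n <= u n.+1 /\ u n.+1 + v n.+1 <= u n + v n) ->
   exists a, forall n, u n <= a <= u n + v n.
  move=> v0 uv.
  have mono m k : u m <= u (m + k)%N.
    by elim: k => [|k IH]; rewrite ?addn0// addnS (le_trans IH)//; apply: (uv _).1.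
  have anti m k : u (m + k)%N + v (m + k)%N <= u m + v m.
    by elim: k => [|k IH]; rewrite ?addn0// addnS (le_trans _ IH)//; apply: (uv _).2.
  have ub m n : u n <= u m + v m.
    have [mn|nm] := leqP m n.
      by rewrite -(subnKC mn) (le_trans _ (anti m (n - m)%N))// lerDl.
    by rewrite (le_trans (mono n (m - n)%N))// subnKC ?(ltnW nm)// lerDl.
  exists (sup (range u)) => n; apply/andP; split.
    apply: ub_le_sup; last by exists n.
    by exists (u 0%N + v 0%N) => _ [m _ <-].
  apply: ge_sup; first by exists (u 0%N); exists 0%N.
  by move=> _ [m _ <-].
have [a Ha] := sub (fun n => (s n).1) wn wn0 (fun n => let: And5 _ A B _ _ := Hf (n, s n) in conj A B).
have [b Hb] := sub (fun n => (s n).2) hn hn0 (fun n => let: And5 _ _ _ A B := Hf (n, s n) in conj A B).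
have [|| d d0 HP] := Ploc a b.
- by have := Ha 0%N; rewrite /wn expr0 divr1.
- by have := Hb 0%N; rewrite /hn expr0 divr1.
have [n1 n1d] := half_pow_lt W d0; have [n2 n2d] := half_pow_lt H d0.
have mon (Z : R) m k : 0 <= Z -> Z / 2 ^+ (m + k) <= Z / 2 ^+ m.
  move=> Z0; rewrite ler_wpM2l// lef_pV2 ?posrE ?exprn_gt0//.
  by rewrite ler_eXn2l ?ltr1n// leq_addr.
apply: (nPs (n1 + n2)%N); apply: HP => //.
  by rewrite (le_lt_trans _ n1d)//; exact: mon.
by rewrite (le_lt_trans _ n2d)// /hn addnC; exact: mon.
Qed.

(* The real part of the contour integral; the imaginary part is that of [- 'i * G]. *)
Definition rect_int G x y w h : R :=
  \int[mu]_(s in `[x, x + w]) Re (G (s +i* y))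
  - \int[mu]_(s in `[y, y + h]) Im (G ((x + w) +i* s))
  - \int[mu]_(s in `[x, x + w]) Re (G (s +i* (y + h)))
  + \int[mu]_(s in `[y, y + h]) Im (G (x +i* s)).

Definition rect_cont G x y w h := forall a b, x <= a <= x + w -> y <= b <= y + h ->
  ccont G (a +i* b).

Lemma rect_contP G x y w h : rect_cont G x y w h ->
  (forall b, y <= b <= y + h -> contI x (x + w) (fun s => Re (G (s +i* b)))) /\
  (forall a, x <= a <= x + w -> contI y (y + h) (fun s => Im (G (a +i* s)))).
Proof.
move=> cG; split=> [b yb s xs|a xa s ys].
  apply: (@curve_cont _ (fun z => Re (G z)) (fun s => s) (fun=> b)).
  - by apply: rcont_Re; apply: cG.
  - exact: cvg_id.
  - exact: cvg_cst.
apply: (@curve_cont _ (fun z => Im (G z)) (fun=> a) (fun s => s)).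
- by apply: rcont_Im; apply: cG.
- exact: cvg_cst.
- exact: cvg_id.
Qed.

Lemma rect_int_split G x y w h : 0 <= w -> 0 <= h -> rect_cont G x y (w + w) (h + h) ->
  rect_int G x y (w + w) (h + h) = rect_int G x y w h + rect_int G (x + w) y w h +
    rect_int G x (y + h) w h + rect_int G (x + w) (y + h) w h.
Proof.
move=> w0 h0 /rect_contP[cR cI]; rewrite /rect_int !addrA.
have E1 b : y <= b <= y + h + h -> \int[mu]_(s in `[x, x + w + w]) Re (G (s +i* b)) =
    \int[mu]_(s in `[x, x + w]) Re (G (s +i* b)) + \int[mu]_(s in `[x + w, x + w + w]) Re (G (s +i* b)).
  move=> yb; apply: Rint_split; rewrite ?lerDl//.
  by rewrite -addrA; apply: cR; rewrite addrA.
have E2 a : x <= a <= x + w + w -> \int[mu]_(s in `[y, y + h + h]) Im (G (a +i* s)) =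
    \int[mu]_(s in `[y, y + h]) Im (G (a +i* s)) + \int[mu]_(s in `[y + h, y + h + h]) Im (G (a +i* s)).
  move=> xa; apply: Rint_split; rewrite ?lerDl//.
  by rewrite -addrA; apply: cI; rewrite addrA.
rewrite !E1 ?E2; first ring.
all: by apply/andP; split; lra.
Qed.

Lemma rect_int_affine (c k : R[i]) x y w h : 0 <= w -> 0 <= h ->
  rect_int (fun z => c + k * z) x y w h = 0.
Proof.
move=> w0 h0; rewrite /rect_int.
case: c => c1 c2; case: k => k1 k2.
have E1 b : \int[mu]_(s in `[x, x + w]) Re (c1 +i* c2 + (k1 +i* k2) * (s +i* b)) =
    (c1 - k2 * b) * (x + w - x) + k1 * ((x + w) ^+ 2 - x ^+ 2) / 2.
  by rewrite -Rint_affine ?lerDl//; apply: eq_Rint => s _ /=; ring.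
have E2 a : \int[mu]_(s in `[y, y + h]) Im (c1 +i* c2 + (k1 +i* k2) * (a +i* s)) =
    (c2 + k2 * a) * (y + h - y) + k1 * ((y + h) ^+ 2 - y ^+ 2) / 2.
  by rewrite -Rint_affine ?lerDl//; apply: eq_Rint => s _ /=; ring.
by rewrite !E1 !E2; ring.
Qed.

Lemma rect_intD G H x y w h : rect_cont G x y w h -> rect_cont H x y w h ->
  0 <= w -> 0 <= h ->
  rect_int (fun z => G z + H z) x y w h = rect_int G x y w h + rect_int H x y w h.
Proof.
move=> /rect_contP[cG1 cG2] /rect_contP[cH1 cH2] w0 h0; rewrite /rect_int.
have E1 b : y <= b <= y + h -> \int[mu]_(s in `[x, x + w]) Re (G (s +i* b) + H (s +i* b)) =
  \int[mu]_(s in `[x, x + w]) Re (G (s +i* b)) + \int[mu]_(s in `[x, x + w]) Re (H (s +i* b)).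
  move=> yb; rewrite -RintD; [|exact: cG1|exact: cH1].
  by apply: eq_Rint => s _; rewrite ReD.
have E2 a : x <= a <= x + w -> \int[mu]_(s in `[y, y + h]) Im (G (a +i* s) + H (a +i* s)) =
  \int[mu]_(s in `[y, y + h]) Im (G (a +i* s)) + \int[mu]_(s in `[y, y + h]) Im (H (a +i* s)).
  move=> yb; rewrite -RintD; [|exact: cG2|exact: cH2].
  by apply: eq_Rint => s _; rewrite ImD.
rewrite !E1 ?E2; first ring.
all: by apply/andP; split; lra.
Qed.

Lemma rect_int_bound G x y w h M : rect_cont G x y w h -> 0 <= w -> 0 <= h ->
  (forall a b, x <= a <= x + w -> y <= b <= y + h -> normc (G (a +i* b)) <= M) ->
  `|rect_int G x y w h| <= 2 * M * (w + h).
Proof.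
move=> /rect_contP[c1 c2] w0 h0 HM; rewrite /rect_int.
have E1 b : y <= b <= y + h -> `|\int[mu]_(s in `[x, x + w]) Re (G (s +i* b))| <= M * (x + w - x).
  move=> yb; apply: normr_Rint; [by rewrite lerDl|exact: c1|] => s xs.
  by rewrite (le_trans (ger_Re _))// HM.
have E2 a : x <= a <= x + w -> `|\int[mu]_(s in `[y, y + h]) Im (G (a +i* s))| <= M * (y + h - y).
  move=> xa; apply: normr_Rint; [by rewrite lerDl|exact: c2|] => s ys.
  by rewrite (le_trans (ger_Im _))// HM.
have yy : y <= y <= y + h by apply/andP; split; lra.
have yh : y <= y + h <= y + h by apply/andP; split; lra.
have xx : x <= x <= x + w by apply/andP; split; lra.
have xw : x <= x + w <= x + w by apply/andP; split; lra.
move: (E1 _ yy) (E1 _ yh) (E2 _ xx) (E2 _ xw).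
set I1 := \int[mu]_(s in _) _; set I2 := \int[mu]_(s in _) _.
set I3 := \int[mu]_(s in _) _; set I4 := \int[mu]_(s in _) _.
have -> : x + w - x = w by ring.
have -> : y + h - y = h by ring.
rewrite !ler_norml => /andP[? ?] /andP[? ?] /andP[? ?] /andP[? ?].
by apply/andP; split; lra.
Qed.

(** The bound [e1 * (w + h) ^+ 2] survives quartering, since each quarter has a quarter of this
    quantity. On a small box the affine part of [G] integrates to 0 and the remainder is at most
    [e1 / 2 * (w + h)] on a boundary of length [2 * (w + h)]. *)
Lemma goursat G (X Y W H : R) : 0 <= W -> 0 <= H ->
  (forall a b, X <= a <= X + W -> Y <= b <= Y + H -> cdiff G (a +i* b)) ->
  rect_int G X Y W H = 0.
Proof.
move=> W0 H0 dG; apply/eqP; rewrite -normr_le0; apply/ler_addgt0Pr => e e0; rewrite add0r.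
have WH : 0 < (W + H) ^+ 2 + 1 by rewrite ltr_wpDl ?sqr_ge0.
pose e1 := e / ((W + H) ^+ 2 + 1); have e10 : 0 < e1 by rewrite divr_gt0.
(* The trivial premises give the goal the shape of [P] below, which only speaks of boxes inside the
   given one. *)
suff: X <= X -> Y <= Y -> X + W <= X + W -> Y + H <= Y + H -> 0 <= W -> 0 <= H ->
    `|rect_int G X Y W H| <= e1 * (W + H) ^+ 2.
  move=> /(_ (lexx _) (lexx _) (lexx _) (lexx _) W0 H0) /le_trans; apply.
  by rewrite mulrAC ler_pdivrMr// ler_wpM2l ?(ltW e0)// lerDl.
have cG x y w h : X <= x -> Y <= y -> x + w <= X + W -> y + h <= Y + H -> rect_cont G x y w h.
  move=> Xx Yy xw yh a b /andP[? ?] /andP[? ?]; apply: cdiff_cont; apply: dG; apply/andP; split; lra.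
pose P x y w h := X <= x -> Y <= y -> x + w <= X + W -> y + h <= Y + H -> 0 <= w -> 0 <= h ->
    `|rect_int G x y w h| <= e1 * (w + h) ^+ 2.
apply: (@box_ind P) => //.
  move=> x y w h P1 P2 P3 P4 Xx Yy xw yh w0 h0.
  have w20 : 0 <= w / 2 by rewrite divr_ge0.
  have h20 : 0 <= h / 2 by rewrite divr_ge0.
  rewrite {1}(splitr w) {1}(splitr h) rect_int_split//; last first.
    by apply: cG => //; rewrite -splitr.
  have {}P1 : `|rect_int G x y (w / 2) (h / 2)| <= e1 * (w / 2 + h / 2) ^+ 2 by apply: P1 => //; lra.
  have {}P2 : `|rect_int G (x + w / 2) y (w / 2) (h / 2)| <= e1 * (w / 2 + h / 2) ^+ 2 by apply: P2 => //; lra.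
  have {}P3 : `|rect_int G x (y + h / 2) (w / 2) (h / 2)| <= e1 * (w / 2 + h / 2) ^+ 2 by apply: P3 => //; lra.
  have {}P4 : `|rect_int G (x + w / 2) (y + h / 2) (w / 2) (h / 2)| <= e1 * (w / 2 + h / 2) ^+ 2 by apply: P4 => //; lra.
  have -> : e1 * (w + h) ^+ 2 = e1 * (w / 2 + h / 2) ^+ 2 + e1 * (w / 2 + h / 2) ^+ 2 +
     e1 * (w / 2 + h / 2) ^+ 2 + e1 * (w / 2 + h / 2) ^+ 2 by field.
  by do 3 (apply: le_trans (ler_normD _ _) _; apply: lerD => //).
move=> a b Xa Yb; have [p cp Gp] := dG a b Xa Yb.
set z0 := a +i* b in cp Gp; have e20 : 0 < e1 / 2 by rewrite divr_gt0.
have [d d0 Hd] := cp _ e20; exists (d / 2); first by rewrite divr_gt0.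
move=> x y w h xa yb wd hd Xx Yy xw yh w0 h0.
pose A (z : R[i]) : R[i] := (G z0 - p z0 * z0) + p z0 * z.
have cA : rect_cont A x y w h.
  move=> s t _ _; apply: ccontD; first exact: ccont_cst.
  by apply: ccontM; [exact: ccont_cst | exact: ccont_id].
have cE : rect_cont (fun z => G z - A z) x y w h.
  move=> s t xs yt; apply: ccontB; last exact: cA.
  exact: (cG x y w h).
have E : G = (fun z => A z + (G z - A z)).
  by apply/funext => z; rewrite [RHS]addrC subrK.
rewrite {1}E => {E}.
rewrite rect_intD// /A rect_int_affine// add0r -/A.
have -> : e1 * (w + h) ^+ 2 = 2 * (e1 / 2 * (w + h)) * (w + h) by field.
apply: rect_int_bound => // s t xs yt.
have -> : G (s +i* t) - A (s +i* t) = (p (s +i* t) - p z0) * (s +i* t - z0).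
  by rewrite /A Gp; ring.
have N : normc (s +i* t - z0) <= w + h.
  rewrite (le_trans (normc_leRI _))// /z0 /=; move: xs yt xa yb => /andP[? ?] /andP[? ?] /andP[? ?] /andP[? ?].
  by apply: lerD; rewrite ler_norml; apply/andP; split; lra.
rewrite normcM ler_pM ?normc_ge0// ltW// Hd// (le_lt_trans N)//.
by rewrite [d]splitr ltrD.
Qed.

Definition cmean (u : R[i] -> R) (r : R) : R :=
  (2 * pi)^-1 * \int[mu]_(t in `[0, 2 * pi]) u (circle_pt r t).

(** Over the rectangle from [ln r1] to [ln r2] and from 0 to [2 * pi], the horizontal sides of the
    integral of [H] composed with [cexp] cancel by periodicity. The vertical ones carry imaginary
    parts, because [rect_int] is the real part of the contour integral. *)
Lemma cmean_annulus H r1 r2 : 0 < r1 -> r1 <= r2 ->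
  (forall z, r1 <= normc z <= r2 -> cdiff H z) ->
  cmean (fun z => Im (H z)) r1 = cmean (fun z => Im (H z)) r2.
Proof.
move=> r10 r12 dH; have r20 := lt_le_trans r10 r12.
have l12 : ln r1 <= ln r2 by rewrite ler_ln.
have W0 : 0 <= ln r2 - ln r1 by rewrite subr_ge0.
have P0 : 0 <= 2 * pi :> R by rewrite mulr_ge0// pi_ge0.
have K : rect_int (fun z => H (cexp z)) (ln r1) 0 (ln r2 - ln r1) (2 * pi) = 0.
  apply: goursat => // a b; rewrite [_ + (_ - _)]addrC subrK => /andP[la1 la2] _.
  apply: cdiff_comp (cdiff_cexp _) (dH _ _); rewrite normc_cexp/=.
  by rewrite -ler_ln ?posrE ?expR_gt0// expRK la1 -ler_ln ?posrE ?expR_gt0// expRK.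
move: K; rewrite /rect_int !add0r [_ + (_ - _)]addrC subrK => K; congr (_ * _).
suff E : forall s : R, cexp (s +i* (2 * pi)) = cexp (s +i* 0).
  have EI r : 0 < r -> \int[mu]_(t in `[0, 2 * pi]) Im (H (circle_pt r t)) =
      \int[mu]_(t in `[0, 2 * pi]) Im (H (cexp (ln r +i* t))).
    by move=> r0; apply: eq_Rint => t _; rewrite circle_ptE.
  rewrite (EI _ r10) (EI _ r20); have alg (i i' a b : R) : i = i' -> i - a - i' + b = 0 -> b = a.
    by move=> -> h; apply: subr0_eq; rewrite -h; ring.
  by apply: alg K; apply: eq_Rint => s _; rewrite E.
move=> s; rewrite /cexp/= /circle_pt.
by rewrite (_ : 2 * pi = pi *+ 2) ?mulr_natl// cos2pi sin2pi cos0 sin0.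
Qed.

End goursat.

(** * Circle means and Cauchy's formula *)

Section cauchy.
Variable R : realType.
Notation mu := (@lebesgue_measure R).
Implicit Types (g H : R[i] -> R[i]) (u v : R[i] -> R) (r s : R).

Definition circ_cont u r := forall z, normc z = r -> rcont u z.

Lemma circ_contP u r : 0 <= r -> circ_cont u r ->
  contI 0 (2 * pi) (fun t => u (circle_pt r t)).
Proof. by move=> r0 cu t _; apply: circle_cont; apply: cu; rewrite normc_circle ger0_norm. Qed.

Lemma twopi_gt0 : 0 < 2 * pi :> R. Proof. by rewrite mulr_gt0// pi_gt0. Qed.
Lemma twopi_ge0 : 0 <= 2 * pi :> R. Proof. exact/ltW/twopi_gt0. Qed.

Lemma eq_cmean u v r : 0 <= r -> (forall z, normc z = r -> u z = v z) -> cmean u r = cmean v r.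
Proof. by move=> r0 uv; congr (_ * _); apply: eq_Rint => t _; rewrite uv// normc_circle ger0_norm. Qed.

Lemma cmeanD u v r : 0 <= r -> circ_cont u r -> circ_cont v r ->
  cmean (fun z => u z + v z) r = cmean u r + cmean v r.
Proof. by move=> r0 cu cv; rewrite /cmean (RintD (circ_contP r0 cu) (circ_contP r0 cv)) mulrDr. Qed.

Lemma cmeanB u v r : 0 <= r -> circ_cont u r -> circ_cont v r ->
  cmean (fun z => u z - v z) r = cmean u r - cmean v r.
Proof. by move=> r0 cu cv; rewrite /cmean RintB ?mulrBr//; exact: circ_contP. Qed.

Lemma cmeanN u r : 0 <= r -> circ_cont u r -> cmean (fun z => - u z) r = - cmean u r.
Proof. by move=> r0 cu; rewrite /cmean RintN ?mulrN//; exact: circ_contP. Qed.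

Lemma cmeanZ u k r : 0 <= r -> circ_cont u r -> cmean (fun z => k * u z) r = k * cmean u r.
Proof. by move=> r0 cu; rewrite /cmean RintZ 1?mulrCA//; exact: circ_contP. Qed.

Lemma cmean_cst k r : cmean (fun=> k) r = k.
Proof. by rewrite /cmean Rint_cst ?twopi_ge0// subr0 mulrC mulfK// gt_eqF// twopi_gt0. Qed.

Lemma le_cmean u v r : 0 <= r -> circ_cont u r -> circ_cont v r ->
  (forall z, normc z = r -> u z <= v z) -> cmean u r <= cmean v r.
Proof.
move=> r0 cu cv uv; rewrite ler_wpM2l ?invr_ge0 ?twopi_ge0//.
apply: le_Rint; [exact: circ_contP | exact: circ_contP |].
by move=> t _; rewrite uv// normc_circle ger0_norm.
Qed.

Lemma normr_cmean u r M : 0 <= r -> circ_cont u r ->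
  (forall t, 0 <= t <= 2 * pi -> `|u (circle_pt r t)| <= M) -> `|cmean u r| <= M.
Proof.
move=> r0 cu uM; rewrite normrM ger0_norm ?invr_ge0 ?twopi_ge0//.
rewrite mulrC ler_pdivrMr ?twopi_gt0//.
have := normr_Rint twopi_ge0 (circ_contP r0 cu) uM.
by rewrite subr0.
Qed.

Lemma circ_bounded u r : 0 <= r -> circ_cont u r ->
  exists M, forall t, 0 <= t <= 2 * pi -> u (circle_pt r t) <= M.
Proof.
move=> r0 cu.
have [c _ Hc] := EVT_max twopi_ge0 (contI_within (circ_contP r0 cu)).
by exists (u (circle_pt r c)) => t t0; apply: Hc; rewrite in_itv.
Qed.

(** Uniformity in the angle comes from [box_ind] on a box of width 0 over the interval of angles;
    the first two coordinates of [P] are idle. Writing radii as [expR s] gives access to the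
    continuity of [cexp]. *)
Lemma cmean_continuous u r e : 0 < r -> 0 < e -> circ_cont u r ->
  exists2 d, 0 < d & forall s, `|s - ln r| < d -> circ_cont u (expR s) ->
    `|cmean u (expR s) - cmean u r| <= e.
Proof.
move=> r0 e0 cu.
pose P (x y w h : R) := exists2 d, 0 < d & forall t s, y <= t <= y + h -> `|s - ln r| < d ->
  `|u (circle_pt (expR s) t) - u (circle_pt r t)| <= e.
have [|//|||d d0 Hd] := @box_ind R P 0 0 0 (2 * pi).
- move=> x y w h [d1 d10 H1] _ [d2 d20 H2] _; exists (Num.min d1 d2); first by rewrite lt_min d10.
  move=> t s /andP[yt ty]; rewrite lt_min => /andP[s1 s2].
  have [th|th] := leP t (y + h / 2); first by apply: H1 => //; rewrite yt.
  by apply: H2 => //; rewrite (ltW th)/= -addrA -splitr.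
- exact: twopi_ge0.
- move=> a b _ _.
  have e20 : 0 < e / 2 by rewrite divr_gt0.
  have [d d0 Hd] := cu (circle_pt r b) ltac:(by rewrite normc_circle gtr0_norm) _ e20.
  have [d' d'0 Hd'] : cnear (ln r +i* b) (fun w => normc (cexp w - circle_pt r b) < d).
    by have := cdiff_cont (cdiff_cexp (ln r +i* b)) d0; rewrite -circle_ptE.
  exists (d' / 2); first by rewrite divr_gt0.
  move=> x y w h _ yb _ hd; exists (d' / 2); first by rewrite divr_gt0.
  move=> t s yt sr.
  have tb : `|t - b| < d' / 2.
    apply: le_lt_trans hd; move: yt yb => /andP[? ?] /andP[? ?].
    by rewrite ler_norml; apply/andP; split; lra.
  have near s' : `|s' - ln r| < d' / 2 -> `|u (circle_pt (expR s') t) - u (circle_pt r b)| < e / 2.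
    move=> sr'; apply: Hd; apply: (Hd' (s' +i* t)); simpc.
    by rewrite (le_lt_trans (normc_leRI _))//= [d']splitr ltrD.
  rewrite -[X in `|X|](subrKA (u (circle_pt r b))) (le_trans (ler_normD _ _))// [e]splitr.
  apply: lerD; first exact/ltW/near.
  have := near (ln r); rewrite lnK// subrr normr0 distrC => /(_ ltac:(by rewrite divr_gt0)).
  exact: ltW.
exists d => // s sr cs; rewrite -mulrBr -RintB.
- rewrite normrM ger0_norm ?invr_ge0 ?twopi_ge0//.
  rewrite mulrC ler_pdivrMr ?twopi_gt0//.
  have := @normr_Rint R 0 (2 * pi) (fun t => u (circle_pt (expR s) t) - u (circle_pt r t)) e twopi_ge0.
  rewrite subr0; apply.
    apply: contID; first by apply: circ_contP => //; exact: expR_ge0.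
    by apply: contIN; apply: circ_contP => //; exact: ltW.
  by move=> t t0; apply: Hd => //; rewrite add0r.
- by apply: circ_contP => //; exact: expR_ge0.
- by apply: circ_contP => //; exact: ltW.
Qed.

Lemma cmean_at0 u e : 0 < e -> rcont u 0 ->
  exists2 d, 0 < d & forall r, 0 < r < d -> circ_cont u r -> `|cmean u r - u 0| <= e.
Proof.
move=> e0 /(_ _ e0)[d d0 Hd]; exists d => // r /andP[r0 rd] cu.
rewrite -{1}(cmean_cst (u 0) r) -cmeanB ?(ltW r0)//; last first.
  by move=> z _ e' e'0; exists 1 => // w _; rewrite subrr normr0.
apply: normr_cmean; first exact: ltW.
  move=> z zr; apply: (@rcont_comp _ u (fun x => x - u 0)); first exact: cu.
  by apply: cvgB; [exact: cvg_id | exact: cvg_cst].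
by move=> t _; apply/ltW/Hd; rewrite subr0 normc_circle gtr0_norm.
Qed.

Lemma real_eq_eps (x y : R) : (forall e, 0 < e -> `|x - y| <= e) -> x = y.
Proof.
move=> H; apply: subr0_eq; apply/eqP; rewrite -normr_le0; apply/ler_addgt0Pr => e e0.
by rewrite add0r; exact: H.
Qed.

(** The mean is constant in the radius on either side of [normc z1], tends to the value at 0 for
    small radii, and is carried across the circle through [z1] by continuity of the mean. Thus mere
    continuity suffices at 0 and at one further point, which Cauchy's formula uses for its
    difference quotient. *)
Lemma cmean_mvp_Im H (z1 : R[i]) rho r :
  (forall z, normc z < rho -> ccont H z) ->
  (forall z, 0 < normc z < rho -> z != z1 -> cdiff H z) ->
  0 < r < rho -> cmean (fun z => Im (H z)) r = Im (H 0).
Proof.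
move=> cH dH /andP[r0 rrho]; set u := fun z => Im (H z); set a := normc z1.
have cu s : 0 <= s -> s < rho -> circ_cont u s.
  by move=> s0 srho z zs; apply: rcont_Im; apply: cH; rewrite zs.
have const s1 s2 : 0 < s1 -> s1 <= s2 -> s2 < rho -> (a < s1) || (s2 < a) -> cmean u s1 = cmean u s2.
  move=> s10 s12 s2rho sa; apply: cmean_annulus => // z /andP[z1' z2'].
  apply: dH; first by rewrite (lt_le_trans s10)//= (le_lt_trans z2').
  apply: contraTneq sa => zz1; rewrite /a -zz1 negb_or -!leNgt.
  by apply/andP.
have below s : 0 < s -> s < rho -> (s < a) || (a == 0) -> cmean u s = u 0.
  move=> s0 srho sa; apply: real_eq_eps => e e0.
  have [|d d0 Hd] := @cmean_at0 u e e0; first by apply: rcont_Im; apply: cH; rewrite normc0 (lt_trans r0).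
  have m0 : 0 < Num.min (d / 2) s by rewrite lt_min s0 divr_gt0.
  have ms : Num.min (d / 2) s <= s by rewrite ge_min lexx orbT.
  rewrite -(const (Num.min (d / 2) s))//.
    apply: Hd; last by apply: cu; [exact: ltW | exact: le_lt_trans srho].
    by rewrite m0/= gt_min ltr_pdivrMr// ltr_pMr// ltr1n.
  by move: sa => /orP[->|/eqP ->]; rewrite ?orbT// m0.
have a0 : 0 <= a by exact: normc_ge0.
have [ra|ar] := ltP r a; first by apply: below => //; rewrite ra.
have [a00|an0] := eqVneq a 0; first by apply: below => //; rewrite a00 eqxx orbT.
have {an0}a0 : 0 < a by rewrite lt_neqAle eq_sym an0.
have arho := le_lt_trans ar rrho.
have at_a : cmean u a = u 0.
  apply: real_eq_eps => e e0.
  have [d d0 Hd] := cmean_continuous a0 e0 (cu _ (ltW a0) arho).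
  have lt_s : expR (ln a - d / 2) < a by rewrite -{2}(lnK (x := a))// ltr_expR; lra.
  rewrite -(below (expR (ln a - d / 2))) ?expR_gt0// ?lt_s//; last exact: lt_trans arho.
  rewrite distrC; apply: Hd; last by apply: cu; [exact: expR_ge0 | exact: lt_trans arho].
  by rewrite addrAC subrr add0r normrN gtr0_norm ?divr_gt0// ltr_pdivrMr// ltr_pMr// ltr1n.
transitivity (cmean u a); last exact: at_a.
move: ar; rewrite le_eqVlt => /predU1P[<-//|ar].
apply: real_eq_eps => e e0.
have [d d0 Hd] := cmean_continuous a0 e0 (cu _ (ltW a0) arho).
have lnar : ln a < ln r by rewrite ltr_ln.
pose s := Num.min (ln a + d / 2) (ln r).
have sr : s <= ln r by rewrite ge_min lexx orbT.
have sa : ln a < s by rewrite lt_min lnar andbT; move: d0; lra.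
have es : expR s <= r by rewrite -[X in _ <= X]lnK ?posrE// ler_expR.
rewrite -(const (expR s))// ?expR_gt0//; last first.
  by rewrite -{1}(lnK (x := a))// ltr_expR sa.
apply: Hd; last by apply: cu; [exact: expR_ge0 | exact: le_lt_trans rrho].
rewrite gtr0_norm ?subr_gt0// ltrBlDl /s gt_min; apply/orP; left.
by move: d0; lra.
Qed.

Definition cmeanC H r : R[i] := cmean (fun z => Re (H z)) r +i* cmean (fun z => Im (H z)) r.

Definition ccirc_cont H r := forall z, normc z = r -> ccont H z.

Lemma ccirc_Re H r : ccirc_cont H r -> circ_cont (fun z => Re (H z)) r.
Proof. by move=> cH z zr; apply: rcont_Re; exact: cH. Qed.

Lemma ccirc_Im H r : ccirc_cont H r -> circ_cont (fun z => Im (H z)) r.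
Proof. by move=> cH z zr; apply: rcont_Im; exact: cH. Qed.

Lemma eq_cmeanC H g r : 0 <= r -> (forall z, normc z = r -> H z = g z) -> cmeanC H r = cmeanC g r.
Proof. by move=> r0 Hg; congr Complex; apply: eq_cmean => // z /Hg ->. Qed.

Lemma cmeanCD H g r : 0 <= r -> ccirc_cont H r -> ccirc_cont g r ->
  cmeanC (fun z => H z + g z) r = cmeanC H r + cmeanC g r.
Proof.
move=> r0 cH cg; rewrite /cmeanC; simpc; congr Complex.
  by rewrite -cmeanD//; [apply: eq_cmean => // z _; rewrite ReD | exact: ccirc_Re | exact: ccirc_Re].
by rewrite -cmeanD//; [apply: eq_cmean => // z _; rewrite ImD | exact: ccirc_Im | exact: ccirc_Im].
Qed.

Lemma circ_contZ u k r : circ_cont u r -> circ_cont (fun z => k * u z) r.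
Proof.
move=> cu z zr; apply: rcontM; last exact: cu.
by move=> e e0; exists 1 => // w _; rewrite subrr normr0.
Qed.

Lemma cmeanCZ H k r : 0 <= r -> ccirc_cont H r -> cmeanC (fun z => k * H z) r = k * cmeanC H r.
Proof.
move=> r0 cH; have cR := ccirc_Re cH; have cI := ccirc_Im cH.
case: k => a b; rewrite /cmeanC; simpc; congr Complex.
  rewrite -!cmeanZ// -cmeanB//; [|exact: circ_contZ|exact: circ_contZ].
  by apply: eq_cmean => // z _; case: (H z).
rewrite -!cmeanZ// -cmeanD//; [|exact: circ_contZ|exact: circ_contZ].
by apply: eq_cmean => // z _; case: (H z).
Qed.

Lemma cmeanCB H g r : 0 <= r -> ccirc_cont H r -> ccirc_cont g r ->
  cmeanC (fun z => H z - g z) r = cmeanC H r - cmeanC g r.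
Proof.
move=> r0 cH cg; rewrite -mulN1r -cmeanCZ// -cmeanCD//.
  by apply: eq_cmeanC => // z _; rewrite mulN1r.
by move=> z zr; apply: ccontM; [exact: ccont_cst | exact: cg].
Qed.

Lemma cmeanCJ H r : 0 <= r -> ccirc_cont H r -> cmeanC (fun z => (H z)^*%C) r = (cmeanC H r)^*%C.
Proof.
move=> r0 cH; rewrite /cmeanC/=; congr Complex.
  by apply: eq_cmean => // z _; case: (H z).
rewrite -cmeanN//; last exact: ccirc_Im.
by apply: eq_cmean => // z _; case: (H z).
Qed.

Lemma cmeanC_bound H r M : 0 <= r -> ccirc_cont H r ->
  (forall t, 0 <= t <= 2 * pi -> normc (H (circle_pt r t)) <= M) -> normc (cmeanC H r) <= 2 * M.
Proof.
move=> r0 cH HM; rewrite (le_trans (normc_leRI _))// mulrDl mul1r lerD//=.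
  apply: normr_cmean => //; first exact: ccirc_Re.
  by move=> t t0; rewrite (le_trans (ger_Re _))// HM.
apply: normr_cmean => //; first exact: ccirc_Im.
by move=> t t0; rewrite (le_trans (ger_Im _))// HM.
Qed.

Lemma cmean_mvp H (z1 : R[i]) rho r :
  (forall z, normc z < rho -> ccont H z) ->
  (forall z, 0 < normc z < rho -> z != z1 -> cdiff H z) ->
  0 < r < rho -> cmeanC H r = H 0.
Proof.
move=> cH dH rr; have r0 : 0 <= r by case/andP: rr => /ltW.
rewrite /cmeanC (cmean_mvp_Im cH dH rr).
(* The real part of [H] is the imaginary part of ['i%C * H]. *)
have := @cmean_mvp_Im (fun z => 'i%C * H z) z1 rho r.
rewrite [X in _ -> _ -> _ -> X = _](_ : _ = cmean (fun z => Re (H z)) r); last first.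
  by apply: eq_cmean => // z _; case: (H z) => c d /=; rewrite mul0r mul1r add0r.
rewrite [Im ('i%C * H 0)](_ : _ = Re (H 0)); last first.
  by case: (H 0) => c d /=; rewrite mul0r mul1r add0r.
move=> ->//.
- by case: (H 0).
- by move=> z zr; apply: ccontM; [exact: ccont_cst | exact: cH].
- by move=> z zr zz1; apply: cdiffM; [exact: cdiff_cst | exact: dH].
Qed.

Lemma conjcM (z w : R[i]) : (z * w)^*%C = z^*%C * w^*%C.
Proof. exact: rmorphM. Qed.

Lemma conjcB (z w : R[i]) : (z - w)^*%C = z^*%C - w^*%C.
Proof. exact: rmorphB. Qed.

Lemma circle_conj r (z : R[i]) : normc z = r -> 0 < r -> z^*%C = (r ^+ 2)%:C / z.
Proof.
move=> zr r0; have z0 : z != 0 by rewrite -normc_gt0 zr.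
by rewrite -zr -mulcJ mulrC mulKf.
Qed.

Lemma ccont_conj H z : ccont H z -> ccont (fun w => (H w)^*%C) z.
Proof. by move=> cH; apply: ccont_comp cH (@ccontJ _ _). Qed.

(* On [|w| = r] the Cauchy kernel [w / (w - z)] is the conjugate of the
   holomorphic function [r^2 / (r^2 - z^* w)]. *)
Lemma cauchy_kernel_conj r (z w : R[i]) : normc w = r -> normc z < r ->
  w / (w - z) = ((r ^+ 2)%:C / ((r ^+ 2)%:C - z^*%C * w))^*%C.
Proof.
move=> wr zr; have r0 : 0 < r by rewrite (le_lt_trans (normc_ge0 z)).
have w0 : w != 0 by rewrite -normc_gt0 wr.
have wz : w - z != 0 by rewrite subr_eq0; apply: contraTneq zr => <-; rewrite wr ltxx.
rewrite conjcM conjc_inv conjcB conjcM conjcK conjc_real (circle_conj wr r0).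
have rr0 : (r ^+ 2)%:C != 0 by rewrite -normc_gt0 normcR normr_gt0 expf_neq0// gt_eqF.
move: ((r ^+ 2)%:C) rr0 => c c0.
rewrite (_ : c - z * (c / w) = c * (w - z) / w); last by field.
by field; rewrite w0 c0 wz.
Qed.

(** By [cauchy_kernel_conj] the integrand is the conjugate of a function holomorphic beyond the
    circle, whose value at 0 is [H 0]. *)
Lemma conj_kernel_mean H rho r (z : R[i]) : (forall w, normc w < rho -> cdiff H w) ->
  normc z < r -> r < rho ->
  cmeanC (fun w => (H w)^*%C * (w / (w - z))) r = (H 0)^*%C.
Proof.
move=> dH zr rrho; have r0 : 0 < r by rewrite (le_lt_trans (normc_ge0 z)).
pose K w := H w * ((r ^+ 2)%:C / ((r ^+ 2)%:C - z^*%C * w)).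
(* The reflected kernel has its pole at modulus [r ^+ 2 / normc z], which exceeds [r]. *)
pose rho' := if z == 0 then rho else Num.min rho (r ^+ 2 / normc z).
have rr' : r < rho'.
  rewrite /rho'; case: eqP => // /eqP z0; rewrite lt_min rrho/= ltr_pdivlMr ?normc_gt0//.
  by rewrite expr2 ltr_pM2l.
have ne w : normc w < rho' -> (r ^+ 2)%:C - z^*%C * w != 0.
  rewrite /rho' subr_eq0; case: eqP => [-> _|/eqP z0].
    by rewrite rmorph0 mul0r -normc_gt0 normcR normr_gt0 expf_neq0// gt_eqF.
  rewrite lt_min => /andP[_]; apply: contraTneq => E.
  rewrite -leNgt ler_pdivrMr ?normc_gt0// mulrC -normc_conj -normcM -E normcR ger0_norm// exprn_ge0// ltW//.
have dK w : normc w < rho' -> cdiff K w.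
  move=> wr; apply: cdiffM.
    by apply: dH; move: wr; rewrite /rho'; case: eqP => // _; rewrite lt_min => /andP[].
  apply: cdiff_div; [exact: cdiff_cst| |exact: ne].
  by apply: cdiffB; [exact: cdiff_cst | apply: cdiffM; [exact: cdiff_cst|exact: cdiff_id]].
have cK : ccirc_cont K r by move=> w wr; apply: cdiff_cont; apply: dK; rewrite wr.
transitivity (cmeanC (fun w => (K w)^*%C) r).
  apply: eq_cmeanC; [exact: ltW|] => w wr.
  by rewrite (cauchy_kernel_conj wr zr) -conjcM.
rewrite cmeanCJ ?(ltW r0)//; rewrite (@cmean_mvp K 0 rho').
- by rewrite /K mulr0 subr0 divff ?mulr1// -normc_gt0 normcR normr_gt0 expf_neq0// gt_eqF.
- by move=> w wr; apply: cdiff_cont; exact: dK.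
- by move=> w /andP[_ wr] _; exact: dK.
- by rewrite r0.
Qed.

(* The origin is allowed to be a point of mere continuity; this is what gives
   the removability of singularities below. *)
Lemma cauchy_formula g rho r (z : R[i]) :
  (forall w, normc w < rho -> ccont g w) ->
  (forall w, 0 < normc w < rho -> cdiff g w) ->
  normc z < r -> r < rho ->
  cmeanC (fun w => g w * (w / (w - z))) r = g z.
Proof.
move=> cg dg zr rrho; have r0 : 0 < r by rewrite (le_lt_trans (normc_ge0 z)).
have rr : 0 < r < rho by rewrite r0.
have wz w : normc w = r -> w - z != 0.
  by move=> wr; rewrite subr_eq0; apply: contraTneq zr => <-; rewrite wr ltxx.
have [z0|z0] := eqVneq z 0.
  rewrite z0 -(@cmean_mvp g 0 rho r)//; last by move=> w wr _; exact: dg.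
  apply: eq_cmeanC; [exact: ltW|] => w wr; rewrite subr0 divff ?mulr1//.
  by rewrite -normc_gt0 wr.
have zrho := lt_trans zr rrho.
have [|p cp gp] := dg z; first by rewrite normc_gt0 z0.
(* Off [z] this is [(g w - g z) * (w / (w - z))]. The factor [w] makes its value at 0, hence its
   circle mean, vanish. *)
pose H w := p w * w.
have pE w : w != z -> p w = (g w - g z) / (w - z).
  by move=> wz'; rewrite gp addrC addKr mulfK// subr_eq0.
have pn w : w != z -> cnear w (fun y => (g y - g z) / (y - z) = p y).
  by move=> wz'; apply: cnearS (cnear_neq wz') => y yz; rewrite pE.
have cp' w : normc w < rho -> ccont p w.
  move=> wr; have [->//|wz'] := eqVneq w z.
  apply: (ccont_near (pn _ wz')); apply: ccont_div.
  - by apply: ccontB; [exact: cg | exact: ccont_cst].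
  - by apply: ccontB; [exact: ccont_id | exact: ccont_cst].
  - by rewrite subr_eq0.
have := @cmean_mvp H z rho r.
have -> : H 0 = 0 by rewrite /H mulr0.
move=> H0; have {}H0 : cmeanC H r = 0.
  apply: H0 => //.
    by move=> w wr; apply: ccontM; [exact: cp' | exact: ccont_id].
  move=> w wr wz'; apply: cdiffM; last exact: cdiff_id.
  apply: (cdiff_near (pn _ wz')); apply: cdiff_div.
  - by apply: cdiffB; [exact: dg | exact: cdiff_cst].
  - by apply: cdiffB; [exact: cdiff_id | exact: cdiff_cst].
  - by rewrite subr_eq0.
have ck : ccirc_cont (fun w => w / (w - z)) r.
  move=> w wr; apply: ccont_div; [exact: ccont_id| |exact: wz].
  by apply: ccontB; [exact: ccont_id | exact: ccont_cst].
have K1 : cmeanC (fun w => w / (w - z)) r = 1.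
  have := @conj_kernel_mean (fun=> 1) rho r z (fun w _ => @cdiff_cst _ 1 w) zr rrho.
  rewrite rmorph1 => <-; apply: eq_cmeanC; [exact: ltW|] => w _.
  by rewrite mul1r.
rewrite -[RHS]mulr1 -K1 -cmeanCZ ?(ltW r0)//; apply: subr0_eq; rewrite -[RHS]H0 -cmeanCB ?(ltW r0)//.
- apply: eq_cmeanC; [exact: ltW|] => w wr.
  rewrite /H pE; last by rewrite -subr_eq0 wz.
  by field; exact: wz.
- by move=> w wr; apply: ccontM; [apply: cg; rewrite wr | exact: ck].
- by move=> w wr; apply: ccontM; [exact: ccont_cst | exact: ck].
Qed.

(** Cauchy's formula holds for such a [g], and in it the variable only enters through the kernel.
    Expanding the kernel at 0 yields the derivative [cmeanC (fun w => g w / w) r] with a quadratic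
    remainder. *)
Lemma removable0 g rho : 0 < rho ->
  (forall w, normc w < rho -> ccont g w) ->
  (forall w, 0 < normc w < rho -> cdiff g w) -> cdiff g 0.
Proof.
move=> rho0 cg dg; pose r := rho / 2.
have r0 : 0 < r by rewrite divr_gt0.
have rrho : r < rho by rewrite ltr_pdivrMr// ltr_pMr// ltr1n.
have cgr : ccirc_cont g r by move=> w wr; apply: cg; rewrite wr.
have [M HM] := @circ_bounded (fun z => normc (g z)) r (ltW r0) (fun z zr => rcont_normc (cgr z zr)).
have M0 : 0 <= M.
  by apply: le_trans (HM 0 _); rewrite ?normc_ge0// lexx twopi_ge0.
have nz (w : R[i]) : normc w = r -> w != 0 by move=> wr; rewrite -normc_gt0 wr.
have nzw (v w : R[i]) : normc v < r -> normc w = r -> w - v != 0.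
  by move=> vr wr; rewrite subr_eq0; apply: contraTneq vr => <-; rewrite wr ltxx.
have cK (v : R[i]) : normc v < r -> ccirc_cont (fun w => g w * (w / (w - v))) r.
  move=> vr w wr; apply: ccontM; first exact: cgr.
  apply: ccont_div; [exact: ccont_id| |exact: nzw].
  by apply: ccontB; [exact: ccont_id | exact: ccont_cst].
have cL : ccirc_cont (fun w => g w / w) r.
  by move=> w wr; apply: ccont_div; [exact: cgr | exact: ccont_id | exact: nz].
have n0r : normc (0 : R[i]) < r by rewrite normc0.
apply: (@cdiff_eps _ g 0 (cmeanC (fun w => g w / w) r)) => e e0.
(* For [normc v < r / 2] the remainder [g w * v ^+ 2 / (w * (w - v))] is at most
   [(M + 1) * normc v ^+ 2 / (r * (r / 2))], and [cmeanC_bound] costs a factor 2. *)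
exists (Num.min (r / 2) (e * (r ^+ 2 / 4) / (M + 1))).
  by rewrite lt_min !(divr_gt0, mulr_gt0, exprn_gt0)// ltr_wpDl.
move=> v; rewrite subr0 lt_min => /andP[vr ve].
have vr' : normc v < r by rewrite (lt_trans vr)// ltr_pdivrMr// ltr_pMr// ltr1n.
rewrite -{1}(cauchy_formula cg dg vr' rrho) -{1}(cauchy_formula cg dg n0r rrho).
rewrite -cmeanCB ?(ltW r0)//; [|exact: cK|exact: cK].
rewrite mulrC -cmeanCZ ?(ltW r0)//.
have cB : ccirc_cont (fun w => g w * (w / (w - v)) - g w * (w / (w - 0))) r.
  by move=> w wr; apply: ccontB; apply: cK.
have cZ : ccirc_cont (fun w => v * (g w / w)) r.
  by move=> w wr; apply: ccontM; [exact: ccont_cst | exact: cL].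
rewrite -cmeanCB ?(ltW r0)//.
rewrite (_ : e * normc v = 2 * (e / 2 * normc v)); last by field.
apply: cmeanC_bound; [exact: ltW| |].
  by move=> w wr; apply: ccontB; [exact: cB | exact: cZ].
move=> t t0; set w := circle_pt r t.
have wr : normc w = r by rewrite normc_circle gtr0_norm.
have w0 := nz _ wr; have wv := nzw _ _ vr' wr.
rewrite subr0 (_ : _ - _ = g w * v ^+ 2 / (w * (w - v))); last by field; rewrite w0 wv.
rewrite normcM normcV normcM normcX normcM wr ler_pdivrMr; last by rewrite mulr_gt0// normc_gt0.
have wv2 : r / 2 <= normc (w - v).
  by have := normc_geB w v; rewrite wr; move: vr; lra.
have gM : normc (g w) <= M + 1 by rewrite (le_trans (HM _ t0))// lerDl.
apply: (@le_trans _ _ ((M + 1) * normc v ^+ 2)); first by rewrite ler_wpM2r// exprn_ge0// normc_ge0.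
apply: (@le_trans _ _ (e / 2 * normc v * (r * (r / 2)))); last first.
  by rewrite ler_wpM2l ?mulr_ge0 ?normc_ge0 ?divr_ge0 ?(ltW e0)// ler_wpM2l// ltW.
rewrite (_ : e / 2 * normc v * (r * (r / 2)) = e * (r ^+ 2 / 4) * normc v); last by field.
rewrite [_ ^+ 2]expr2 mulrA ler_wpM2r ?normc_ge0//.
by rewrite mulrC -ler_pdivlMr ?ltW// ltr_wpDl.
Qed.

End cauchy.

(** * Local structure of meromorphic functions *)

Section meromorphic.
Variable R : realType.
Implicit Types (f g h : R[i] -> R[i]) (z w : R[i]) (r : R).

(** The slope of [g] at 0 is itself the quotient: holomorphic off 0, continuous at 0, hence
    holomorphic by [removable0]. *)
Lemma hol_factor0 g rho : (forall w, normc w < rho -> cdiff g w) -> g 0 = 0 -> 0 < rho ->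
  exists2 h, (forall w, normc w < rho -> cdiff h w) & forall w, g w = w * h w.
Proof.
move=> dg g0 rho0; have [|p cp gp] := dg 0; first by rewrite normc0.
have gE w : g w = w * p w by rewrite gp g0 subr0 add0r mulrC.
have dp w : w != 0 -> normc w < rho -> cdiff p w.
  move=> w0 wr; apply: (@cdiff_near _ (fun v => g v / v)).
    by apply: cnearS (cnear_neq w0) => v v0; rewrite gE mulrC mulKf.
  by apply: cdiff_div; [exact: dg | exact: cdiff_id | ].
exists p => // w wr; have [->|w0] := eqVneq w 0; last exact: dp.
apply: (@removable0 _ p rho) => //.
  move=> v vr; have [->//|v0] := eqVneq v 0.
  by apply: cdiff_cont; apply: dp.
by move=> v /andP[]; rewrite normc_gt0 => ? ?; exact: dp.
Qed.

Lemma exp_small (x K e : R) : 0 <= x < 1 -> 0 <= K -> 0 < e -> exists m, K * x ^+ m <= e.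
Proof.
move=> /andP[x0 x1] K0 e0.
have K10 : 0 < K + 1 by rewrite ltr_wpDl.
have : (fun n => x ^+ n) @ \oo --> (0 : R) by apply: cvg_expr; rewrite ger0_norm.
move=> /cvgrPdist_lt/(_ (e / (K + 1)))[|m _ /(_ m (leqnn m))]; first by rewrite divr_gt0.
rewrite /= sub0r normrN ger0_norm ?exprn_ge0// ltr_pdivlMr// => H; exists m.
rewrite mulrC (le_trans _ (ltW H))// ler_wpM2l ?exprn_ge0// lerDl//.
Qed.

(** If the division by [w] never stops, then [g w = w ^+ m * h w] for every [m]. Cauchy's formula
    for [h] on a circle of radius [r > normc w] gives [normc (g w)] at most a constant times
    [(normc w / r) ^+ m], so [g] vanishes. *)
Lemma zero_order g rho : 0 < rho -> (forall w, normc w < rho -> cdiff g w) ->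
  (forall w, normc w < rho -> g w = 0) \/
  exists m h, [/\ forall w, normc w < rho -> cdiff h w, h 0 != 0 & forall w, g w = w ^+ m * h w].
Proof.
move=> rho0 dg; have [|N] := pselect (exists m h,
  [/\ forall w, normc w < rho -> cdiff h w, h 0 != 0 & forall w, g w = w ^+ m * h w]).
  by right.
left; have {N} H m : exists h, (forall w, normc w < rho -> cdiff h w) /\ forall w, g w = w ^+ m * h w.
  elim: m => [|m [h [dh gh]]]; first by exists g; split => // w; rewrite expr0 mul1r.
  have [h0|h0] := eqVneq (h 0) 0; last by exfalso; apply: N; exists m, h.
  have [k dk hk] := hol_factor0 dh h0 rho0.
  by exists k; split => // w; rewrite gh hk exprSr mulrA.
move=> w wr; pose r := (normc w + rho) / 2.
have n0 := normc_ge0 w.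
have wr' : normc w < r by rewrite /r; lra.
have rr : r < rho by rewrite /r; lra.
have r0 : 0 < r by rewrite (le_lt_trans n0).
have cg : circ_cont (fun z => normc (g z)) r.
  by move=> z zr; apply: rcont_normc; apply: cdiff_cont; apply: dg; rewrite zr.
have [M HM] := circ_bounded (ltW r0) cg.
have M0 : 0 <= M by apply: le_trans (HM 0 _); rewrite ?normc_ge0// lexx twopi_ge0.
have d0 : 0 < r - normc w by rewrite subr_gt0.
apply/eqP; rewrite -normc_eq0 -normr_le0; apply/ler_addgt0Pr => e e0; rewrite add0r ger0_norm ?normc_ge0//.
have [|||m Hm] := @exp_small (normc w / r) (2 * (M * (r / (r - normc w)))) e.
- by rewrite divr_ge0 ?(ltW r0)//= ltr_pdivrMr// mul1r.
- by rewrite mulr_ge0// mulr_ge0// divr_ge0 ?(ltW r0) ?(ltW d0).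
- by [].
have [h [dh gh]] := H m.
apply: le_trans Hm; rewrite gh normcM normcX expr_div_n.
have wz z : normc z = r -> z - w != 0.
  by move=> zr; rewrite subr_eq0; apply: contraTneq wr' => <-; rewrite zr ltxx.
have : normc (h w) <= 2 * (M / r ^+ m * (r / (r - normc w))).
  rewrite -(@cauchy_formula _ h rho r w) //; last by move=> z /andP[_ zr]; exact: dh.
    apply: cmeanC_bound; [exact: ltW| |].
      move=> z zr; apply: ccontM; first by apply: cdiff_cont; apply: dh; rewrite zr.
      apply: ccont_div; [exact: ccont_id| |exact: wz].
      by apply: ccontB; [exact: ccont_id | exact: ccont_cst].
    move=> t t0; have zr : normc (circle_pt r t) = r by rewrite normc_circle gtr0_norm.
    rewrite normcM ler_pM ?normc_ge0//.
      by rewrite ler_pdivlMr ?exprn_gt0// mulrC -{1}zr -normcX -normcM -gh HM.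
    rewrite normcM normcV zr ler_wpM2l ?(ltW r0)//.
    rewrite lef_pV2 ?posrE ?normc_gt0 ?wz//.
    by rewrite -{1}zr normc_geB.
  by move=> z zr; apply: cdiff_cont; exact: dh.
move=> B; apply: le_trans (ler_wpM2l (exprn_ge0 m n0) B) _.
rewrite le_eqVlt; apply/orP; left; apply/eqP; field.
by rewrite expf_neq0 ?gt_eqF.
Qed.

(** A zero order [a] and a pole order [b], at least one of them 0, stand for one signed exponent;
    inversion of [f] just swaps them. *)
Definition local_form f z0 (a b : nat) h :=
  [/\ cnear z0 (fun z => cdiff h z), h z0 != 0, (a == 0%N) || (b == 0%N) &
      cnear z0 (fun z => z != z0 -> f z = (z - z0) ^+ a / (z - z0) ^+ b * h z)].

Definition zero_near f z0 := cnear z0 (fun z => z != z0 -> f z = 0).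

Lemma holomorphic_cdiff g z0 : holomorphic_at g z0 <-> cnear z0 (fun z => cdiff g z).
Proof.
rewrite /holomorphic_at cnearP; split; apply: cnearS => z; [exact: derivable_cdiff | exact: cdiff_derivable].
Qed.

Lemma cdiff_shift g z0 w : cdiff g (z0 + w) -> cdiff (fun v => g (z0 + v)) w.
Proof. by move=> dg; apply: (cdiff_comp (g := fun v => z0 + v)) dg; apply: cdiffD; [exact: cdiff_cst | exact: cdiff_id]. Qed.

Lemma mero_dichotomy f z0 : meromorphic f ->
  zero_near f z0 \/ exists a b h, local_form f z0 a b h.
Proof.
move=> /(_ z0)[k [g [/holomorphic_cdiff[rho rho0 dg] /dcnearP fg]]].
have [|Z|[m [h [dh h0 gh]]]] := @zero_order (fun w => g (z0 + w)) rho rho0.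
- by move=> w wr; apply: cdiff_shift; apply: dg; rewrite addrC addKr.
- left; have C : cnear z0 (fun z => normc (z - z0) < rho) by exists rho.
  apply: cnearS (cnearI fg C) => z [fz zr] zz; rewrite fz//.
  by have := Z _ zr; rewrite addrC subrK => ->; rewrite mul0r.
(* Truncated subtraction splits the signed order [m - k] into its two parts. *)
right; exists (m - k)%N, (k - m)%N, (fun z => h (z - z0)); split.
- exists rho => // z zr; apply: (cdiff_comp (g := fun v => v - z0)); last exact: dh.
  by apply: cdiffB; [exact: cdiff_id | exact: cdiff_cst].
- by rewrite subrr.
- by rewrite !subn_eq0 leq_total.
- apply: cnearS fg => z fz zz; rewrite fz//.
  have zz0 : z - z0 != 0 by rewrite subr_eq0.
  have := gh (z - z0); rewrite addrC subrK => ->.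
  have [mk|km] := leqP m k.
    rewrite (eqP mk) expr0 mul1r mulrAC; congr (_ * _).
    by rewrite -{1}(subnK mk) exprD invfM mulrCA mulfV ?mulr1// expf_neq0.
  rewrite (eqP (ltnW km)) expr0 invr1 mulr1 mulrAC; congr (_ * _).
  by rewrite -{1}(subnK (ltnW km)) exprD mulfK// expf_neq0.
Qed.

(** Asking for a whole neighbourhood excludes zeros, poles and also the points where the
    representative has a stray value. *)
Definition reg f z := cnear z (fun w => cdiff f w /\ f w != 0).

Lemma local_form_reg f z0 a b h : local_form f z0 a b h -> cnear z0 (fun z => z != z0 -> reg f z).
Proof.
move=> [dh h0 _ fh].
have ch : ccont h z0 by apply: cdiff_cont; exact: cnear_self dh.
have C := cnearI fh (cnearI dh (ccont_neq0 ch h0)).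
apply: cnearS (cnear_near C) => z Cz zz0.
have Cz' := cnear_near (cnearI (cnear_neq zz0) Cz).
apply: cnearS Cz' => w Cw; have [ww0 [fw [dw hw]]] := cnear_self Cw.
have w0 : w - z0 != 0 by rewrite subr_eq0.
split; last by rewrite fw// mulf_neq0// mulf_neq0 ?invr_eq0 ?expf_neq0.
apply: (@cdiff_near _ (fun z => (z - z0) ^+ a / (z - z0) ^+ b * h z)).
  by apply: cnearS Cw => v [v0 [fv _]]; rewrite fv.
have dz : cdiff (fun z => z - z0) w by apply: cdiffB; [exact: cdiff_id | exact: cdiff_cst].
apply: cdiffM => //; apply: cdiff_div; [exact: cdiffX | exact: cdiffX | exact: expf_neq0].
Qed.

Lemma reg_not_zero_near f z : reg f z -> ~ zero_near f z.
Proof.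
move=> rf zf; have [e e0 H] := cnearI rf zf.
pose w := z + (e / 2)%:C.
have E : w - z = (e / 2)%:C by rewrite /w addrC addKr.
have wz : w != z by rewrite -subr_eq0 E -normc_gt0 normcR normr_gt0 gt_eqF// divr_gt0.
have [|[_ fw] zw] := H w.
  by rewrite E normcR gtr0_norm ?divr_gt0// ltr_pdivrMr// ltr_pMr// ltr1n.
by rewrite zw ?eqxx in fw.
Qed.

Lemma cnear_punct z0 (P : R[i] -> Prop) : cnear z0 (fun z => z != z0 -> P z) ->
  exists2 z, z != z0 & P z.
Proof.
move=> [e e0 H]; pose w := z0 + (e / 2)%:C.
have E : w - z0 = (e / 2)%:C by rewrite /w addrC addKr.
have wz : w != z0 by rewrite -subr_eq0 E -normc_gt0 normcR normr_gt0 gt_eqF// divr_gt0.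
exists w => //; apply: H => //.
by rewrite E normcR gtr0_norm ?divr_gt0// ltr_pdivrMr// ltr_pMr// ltr1n.
Qed.

Lemma zero_near_open f z0 : zero_near f z0 -> cnear z0 (fun z => zero_near f z).
Proof.
move=> zf; apply: cnearS (cnear_near zf) => z Cz.
have [->//|zz0] := eqVneq z z0.
by apply: cnearS (cnearI Cz (cnear_neq zz0)) => w [fw ww0] _; exact: fw.
Qed.

Lemma local_form_not_zero f z0 a b h : local_form f z0 a b h -> ~ zero_near f z0.
Proof.
move=> lf zf; have := cnearI (local_form_reg lf) (zero_near_open zf).
have C : cnear z0 (fun z => z != z0 -> reg f z /\ zero_near f z).
  by apply: cnearS (cnearI (local_form_reg lf) (zero_near_open zf)) => z [H1 H2] /H1.
by move=> _; have [z _ [rz zz]] := cnear_punct C; apply: (reg_not_zero_near rz).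
Qed.

(* The points where [f] vanishes identically nearby form a clopen set; bisection
   along a segment plays the role of connectedness. *)
Lemma mero_identity f : meromorphic f -> (exists z0, ~ zero_near f z0) ->
  forall z, exists a b h, local_form f z a b h.
Proof.
move=> mf [z0 nz0] z1; have [zf|//] := mero_dichotomy z1 mf; exfalso.
pose c (t : R) : R[i] := z0 + t%:C * (z1 - z0).
(* [P] says that one alternative holds along the whole parameter interval. The case [w < 0] is there
   because the splitting premise of [box_ind] ranges over all widths, and the two halves share a
   midpoint only if [0 <= w]. *)
pose P (x y w h : R) := (forall t, x <= t <= x + w -> zero_near f (c t)) \/
   (forall t, x <= t <= x + w -> ~ zero_near f (c t)) \/ w < 0.
have [||||A|[A|]] := @box_ind R P 0 0 1 0.
- move=> x y w h.
  have [w0|w0] := ltP w 0; first by move=> *; right; right.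
  have mid : x <= x + w / 2 <= x + w / 2 by rewrite lexx lerDl divr_ge0.
  have mid' : x + w / 2 <= x + w / 2 <= x + w / 2 + w / 2 by rewrite lexx lerDl divr_ge0.
  have E : x + w / 2 + w / 2 = x + w by rewrite -addrA -splitr.
  case=> [A1|[A1|]]; last by rewrite ltNge divr_ge0.
    case=> [A2|[A2|]]; last by rewrite ltNge divr_ge0.
      move=> _ _; left => t /andP[xt tx]; have [th|th] := leP t (x + w / 2).
        by apply: A1; rewrite xt.
      by apply: A2; rewrite (ltW th) E.
    by have := A2 _ mid' (A1 _ mid).
  case=> [A2|[A2|]]; last by rewrite ltNge divr_ge0.
    by have := A1 _ mid (A2 _ mid').
  move=> _ _; right; left => t /andP[xt tx]; have [th|th] := leP t (x + w / 2).
    by apply: A1; rewrite xt.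
  by apply: A2; rewrite (ltW th) E.
- exact: ler01.
- exact: lexx.
- move=> a b _ _.
  have [e e0 He] : cnear (c a) (fun z => (zero_near f (c a) -> zero_near f z) /\ (~ zero_near f (c a) -> ~ zero_near f z)).
    have [/zero_near_open Z|[a' [b' [h' lf]]]] := mero_dichotomy (c a) mf.
      by apply: cnearS (Z) => z zz; split => // /(_ (cnear_self Z)).
    apply: cnearS (local_form_reg lf) => z Hz.
    split; first by move/(local_form_not_zero lf).
    have [->//|zc] := eqVneq z (c a).
    by move=> _; apply: reg_not_zero_near; exact: Hz.
  pose n := normc (z1 - z0).
  have n10 : 0 < n + 1 by rewrite ltr_wpDl// normc_ge0.
  exists (e / (n + 1)); first by rewrite divr_gt0.
  move=> x y w h xa _ wd _.
  have near t : x <= t <= x + w -> normc (c t - c a) < e.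
    move=> xt; rewrite /c opprD addrACA subrr add0r -mulrBl -rmorphB normcM normcR.
    have ta : `|t - a| <= w.
      move: xa xt => /andP[? ?] /andP[? ?]; rewrite ler_norml; apply/andP; split; lra.
    rewrite (@le_lt_trans _ _ (w * (n + 1)))//; last by rewrite -ltr_pdivlMr.
    by rewrite ler_pM ?normc_ge0// lerDl.
  have [Z|Z] := pselect (zero_near f (c a)).
    by left => t /near /He[H _]; exact: H.
  by right; left => t /near /He[_ H]; exact: H.
- by apply: nz0; have := A 0; rewrite /c mul0r addr0; apply; rewrite lexx add0r ler01.
- have := A 1; rewrite /c (_ : z0 + 1%:C * (z1 - z0) = z1); last by rewrite mul1r addrC subrK.
  apply => //.
  by rewrite add0r lexx ler01.
- by rewrite ltr10.
Qed.

(** If [n < m], dividing by [(z - z0) ^+ n] leaves a left side tending to 0 and a right side tending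
    to [v z0]. *)
Lemma power_order (u v : R[i] -> R[i]) z0 (m n : nat) : ccont u z0 -> ccont v z0 ->
  v z0 != 0 -> cnear z0 (fun z => z != z0 -> u z * (z - z0) ^+ m = v z * (z - z0) ^+ n) ->
  (m <= n)%N.
Proof.
move=> cu cv v0 E; rewrite leqNgt; apply/negP => nm.
have {}E : cnear z0 (fun z => z != z0 -> u z * (z - z0) ^+ (m - n) = v z).
  apply: cnearS E => z E zz0; have := E zz0; rewrite -{1}(subnK (ltnW nm)) exprD mulrA.
  by apply: mulIf; rewrite expf_neq0// subr_eq0.
pose d z := v z - u z * (z - z0) ^+ (m - n).
have cd : ccont d z0.
  apply: ccontB => //; apply: ccontM => //; apply: ccontX.
  by apply: ccontB; [exact: ccont_id | exact: ccont_cst].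
have d0 : d z0 != 0.
  by rewrite /d subrr expr0n (gtn_eqF (_ : 0 < m - n)%N) ?subn_gt0// mulr0 subr0.
have C : cnear z0 (fun z => z != z0 -> False).
  by apply: cnearS (cnearI E (ccont_neq0 cd d0)) => z [Ez dz] /Ez; move: dz; rewrite /d subr_eq0 => /eqP dz /esym.
by have [z _] := cnear_punct C.
Qed.

Lemma pole_order_local f z0 a b h : local_form f z0 a b h -> pole_order f z0 = b.
Proof.
move=> [dh h0 ab fh]; have ch : ccont h z0 by apply: cdiff_cont; exact: cnear_self dh.
have uniq k : (exists2 g, laurent_at f z0 k g & g z0 != 0) -> k = b.
  move=> [g [/holomorphic_cdiff dg /dcnearP fg] g0].
  have cg : ccont g z0 by apply: cdiff_cont; exact: cnear_self dg.
  have E : cnear z0 (fun z => z != z0 -> g z * (z - z0) ^+ b = h z * (z - z0) ^+ (a + k)).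
    apply: cnearS (cnearI fg fh) => z [fz fz'] zz0; have := fz zz0; rewrite fz'//.
    have zz : z - z0 != 0 by rewrite subr_eq0.
    move=> EE; have zb := expf_neq0 b zz; have zk := expf_neq0 k zz.
    rewrite -[g z](divfK zk) -EE exprD.
    by move: (_ ^+ a) (_ ^+ b) (_ ^+ k) zb => x y K y0; field.
  have bk : b = (a + k)%N.
    apply/eqP; rewrite eqn_leq (power_order cg ch h0 E)/=.
    apply: (power_order ch cg g0); apply: cnearS E => z Ez /Ez <-.
    by [].
  by case/orP: ab => /eqP E0; move: bk; rewrite E0 ?add0n// => /esym/eqP; rewrite addn_eq0 => /andP[_ /eqP].
rewrite /pole_order; case: xgetP => [k _|N]; first exact: uniq.
(* Without an admissible order the default is 0, which is right: for [0 < b] one has [a = 0], and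
   [h] would be a witness for [b]. *)
have [//|b0] := posnP b; exfalso; apply: (N b); exists h => //; split.
  exact/holomorphic_cdiff.
apply/dcnearP; move: ab; rewrite (gtn_eqF b0) orbF => /eqP a0.
by apply: cnearS fh => z fz /fz ->; rewrite a0 expr0 mul1r mulrC.
Qed.

Lemma local_formV f z0 a b h : local_form f z0 a b h ->
  local_form (fun z => (f z)^-1) z0 b a (fun z => (h z)^-1).
Proof.
move=> [dh h0 ab fh]; have ch : ccont h z0 by apply: cdiff_cont; exact: cnear_self dh.
split; first by apply: cnearS (cnearI dh (ccont_neq0 ch h0)) => z [? ?]; exact: cdiffV.
- by rewrite invr_eq0.
- by rewrite orbC.
- by apply: cnearS fh => z fz /fz ->; rewrite invfM invf_div.
Qed.

(** Compactness of a square by bisection: a small box contains at most one exceptional point, and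
    the lists of the quarters are concatenated. *)
Lemma discrete_finite (P : R[i] -> Prop) : (forall z0, cnear z0 (fun z => z != z0 -> P z)) ->
  forall r, exists2 s : seq R[i], uniq s & forall z, z \in s <-> (normc z <= r /\ ~ P z).
Proof.
move=> HP r.
pose Q (x y w h : R) := exists s : seq R[i], forall a b, x <= a <= x + w -> y <= b <= y + h ->
  ~ P (a +i* b) -> a +i* b \in s.
have r20 : 0 <= 2 * `|r| by rewrite mulr_ge0.
have [||||s Hs] := @box_ind R Q (- `|r|) (- `|r|) (2 * `|r|) (2 * `|r|).
- move=> x y w h [s1 H1] [s2 H2] [s3 H3] [s4 H4]; exists (s1 ++ s2 ++ s3 ++ s4).
  move=> a b /andP[xa ax] /andP[yb by'] nP; rewrite !mem_cat.
  have [aw|aw] := leP a (x + w / 2); have [bh|bh] := leP b (y + h / 2).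
  + by rewrite H1 ?xa ?yb.
  + by rewrite H3 ?xa ?(ltW bh) ?orbT//= -addrA -splitr.
  + by rewrite H2 ?yb ?(ltW aw) ?orbT//= -addrA -splitr.
  + by rewrite H4 ?(ltW aw) ?(ltW bh) ?orbT//= -addrA -splitr.
- exact: r20.
- exact: r20.
- move=> a b _ _; have [e e0 He] := HP (a +i* b); exists (e / 2); first by rewrite divr_gt0.
  move=> x y w h xa yb wd hd; exists [:: a +i* b] => a' b' xa' yb' nP.
  rewrite inE; apply: contrapT => /negP ne; apply: nP; apply: He => //; simpc.
  rewrite (le_lt_trans (normc_leRI _))//= [e]splitr ltrD//.
    apply: le_lt_trans wd; move: xa xa' => /andP[? ?] /andP[? ?].
    by rewrite ler_norml; apply/andP; split; lra.
  apply: le_lt_trans hd; move: yb yb' => /andP[? ?] /andP[? ?].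
  by rewrite ler_norml; apply/andP; split; lra.
exists (undup [seq z <- s | `[< normc z <= r /\ ~ P z >]]); first exact: undup_uniq.
move=> z; rewrite mem_undup mem_filter; split; first by case/andP => /asboolP.
move=> [zr nP]; rewrite asboolT//=; case: z zr nP => a b zr nP.
have la := le_trans (ger_Re _) (le_trans zr (ler_norm _)).
have lb := le_trans (ger_Im _) (le_trans zr (ler_norm _)).
move: la lb; rewrite /= !ler_norml => /andP[? ?] /andP[? ?].
by apply: Hs => //; apply/andP; split; lra.
Qed.

(** Provides the margin that makes the zero-free factor of a closed disc holomorphic on a larger
    open one. *)
Lemma disc_gap (s : seq R[i]) r : exists2 r', r < r' & forall z, z \in s -> normc z < r' -> normc z <= r.
Proof.
elim: s => [|c s [r' rr' H]]; first by exists (r + 1); [rewrite ltrDl | ].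
have [cr|cr] := leP (normc c) r.
  by exists r' => // z; rewrite inE => /orP[/eqP ->//|/H].
exists (Num.min r' (normc c)); first by rewrite lt_min rr'.
move=> z; rewrite inE lt_min => /orP[/eqP ->|/H zs /andP[/zs]//].
by rewrite ltxx andbF.
Qed.

End meromorphic.

(** * Factorization on discs *)

Section factorization.
Variable R : realType.
Implicit Types (f g h F L : R[i] -> R[i]) (z w : R[i]) (r rho : R).

Definition rprod (s : seq R[i]) z : R[i] := \prod_(c <- s) (z - c).

Lemma rprod_neq0 s z : z \notin s -> rprod s z != 0.
Proof.
rewrite /rprod; elim: s => [|c s IH]; first by rewrite big_nil oner_neq0.
by rewrite inE negb_or big_cons => /andP[zc zs]; rewrite mulf_neq0 ?IH// subr_eq0.
Qed.

Lemma cdiff_rprod s z : cdiff (rprod s) z.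
Proof. by apply: cdiff_prod => c; apply: cdiffB; [exact: cdiff_id | exact: cdiff_cst]. Qed.

Lemma rprod_flatten (s : seq R[i]) (B : R[i] -> nat) z :
  rprod (flatten [seq nseq (B c) c | c <- s]) z = \prod_(c <- s) (z - c) ^+ B c.
Proof.
rewrite /rprod big_flatten big_map; apply: eq_bigr => c _.
by rewrite big_nseq; elim: (B c) => [|n IH]; [rewrite expr0 | rewrite exprS -IH].
Qed.

Lemma count_flatten_nseq (s : seq R[i]) (B : R[i] -> nat) z : uniq s ->
  count_mem z (flatten [seq nseq (B c) c | c <- s]) = (if z \in s then B z else 0)%N.
Proof.
elim: s => [|c s IH]//= /andP[cs us]; rewrite count_cat IH// count_nseq/= inE.
have [<-|cz] := eqVneq c z; first by rewrite (negbTE cs) mul1n addn0.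
by rewrite mul0n.
Qed.

Lemma mem_flatten_nseq (s : seq R[i]) (B : R[i] -> nat) z :
  z \in flatten [seq nseq (B c) c | c <- s] -> z \in s.
Proof. by move=> /flattenP[_ /mapP[c cs ->]]; rewrite mem_nseq => /andP[_ /eqP ->]. Qed.

(** [T c] is the inverse of the singular factor of [f] at [c]; multiplying by it at each of the
    finitely many irregular points of the closed disc leaves [F]. Points where only the value of [f]
    is wrong have [A c = B c = 0] and enter neither list. *)
Lemma factorization f r : (forall z, exists a b h, local_form f z a b h) ->
  exists rho F (ps qs : seq R[i]), [/\ r < rho,
    forall z, normc z < rho -> cdiff F z /\ F z != 0,
    forall p, p \in ps ++ qs -> normc p <= r,
    forall z, normc z < rho -> reg f z ->
      [/\ z \notin ps, z \notin qs & f z * rprod ps z = F z * rprod qs z] &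
    forall z, normc z <= r -> pole_order f z = count_mem z ps /\
      pole_order (fun z => (f z)^-1) z = count_mem z qs].
Proof.
move=> lf.
have [A HA] := choice lf; have [B HB] := choice HA; have [H HH] := choice HB => {HA HB}.
have dr z0 : cnear z0 (fun z => z != z0 -> reg f z) by exact: local_form_reg (HH z0).
have [s us Hs] := discrete_finite dr (r + 1).
have [r' rr' Hr'] := disc_gap s r.
pose rho := Num.min r' (r + 1).
pose s1 := [seq z <- s | normc z <= r].
have us1 : uniq s1 by rewrite filter_uniq.
have s1r z : z \in s1 -> normc z <= r by rewrite mem_filter => /andP[].
have s1P z : normc z < rho -> ~ reg f z -> z \in s1.
  rewrite lt_min => /andP[zr' zr1] nz; have zs : z \in s by apply/Hs; split => //; exact: ltW.
  by rewrite mem_filter zs andbT Hr'.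
have s1P' z : z \in s1 -> ~ reg f z by rewrite mem_filter => /andP[_ /Hs[]].
pose T c z : R[i] := (z - c) ^+ B c / (z - c) ^+ A c.
pose W t z : R[i] := \prod_(c <- t) T c z.
have WE t z : W t z = rprod (flatten [seq nseq (B c) c | c <- t]) z /
    rprod (flatten [seq nseq (A c) c | c <- t]) z.
  rewrite !rprod_flatten /W; elim: t => [|c t IH]; first by rewrite !big_nil divr1.
  by rewrite !big_cons IH /T invfM !mulrA; congr (_ / _); rewrite -!mulrA; congr (_ * _); rewrite mulrC.
have W0 t z : z \notin t -> W t z != 0.
  move=> zt; rewrite WE mulf_neq0 ?invr_eq0//; apply: rprod_neq0; apply: contra zt; exact: mem_flatten_nseq.
have dW t z : z \notin t -> cdiff (W t) z.
  move=> zt; have -> : W t = fun z => rprod (flatten [seq nseq (B c) c | c <- t]) z /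
    rprod (flatten [seq nseq (A c) c | c <- t]) z by apply/funext => v; exact: WE.
  apply: cdiff_div; [exact: cdiff_rprod|exact: cdiff_rprod|].
  by apply: rprod_neq0; apply: contra zt; exact: mem_flatten_nseq.
have Wrem z0 z : z0 \in s1 -> W s1 z = T z0 z * W (rem z0 s1) z.
  by move=> z0s; rewrite /W (big_rem z0).
have remP z0 : z0 \notin rem z0 s1 by rewrite mem_rem_uniq// inE eqxx.
(* At an irregular point the product [f z * W s1 z] is meaningless; the local factor [H z z]
   supplies the limit value. *)
pose F z : R[i] := if z \in s1 then H z z * W (rem z s1) z else f z * W s1 z.
have near_s1 z0 : cnear z0 (fun z => z != z0 -> z \notin s1).
  apply: cnearS (dr z0) => z Hz zz0; apply/negP => /s1P'; apply.
  exact: Hz.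
exists rho, F, (flatten [seq nseq (B c) c | c <- s1]), (flatten [seq nseq (A c) c | c <- s1]).
split.
- by rewrite lt_min rr' ltrDl ltr01.
- move=> z0 z0r; rewrite {2}/F; case: ifPn => z0s; last first.
    have rz0 : reg f z0 by apply: contrapT => /(s1P _ z0r); exact/negP.
    have [dz fz] := cnear_self rz0; split; last by rewrite mulf_neq0// W0.
    apply: (@cdiff_near _ (fun z => f z * W s1 z)); last by apply: cdiffM => //; exact: dW.
    apply: cnearS (near_s1 z0) => z Hz; rewrite /F.
    have [->|zz0] := eqVneq z z0; first by rewrite (negbTE z0s).
    by rewrite (negbTE (Hz zz0)).
  have [dh h0 _ fh] := HH z0; split; last by rewrite mulf_neq0// W0.
  apply: (@cdiff_near _ (fun z => H z0 z * W (rem z0 s1) z)); last first.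
    by apply: cdiffM; [exact: cnear_self dh | exact: dW].
  apply: cnearS (cnearI (near_s1 z0) fh) => z [Hz Fz]; rewrite /F.
  have [->|zz0] := eqVneq z z0; first by rewrite z0s.
  have zz : z - z0 != 0 by rewrite subr_eq0.
  rewrite (negbTE (Hz zz0)) Fz// (Wrem z0)// mulrA; congr (_ * _).
  have za := expf_neq0 (A z0) zz; have zb := expf_neq0 (B z0) zz; rewrite /T.
  by move: (_ ^+ A z0) (_ ^+ B z0) za zb => x y x0 y0; field; rewrite x0.
- by move=> p; rewrite mem_cat => /orP[] /mem_flatten_nseq /s1r.
- move=> z zr rz; have zs : z \notin s1 by apply/negP => /s1P'.
  have n t (C : R[i] -> nat) : z \notin t -> z \notin flatten [seq nseq (C c) c | c <- t].
    by apply: contra; exact: mem_flatten_nseq.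
  split; [exact: n | exact: n |].
  rewrite /F (negbTE zs) WE -mulrA divfK//; exact/rprod_neq0/n.
- move=> z zr; rewrite !count_flatten_nseq//.
  rewrite (pole_order_local (HH z)) (pole_order_local (local_formV (HH z))).
  case: ifPn => // zs.
  have rz : reg f z.
    by apply: contrapT => /(s1P _ (le_lt_trans zr _)); rewrite lt_min rr' ltrDl ltr01 (negbTE zs) => /(_ isT).
  have [dz fz] := cnear_self rz.
  have lr : local_form f z 0 0 f.
    split => //; first by apply: cnearS rz => v [].
    by apply: cnearT => v _; rewrite !expr0 divr1 mul1r.
  by rewrite -(pole_order_local (HH z)) -(pole_order_local (local_formV (HH z)))
    (pole_order_local lr) (pole_order_local (local_formV lr)).
Qed.

(** [F z / F 0] telescopes along the radius into quotients at the points [k / N * z]. For [N] large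
    all of them lie in the right half-plane, where [cLog] is holomorphic, and the logarithm is the
    sum of theirs. *)
Lemma hol_log F rho r : (forall z, normc z < rho -> cdiff F z /\ F z != 0) -> 0 < r < rho ->
  exists L, (forall z, normc z < r -> cdiff L z) /\
    (forall z, normc z <= r -> Re (L z) = ln (normc (F z))).
Proof.
move=> HF /andP[r0 rrho].
have dF z : normc z <= r -> cdiff F z by move=> zr; apply: (HF _ (le_lt_trans zr rrho)).1.
have F0 z : normc z <= r -> F z != 0 by move=> zr; apply: (HF _ (le_lt_trans zr rrho)).2.
(* Uniform continuity relative to the size of [F]: the inequality puts [F z / F (a +i* b)] within 1
   of 1, hence in the right half-plane. *)
pose P (x y w h : R) := exists2 d, 0 < d & forall a b z, x <= a <= x + w -> y <= b <= y + h ->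
  normc (a +i* b) <= r -> normc (z - (a +i* b)) < d -> normc (F z - F (a +i* b)) < normc (F (a +i* b)).
have r20 : 0 <= 2 * r by rewrite mulr_ge0// ltW.
have [||||d d0 Hd] := @box_ind R P (- r) (- r) (2 * r) (2 * r).
- move=> x y w h [d1 d10 H1] [d2 d20 H2] [d3 d30 H3] [d4 d40 H4].
  exists (Num.min d1 (Num.min d2 (Num.min d3 d4))); first by rewrite !lt_min d10 d20 d30.
  move=> a b z /andP[xa ax] /andP[yb by'] abr; rewrite !lt_min => /and4P[z1 z2 z3 z4].
  have [aw|aw] := leP a (x + w / 2); have [bh|bh] := leP b (y + h / 2).
  + by apply: H1; rewrite ?xa ?yb.
  + by apply: H3; rewrite ?xa ?(ltW bh)//= -addrA -splitr.
  + by apply: H2; rewrite ?yb ?(ltW aw)//= -addrA -splitr.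
  + by apply: H4; rewrite ?(ltW aw) ?(ltW bh)//= -addrA -splitr.
- exact: r20.
- exact: r20.
- move=> a b _ _; set z0 := a +i* b.
  have box (e x y w h a' b' : R) : x <= a <= x + w -> y <= b <= y + h -> w < e / 2 -> h < e / 2 ->
     x <= a' <= x + w -> y <= b' <= y + h -> normc ((a' +i* b') - z0) < e.
    move=> xa yb we he xa' yb'; simpc; rewrite (le_lt_trans (normc_leRI _))//= [e]splitr ltrD//.
      apply: le_lt_trans we; move: xa xa' => /andP[? ?] /andP[? ?].
      by rewrite ler_norml; apply/andP; split; lra.
    apply: le_lt_trans he; move: yb yb' => /andP[? ?] /andP[? ?].
    by rewrite ler_norml; apply/andP; split; lra.
  have [z0r|z0r] := leP (normc z0) r; last first.
    have [e e0 He] := cnear_out z0r; exists (e / 2); first by rewrite divr_gt0.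
    move=> x y w h xa yb we he; exists 1 => // a' b' z xa' yb' ar.
    have := He _ (box e x y w h a' b' xa yb we he xa' yb').
    by rewrite ltNge ar.
  have n0 : 0 < normc (F z0) by rewrite normc_gt0 F0.
  have n40 : 0 < normc (F z0) / 4 by rewrite divr_gt0.
  have [e e0 He] := cdiff_cont (dF _ z0r) n40.
  have e20 : 0 < e / 2 by rewrite divr_gt0.
  exists (e / 2 / 2); first by rewrite divr_gt0.
  move=> x y w h xa yb we he; exists (e / 2) => // a' b' z xa' yb' ar zz.
  have ae := box (e / 2) x y w h a' b' xa yb we he xa' yb'.
  have := He _ (lt_trans ae _); rewrite ltr_pdivrMr// ltr_pMr// ltr1n => /(_ isT) Ha.
  have Hz : normc (F z - F z0) < normc (F z0) / 4.
    apply: He; rewrite -[z](subrK (a' +i* b')) -addrA (le_lt_trans (normcD _ _))// [e]splitr ltrD//.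
  set F1 := F (a' +i* b') in Ha *.
  have B1 : normc (F z - F1) <= normc (F z - F z0) + normc (F1 - F z0).
    by rewrite -(subrKA (F z0)) (le_trans (normcD _ _))// lerD2l normcBC.
  have B2 := normc_geB (F z0) F1; rewrite normcBC in B2.
  by move: B1 B2 Ha Hz; lra.
have {Hd}Hd z w : normc z <= r -> normc w <= r -> normc (w - z) < d -> 0 < Re (F w / F z).
  move=> zr wr wz; have lz := le_trans (ger_Re z) zr; have lz' := le_trans (ger_Im z) zr.
  have := Hd (Re z) (Im z) w; case: z zr wz lz lz' => a b zr wz; rewrite /= !ler_norml.
  move=> /andP[? ?] /andP[? ?] H.
  have {}H : normc (F w - F (a +i* b)) < normc (F (a +i* b)).
    by apply: H => //; apply/andP; split; lra.
  have Fz := F0 _ zr.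
  have : normc (F w / F (a +i* b) - 1) < 1.
    rewrite (_ : _ - 1 = (F w - F (a +i* b)) / F (a +i* b)); last by field.
    by rewrite normcM normcV ltr_pdivrMr ?normc_gt0// mul1r.
  move=> /(le_lt_trans (ger_Re _)); rewrite ReB/= ltr_norml => /andP[+ _]; lra.
have [n Hn] := half_pow_lt r d0.
pose N := (2 ^ n)%N; have N0 : (0 < N)%N by rewrite expn_gt0.
pose c (k : nat) z : R[i] := (k%:R / N%:R)%:C * z.
have NR : 0 < N%:R :> R by rewrite ltr0n.
have cr k z : (k <= N)%N -> normc z <= r -> normc (c k z) <= r.
  move=> kN; apply: le_trans; rewrite normcM normcR ger0_norm ?divr_ge0//.
  by rewrite ler_piMl ?normc_ge0// ler_pdivrMr// mul1r ler_nat.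
have cc k z : normc z <= r -> normc (c k.+1 z - c k z) < d.
  move=> zr; rewrite /c -mulrBl -rmorphB -mulrBl -natrB// subSnn.
  rewrite normcM normcR ger0_norm ?divr_ge0// mul1r (le_lt_trans _ Hn)//.
  by rewrite mulrC /N natrX ler_wpM2r// invr_ge0 exprn_ge0.
pose term k z := cLog (F (c k.+1 z) / F (c k z)).
have pos (k : 'I_N) z : normc z <= r -> 0 < Re (F (c k.+1 z) / F (c k z)).
  by move=> zr; apply: Hd; [apply: cr | apply: cr | exact: cc] => //; exact: ltnW.
exists (fun z => (ln (normc (F 0)))%:C + \sum_(k < N) term k z); split.
  move=> z /ltW zr; apply: cdiffD; first exact: cdiff_cst.
  have dsum (I : Type) (s : seq I) (G : I -> R[i] -> R[i]) : (forall i, cdiff (G i) z) ->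
      cdiff (fun w => \sum_(i <- s) G i w) z.
    move=> HG; elim: s => [|i s IH].
      by apply: (cdiff_near _ (cdiff_cst 0 z)); apply: cnearT => w; rewrite big_nil.
    by apply: (cdiff_near _ (cdiffD (HG i) IH)); apply: cnearT => w; rewrite big_cons.
  apply: dsum => k; apply: (cdiff_comp (g := fun z => F (c k.+1 z) / F (c k z))); last exact/cdiff_cLog/pos.
  have dc m : (m <= N)%N -> cdiff (fun z => F (c m z)) z.
    move=> mN; apply: (cdiff_comp (g := c m)); last exact/dF/cr.
    by apply: cdiffM; [exact: cdiff_cst | exact: cdiff_id].
  apply: cdiff_div; [exact: dc | apply: dc; exact: ltnW|].
  by apply: F0; apply: cr => //; exact: ltnW.
move=> z zr; rewrite ReD /=.
have -> : Re (\sum_(k < N) term k z) = \sum_(k < N) (ln (normc (F (c k.+1 z))) - ln (normc (F (c k z)))).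
  transitivity (\sum_(k < N) Re (term k z)).
    by elim/big_rec2: _ => [//|k x y _ <-]; rewrite ReD.
  apply: eq_bigr => k _; rewrite /term /cLog/= normcM normcV lnM ?lnV ?posrE//.
  - by rewrite normc_gt0 F0// cr// ltnW.
  - by rewrite normc_gt0 F0// cr.
  - by rewrite invr_gt0 normc_gt0 F0// cr// ltnW.
rewrite -(big_mkord xpredT (fun k => ln (normc (F (c k.+1 z))) - ln (normc (F (c k z))))).
rewrite telescope_sumr// /c mul0r divff ?gt_eqF//.
by rewrite (_ : 0%:C * z = 0) ?mul0r// (_ : 1%:C * z = z) ?mul1r// addrC subrK.
Qed.

End factorization.

(** * Poisson bounds and means of negative powers *)

Section poisson.
Variable R : realType.
Implicit Types (f g h F L : R[i] -> R[i]) (z w q : R[i]) (r rho : R).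

Lemma rcont_ln (u : R[i] -> R) z : rcont u z -> 0 < u z -> rcont (fun w => ln (u w)) z.
Proof. by move=> cu u0; apply: rcont_comp cu _; exact: continuous_ln. Qed.

Lemma rcont_cst (k : R) z : rcont (fun=> k) z.
Proof. by move=> e e0; exists 1 => // w _; rewrite subrr normr0. Qed.

Lemma rcontN (u : R[i] -> R) z : rcont u z -> rcont (fun w => - u w) z.
Proof. by move=> cu e e0; apply: cnearS (cu e e0) => w; rewrite -opprD normrN. Qed.

Lemma rcontB (u v : R[i] -> R) z : rcont u z -> rcont v z -> rcont (fun w => u w - v w) z.
Proof. by move=> cu cv; apply: rcontD => //; exact: rcontN. Qed.

Lemma rcont_abs (u : R[i] -> R) z : rcont u z -> rcont (fun w => `|u w|) z.
Proof.
by move=> cu e e0; apply: cnearS (cu e e0) => w; apply: le_lt_trans; exact: ler_dist_dist.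
Qed.

Lemma rcont_expR (u : R[i] -> R) z : rcont u z -> rcont (fun w => expR (u w)) z.
Proof. by move=> cu; apply: rcont_comp cu _; exact: continuous_expR. Qed.

Lemma rcont_ln_normc F z : ccont F z -> F z != 0 -> rcont (fun w => ln (normc (F w))) z.
Proof. by move=> cF F0; apply: rcont_ln; [exact: rcont_normc | rewrite normc_gt0]. Qed.

Section zero_free.
Variables (F : R[i] -> R[i]) (rho r : R).
Hypothesis HF : forall z, normc z < rho -> cdiff F z /\ F z != 0.
Hypotheses (r0 : 0 < r) (rrho : r < rho).

Let lnF z := ln (normc (F z)).

Lemma circ_lnF : circ_cont lnF r.
Proof.
move=> z zr; have [|dF F0] := HF (z := z); first by rewrite zr.
by apply: rcont_ln_normc => //; exact: cdiff_cont.
Qed.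

Let exL : exists L rho', [/\ r < rho', forall z, normc z < rho' -> cdiff L z &
  forall z, normc z <= rho' -> Re (L z) = lnF z].
Proof.
have [|L [dL eL]] := @hol_log R F rho ((r + rho) / 2) HF.
  by apply/andP; split; move: r0 rrho; lra.
by exists L, ((r + rho) / 2); split => //; move: r0 rrho; lra.
Qed.

Lemma lnF_mean : cmean lnF r = lnF 0.
Proof.
have [L [rho' [rr' dL eL]]] := exL.
have := @cmean_mvp R L 0 rho' r (fun z zr => cdiff_cont (dL z zr)).
move=> /(_ (fun z zr _ => dL z (andP zr).2)); rewrite r0 => /(_ rr').
move=> /(congr1 (fun z => Re z)) /=; rewrite eL ?normc0 ?(ltW (lt_trans r0 rr'))// => <-.
by apply: eq_cmean; [exact: ltW | move=> z zr; rewrite eL// zr ltW].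
Qed.

Lemma circ_kernel z : normc z < r -> ccirc_cont (fun w => w / (w - z)) r.
Proof.
move=> zr w wr; apply: ccont_div; first exact: ccont_id.
  by apply: ccontB; [exact: ccont_id | exact: ccont_cst].
by rewrite subr_eq0; apply: contraTneq zr => <-; rewrite wr ltxx.
Qed.

(** Cauchy's formula for a logarithm [L] of [F] and the conjugate-kernel formula for [L] add up to
    the mean of [2 * Re (L w)] against the kernel; the real part is the claim. *)
Lemma lnF_schwarz z : normc z < r ->
  lnF z + lnF 0 = 2 * cmean (fun w => lnF w * Re (w / (w - z))) r.
Proof.
move=> zr; have [L [rho' [rr' dL eL]]] := exL.
have zr' := lt_trans zr rr'.
have cL : ccirc_cont L r by move=> w wr; apply/cdiff_cont/dL; rewrite wr.
have ck := circ_kernel zr.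
have E1 := @cauchy_formula R L rho' r z (fun z zr => cdiff_cont (dL z zr))
  (fun z zr => dL z (andP zr).2) zr rr'.
have E2 := @conj_kernel_mean R L rho' r z dL zr rr'.
have := congr1 (fun z => Re z) (congr2 +%R E1 E2).
rewrite -cmeanCD ?(ltW r0)//.
- have e0 : Re (L 0) = lnF 0 by rewrite eL// normc0 ltW// (lt_trans r0).
  rewrite [Re (L z + _)]ReD [Re (L 0)^*%C](_ : _ = Re (L 0)); last by case: (L 0).
  rewrite (eL z (ltW zr')) e0 => <- /=.
  rewrite -cmeanZ ?(ltW r0)//.
    apply: eq_cmean; first exact: ltW.
    move=> w wr; rewrite -eL ?wr ?(ltW rr')//.
    by move: (w / (w - z)) (L w) => [a b] [c d] /=; ring.
  move=> w wr; apply: rcontM; first exact: circ_lnF.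
  exact/rcont_Re/ck.
- by move=> w wr; apply: ccontM; [exact: cL | exact: ck].
- by move=> w wr; apply: ccontM; [apply: ccont_conj; exact: cL | exact: ck].
Qed.

Lemma lnF_poisson z : normc z < r ->
  lnF z = cmean (fun w => lnF w * (2 * Re (w / (w - z)) - 1)) r.
Proof.
move=> zr; have H := lnF_schwarz zr; rewrite -lnF_mean in H.
have c1 : circ_cont (fun w => lnF w * Re (w / (w - z))) r.
  by move=> w wr; apply: rcontM; [exact: circ_lnF | exact/rcont_Re/circ_kernel].
have c2 : circ_cont (fun w => 2 * (lnF w * Re (w / (w - z)))) r by exact: circ_contZ.
transitivity (2 * cmean (fun w => lnF w * Re (w / (w - z))) r - cmean lnF r).
  by rewrite -H addrK.
rewrite -cmeanZ ?(ltW r0)// -cmeanB ?(ltW r0)//; last exact: circ_lnF.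
by apply: eq_cmean; [exact: ltW | move=> w _; ring].
Qed.

(** In the difference of two instances of [lnF_schwarz] the term [lnF 0] cancels, and the kernels
    differ by [w * (z - z') / ((w - z) * (w - z'))], which is small with [z - z']. *)
Lemma lnF_diff z z' : normc z < r -> normc z' < r ->
  `|lnF z - lnF z'| <=
  2 * (r * normc (z - z') / ((r - normc z) * (r - normc z'))) * cmean (fun w => `|lnF w|) r.
Proof.
move=> zr zr'; have H := lnF_schwarz zr; have H' := lnF_schwarz zr'.
have c1 y : normc y < r -> circ_cont (fun w => lnF w * Re (w / (w - y))) r.
  by move=> yr w wr; apply: rcontM; [exact: circ_lnF | exact/rcont_Re/circ_kernel].
have -> : lnF z - lnF z' = 2 * cmean (fun w => lnF w * Re (w / (w - z)) - lnF w * Re (w / (w - z'))) r.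
  rewrite cmeanB ?(ltW r0)//; [|exact: c1|exact: c1].
  by rewrite mulrBr -H -H' opprD addrACA subrr addr0.
rewrite normrM ger0_norm// -mulrA ler_wpM2l//.
set K := r * _ / _.
have cu : circ_cont (fun w => `|lnF w|) r by move=> w wr; apply: rcont_abs; exact: circ_lnF.
rewrite -cmeanZ ?(ltW r0)//.
have c2 : circ_cont (fun w => lnF w * Re (w / (w - z)) - lnF w * Re (w / (w - z'))) r.
  by move=> w wr; apply: rcontB; exact: c1.
have B w : normc w = r -> `|lnF w * Re (w / (w - z)) - lnF w * Re (w / (w - z'))| <= K * `|lnF w|.
  move=> wr; rewrite -mulrBr normrM mulrC ler_wpM2r// -ReB (le_trans (ger_Re _))//.
  have nz y : normc y < r -> w - y != 0.
    by move=> yr; rewrite subr_eq0; apply: contraTneq yr => <-; rewrite wr ltxx.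
  rewrite (_ : _ - _ = w * (z - z') / ((w - z) * (w - z'))); last first.
    by field; rewrite !nz.
  rewrite normcM normcV !normcM wr /K ler_wpM2l ?mulr_ge0 ?normc_ge0 ?(ltW r0)//.
  rewrite lef_pV2 ?posrE ?mulr_gt0 ?normc_gt0 ?nz ?subr_gt0//.
  by rewrite ler_pM ?subr_ge0 ?(ltW zr) ?(ltW zr')// -{1}wr normc_geB.
have cK : circ_cont (fun w => K * `|lnF w|) r by exact: circ_contZ.
rewrite ler_norml -cmeanN ?(ltW r0)//; apply/andP; split; apply: le_cmean => //; try exact: ltW.
- by move=> w wr; apply: rcontN; exact: cK.
- by move=> w /B; rewrite ler_norml => /andP[].
- by move=> w /B; rewrite ler_norml => /andP[].
Qed.

End zero_free.

Lemma circle_dist_conj r w q : normc w = r -> 0 < r ->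
  normc (w - q) = normc ((r ^+ 2)%:C - q^*%C * w) / r.
Proof.
move=> wr r0; rewrite -(normc_conj (w - q)) conjcB (circle_conj wr r0).
have w0 : w != 0 by rewrite -normc_gt0 wr.
have <- : normc w^-1 = r^-1 by rewrite normcV wr.
by rewrite -normcM mulrBl mulfK.
Qed.

Lemma conj_pole_free r q : 0 < r -> normc q < r ->
  exists2 rho, r < rho & forall w, normc w < rho -> (r ^+ 2)%:C - q^*%C * w != 0.
Proof.
move=> r0 qr; exists (if q == 0 then r + 1 else r ^+ 2 / normc q).
  case: eqP => [_|/eqP q0]; first by rewrite ltrDl.
  by rewrite ltr_pdivlMr ?normc_gt0// expr2 ltr_pM2l.
move=> w; rewrite subr_eq0; case: eqP => [-> _|/eqP q0].
  by rewrite rmorph0 mul0r -normc_gt0 normcR normr_gt0 expf_neq0// gt_eqF.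
apply: contraTneq => E; rewrite -leNgt ler_pdivrMr ?normc_gt0// mulrC -normc_conj -normcM -E.
by rewrite normcR ger0_norm// exprn_ge0// ltW.
Qed.

(** For [q] outside the circle [w - q] is zero-free on the disc. For [q] inside, reflecting [q] in
    the circle gives a zero-free function with the same modulus on it and modulus [r] at 0. *)
Lemma ln_mean r q : 0 < r -> normc q != r ->
  cmean (fun w => ln (normc (w - q))) r = ln (Num.max r (normc q)).
Proof.
move=> r0; rewrite neq_lt => /orP[qr|rq].
  rewrite (elimT max_idPl (ltW qr)); have [rho rrho nz] := conj_pole_free r0 qr.
  pose F w : R[i] := ((r ^+ 2)%:C - q^*%C * w) / r%:C.
  have rC : r%:C != 0 by rewrite -normc_gt0 normcR normr_gt0 gt_eqF.
  transitivity (cmean (fun w => ln (normc (F w))) r).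
    apply: eq_cmean; first exact: ltW.
    by move=> w wr; rewrite (circle_dist_conj q wr r0) /F normcM normcV normcR gtr0_norm.
  rewrite (@lnF_mean F rho)//.
    by rewrite /F mulr0 subr0 normcM normcV !normcR !gtr0_norm ?exprn_gt0// expr2 mulfK// gt_eqF.
  move=> w /nz wn; split; last by rewrite mulf_neq0// invr_eq0.
  apply: cdiffM; last exact: cdiff_cst.
  by apply: cdiffB; [exact: cdiff_cst | apply: cdiffM; [exact: cdiff_cst | exact: cdiff_id]].
rewrite (elimT max_idPr (ltW rq)) (@lnF_mean (fun w => w - q) (normc q))//.
  by rewrite sub0r normcN.
move=> w wq; split; first by apply: cdiffB; [exact: cdiff_id | exact: cdiff_cst].
by rewrite subr_eq0; apply: contraTneq wq => ->; rewrite ltxx.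
Qed.

(* Kolmogorov's trick: [g = 1/(1 - a w)] has positive real part, so
   [|g|^d <= Re (g^d) / cos (d pi/2)] and the mean of [g^d] is its value 1 at 0. *)
Lemma kolmogorov (a : R[i]) r d : 0 < r -> normc a * r < 1 -> 0 < d < 1 ->
  cmean (fun w => expR (- d * ln (normc (1 - a * w)))) r <= (cos (d * (pi / 2)))^-1.
Proof.
move=> r0 ar /andP[d0 d1].
have [rho rrho Hrho] : exists2 rho, r < rho & forall w, normc w < rho -> normc (a * w) < 1.
  exists (if a == 0 then r + 1 else (normc a)^-1).
    case: eqP => [_|/eqP a0]; first by rewrite ltrDl.
    by rewrite -[X in _ < X]mul1r ltr_pdivlMr ?normc_gt0// mulrC.
  move=> w; case: eqP => [-> _|/eqP a0]; first by rewrite mul0r normc0.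
  by rewrite normcM -[X in _ < X]mul1r ltr_pdivlMr ?normc_gt0// mulrC.
have Re1 w : normc (a * w) < 1 -> 0 < Re (1 - a * w).
  move=> /(le_lt_trans (ger_Re _)); rewrite ltr_norml ReB /= => /andP[_ H]; lra.
have nz w : normc (a * w) < 1 -> 1 - a * w != 0.
  by move=> /Re1; apply: contraTneq => ->; rewrite ltxx.
have ReV (z : R[i]) : 0 < Re z -> 0 < Re z^-1.
  case: z => x y /= x0; apply: divr_gt0 => //.
  by rewrite ltr_pwDl ?exprn_gt0 ?sqr_ge0.
pose L w := cLog (1 - a * w)^-1.
pose H w := cexp (d%:C * L w).
have dH w : normc w < rho -> cdiff H w.
  move=> /Hrho wr; apply: cdiff_comp (cdiff_cexp _); apply: cdiffM; first exact: cdiff_cst.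
  apply: (cdiff_comp (g := fun w => (1 - a * w)^-1)); last exact/cdiff_cLog/ReV/Re1.
  apply: cdiffV; last exact: nz.
  by apply: cdiffB; [exact: cdiff_cst | apply: cdiffM; [exact: cdiff_cst | exact: cdiff_id]].
have cH : ccirc_cont H r by move=> w wr; apply/cdiff_cont/dH; rewrite wr.
have ReHL w : Re (d%:C * L w) = - d * ln (normc (1 - a * w)) \/ normc (1 - a * w) = 0.
  have [E|n0] := eqVneq (normc (1 - a * w)) 0; [by right | left].
  rewrite /L /cLog normcV lnV ?posrE ?normc_gt0 -?normc_eq0//.
  by rewrite /= mul0r subr0 mulrN mulNr.
have H0 : Re (H 0) = 1.
  have L1 : cLog (1 : R[i]) = 0 by rewrite /cLog normc1 ln1 (_ : Im 1 = 0)// mul0r atan0.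
  by rewrite /H /L mulr0 subr0 invr1 L1 mulr0 cexp0.
have M : cmean (fun w => Re (H w)) r = 1.
  rewrite -H0 -(@cmean_mvp R H 0 rho r)//; last by rewrite r0.
    by move=> z zr; exact/cdiff_cont/dH.
  by move=> z /andP[_ zr] _; exact: dH.
have pi2 : 0 < pi / 2 :> R by rewrite divr_gt0// pi_gt0.
have cp : 0 < cos (d * (pi / 2)).
  apply: cos_gt0_pihalf; apply/andP; split; last by rewrite -[X in _ < X]mul1r ltr_pM2r.
  by have := mulr_gt0 d0 pi2; move: pi2; lra.
rewrite -[leRHS]mulr1 -[X in _ * X]M -cmeanZ ?(ltW r0)//; last exact: ccirc_Re.
apply: le_cmean; first exact: ltW.
- move=> w wr; apply: rcont_expR; apply: rcontM; first exact: rcont_cst.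
  apply: rcont_ln_normc; last by apply: nz; apply: Hrho; rewrite wr.
  by apply: ccontB; [exact: ccont_cst | apply: ccontM; [exact: ccont_cst | exact: ccont_id]].
- by apply: circ_contZ; exact: ccirc_Re.
move=> w wr; have aw : normc (a * w) < 1 by apply: Hrho; rewrite wr.
rewrite [leRHS]mulrC ler_pdivlMr//.
case: (ReHL w) => [E|/eqP]; last by rewrite normc_eq0 (negbTE (nz _ aw)).
rewrite /H /cexp /circle_pt/= -E ler_wpM2l ?expR_ge0//.
rewrite mul0r addr0.
(* [t] is the argument of a point of the right half-plane, so [|d * t| <= d * (pi / 2)], and [cos]
   decreases from 0 to [pi]. *)
set t := atan _.
have tl : - (pi / 2) < t by exact: atan_gtNpi2.
have tu : t < pi / 2 by exact: atan_ltpi2.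
rewrite -(cos_norm (d * t)) normrM (ger0_norm (ltW d0)).
have ta : `|t| <= pi / 2 by rewrite ler_norml !ltW.
have dd : d * (pi / 2) <= pi / 2 by rewrite ger_pMl// ltW.
have dt : d * `|t| <= d * (pi / 2) by rewrite ler_wpM2l// ltW.
rewrite leNgt ltr_cos ?in_itv/=; first by rewrite -leNgt.
  by rewrite mulr_ge0 ?(ltW d0) ?(ltW pi2)//= (le_trans dd)// ler_pdivrMr// ler_pMr ?pi_gt0// ler1n.
by rewrite mulr_ge0 ?(ltW d0)//= (le_trans dt)// (le_trans dd)// ler_pdivrMr// ler_pMr ?pi_gt0// ler1n.
Qed.

(** Both cases reduce to [kolmogorov]. For [q] inside, [normc (w - q) / r] equals
    [normc (1 - a * w)] with [a = q^*%C / r ^+ 2]. For [q] outside, it is at least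
    [normc (1 - a * w)] with [a = q^-1]. *)
Lemma mean_pow q r d : 0 < r -> normc q != r -> 0 < d < 1 ->
  cmean (fun w => expR (d * (ln r - ln (normc (w - q))))) r <= (cos (d * (pi / 2)))^-1.
Proof.
move=> r0 + d01; have d0 : 0 < d by case/andP: d01.
rewrite neq_lt => /orP[qr|rq].
  have ar : normc (q^*%C / (r ^+ 2)%:C) * r < 1.
    rewrite normcM normcV normc_conj normcR ger0_norm ?exprn_ge0 ?(ltW r0)//.
    by rewrite expr2 invfM mulrA divfK ?gt_eqF// ltr_pdivrMr// mul1r.
  apply: le_trans (kolmogorov r0 ar d01); rewrite le_eqVlt; apply/orP; left; apply/eqP.
  apply: eq_cmean; first exact: ltW.
  move=> w wr; congr expR; rewrite mulNr -mulrN; congr (_ * _).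
  have rC : (r ^+ 2)%:C != 0 by rewrite -normc_gt0 normcR normr_gt0 expf_neq0// gt_eqF.
  have wq : w - q != 0 by rewrite subr_eq0; apply: contraTneq qr => <-; rewrite wr ltxx.
  have -> : normc (1 - q^*%C / (r ^+ 2)%:C * w) = normc (w - q) / r.
    rewrite (circle_dist_conj q wr r0).
    rewrite (_ : 1 - _ = ((r ^+ 2)%:C - q^*%C * w) / (r ^+ 2)%:C); last by rewrite mulrBl divff// mulrAC.
    by rewrite normcM normcV normcR ger0_norm ?exprn_ge0 ?(ltW r0)// expr2 invfM mulrA.
  by rewrite lnM ?lnV ?posrE ?invr_gt0 ?normc_gt0// opprD opprK addrC.
have q0 : q != 0 by rewrite -normc_gt0 (lt_trans r0).
have ar : normc q^-1 * r < 1 by rewrite normcV mulrC ltr_pdivrMr ?normc_gt0// mul1r.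
apply: le_trans (kolmogorov r0 ar d01).
have wq w : normc w = r -> w - q != 0.
  by move=> wr; rewrite subr_eq0; apply: contraTneq rq => <-; rewrite wr ltxx.
have E w : 1 - q^-1 * w = - (w - q) / q by field.
apply: le_cmean; first exact: ltW.
- move=> w wr; apply: rcont_expR; apply: rcontM; first exact: rcont_cst.
  apply: rcontB; first exact: rcont_cst.
  apply: rcont_ln_normc; last exact: wq.
  by apply: ccontB; [exact: ccont_id | exact: ccont_cst].
- move=> w wr; apply: rcont_expR; apply: rcontM; first exact: rcont_cst.
  apply: rcont_ln_normc; last by rewrite E mulf_neq0 ?invr_eq0// oppr_eq0 wq.
  by apply: ccontB; [exact: ccont_cst | apply: ccontM; [exact: ccont_cst | exact: ccont_id]].
move=> w wr; rewrite ler_expR mulNr -mulrN ler_wpM2l ?(ltW d0)//.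
rewrite E normcM normcN normcV lnM ?lnV ?posrE ?invr_gt0 ?normc_gt0 ?wq//.
by rewrite opprB lerD2r ler_ln ?posrE ?normc_gt0// ltW.
Qed.

(** Trades a logarithm for a power whose circle mean is controlled. For [x <= 1],
    [ln (1 + x) <= x <= x^d]; for [x > 1], [ln (1 + x) <= 1 + ln x], where [1 <= x^d] and
    [ln x <= x^d / d]. *)
Lemma ln1D_le_pow (x d : R) : 0 < x -> 0 < d <= 1 -> ln (1 + x) <= (1 + d^-1) * expR (d * ln x).
Proof.
move=> x0 /andP[d0 d1]; have di : 0 < d^-1 by rewrite invr_gt0.
have e0 := expR_ge0 (d * ln x).
have l1 (y : R) : 0 <= y -> ln (1 + y) <= y by move=> y0; apply: le_ln1Dx; rewrite (lt_le_trans _ y0).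
have [x1|x1] := leP x 1.
  rewrite (le_trans (l1 _ (ltW x0)))// -{1}(lnK (x := x))//.
  apply: (@le_trans _ _ (expR (d * ln x))); last by rewrite mulrDl mul1r lerDl mulr_ge0// ltW.
  rewrite ler_expR -subr_ge0 -mulN1r -mulrDl mulr_le0//; last by rewrite ln_le0.
  by rewrite subr_le0.
have lx : 0 < ln x by rewrite ln_gt0.
have dl : 0 < d * ln x by rewrite mulr_gt0.
have e1 : 1 + d * ln x <= expR (d * ln x) by exact: expR_ge1Dx.
apply: (@le_trans _ _ (ln ((1 + 1) * x))).
  by rewrite ler_ln ?posrE ?mulr_gt0 ?addr_gt0// mulrDl mul1r lerD2r ltW.
rewrite lnM ?posrE// mulrDl mul1r lerD//.
  by rewrite (le_trans (l1 _ ler01))// (le_trans _ e1)// lerDl ltW.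
by rewrite mulrC ler_pdivlMr// mulrC (le_trans _ e1)// lerDr.
Qed.

End poisson.

(** * The functions [logp] and [counting_fun] *)

Section logplus.
Variable R : realType.
Implicit Types x y : R.

Lemma logpE x : logp x = ln (Num.max 1 x).
Proof.
rewrite /logp; have [x1|x1] := leP x 1; first by rewrite ln1 (elimT max_idPl)// ln_le0.
by rewrite (elimT max_idPr)// ltW// ln_gt0.
Qed.

Lemma logp_ge0 x : 0 <= logp x.
Proof. by rewrite /logp le_max lexx. Qed.

Lemma ln_le_logp x : ln x <= logp x.
Proof. by rewrite /logp le_max lexx orbT. Qed.

Lemma logp_ge1 x : 1 <= x -> logp x = ln x.
Proof. by move=> x1; rewrite /logp (elimT max_idPr)// ln_ge0. Qed.

Lemma logp_le1 x : x <= 1 -> logp x = 0.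
Proof. by move=> x1; rewrite /logp (elimT max_idPl)// ln_le0. Qed.

Lemma le_logp x y : x <= y -> logp x <= logp y.
Proof.
move=> xy; rewrite !logpE ler_ln ?posrE ?lt_max ?ltr01//.
by rewrite ge_max le_max lexx/= le_max xy orbT.
Qed.

Lemma logpM x y : 0 <= x -> 0 <= y -> logp (x * y) <= logp x + logp y.
Proof.
move=> x0 y0; rewrite !logpE -lnM ?posrE ?lt_max ?ltr01// ler_ln ?posrE ?mulr_gt0 ?lt_max ?ltr01//.
have a1 (t : R) : 1 <= Num.max 1 t by rewrite le_max lexx.
rewrite ge_max; apply/andP; split; first by rewrite -[leLHS]mulr1 ler_pM.
by rewrite ler_pM// le_max lexx orbT.
Qed.

Lemma logpX x n : 0 <= x -> logp (x ^+ n) <= n%:R * logp x.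
Proof.
move=> x0; elim: n => [|n IH]; first by rewrite expr0 logp_le1// mul0r.
rewrite exprS (le_trans (logpM _ _))// ?exprn_ge0//.
by rewrite -natr1 mulrDl mul1r addrC lerD2r.
Qed.

Lemma logp_prod (I : Type) (s : seq I) (F : I -> R) : (forall i, 0 <= F i) ->
  logp (\prod_(i <- s) F i) <= \sum_(i <- s) logp (F i).
Proof.
move=> F0; elim: s => [|i s IH]; first by rewrite !big_nil logp_le1.
by rewrite !big_cons (le_trans (logpM _ _))// ?lerD2l// prodr_ge0.
Qed.

(** The sum is at most [size s] times the product of the [Num.max 1 (F i)]. The successor keeps the
    argument of [ln] at least 1 for the empty list. *)
Lemma logp_sum (I : Type) (s : seq I) (F : I -> R) : (forall i, 0 <= F i) ->
  logp (\sum_(i <- s) F i) <= ln (size s).+1%:R + \sum_(i <- s) logp (F i).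
Proof.
move=> F0; pose M := \prod_(i <- s) Num.max 1 (F i).
have M1 : 1 <= M.
  apply: (big_ind (fun x => 1 <= x)) => [|x y x1 y1|i _]; first by [].
    by rewrite -[leLHS]mulr1 ler_pM.
  by rewrite le_max lexx.
have FM (t : seq I) : \sum_(i <- t) F i <= (size t)%:R * \prod_(i <- t) Num.max 1 (F i) /\
   1 <= \prod_(i <- t) Num.max 1 (F i).
  elim: t => [|i t [IH1 IH2]]; first by rewrite !big_nil mul0r.
  have m1 : 1 <= Num.max 1 (F i) by rewrite le_max lexx.
  rewrite !big_cons; split; last by rewrite -[leLHS]mulr1 ler_pM.
  rewrite -natr1 mulrDl mul1r addrC lerD//.
    rewrite (le_trans IH1)// ler_wpM2l// ler_peMl// (le_trans ler01)//.
  by rewrite -[leLHS]mulr1 ler_pM// le_max lexx orbT.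
have -> : \sum_(i <- s) logp (F i) = ln M.
  rewrite /M; elim: {M M1} s => [|i t IH]; first by rewrite !big_nil ln1.
  rewrite !big_cons IH logpE lnM// posrE ?lt_max ?ltr01//.
  by rewrite (lt_le_trans ltr01)//; have [] := FM t.
rewrite -lnM ?posrE ?(lt_le_trans ltr01 M1)// logpE ler_ln ?posrE ?lt_max ?ltr01//; last first.
  by rewrite mulr_gt0 ?(lt_le_trans ltr01 M1).
rewrite ge_max; apply/andP; split; first by rewrite -[leLHS]mulr1 ler_pM// ler1n.
by rewrite (le_trans (FM s).1)// ler_wpM2r ?(le_trans ler01 M1)// ler_nat.
Qed.

Lemma logpV x : 0 < x -> logp x - logp x^-1 = ln x.
Proof.
move=> x0; have [x1|x1] := leP x 1.
  rewrite (logp_le1 x1) logp_ge1; first by rewrite lnV ?posrE// sub0r opprK.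
  by rewrite invf_ge1.
by rewrite (logp_ge1 (ltW x1)) logp_le1 ?subr0// invf_le1// ltW.
Qed.

Lemma abs_ln x : 0 < x -> `|ln x| = logp x + logp x^-1.
Proof.
move=> x0; have [x1|x1] := leP x 1.
  rewrite (logp_le1 x1) logp_ge1; last by rewrite invf_ge1.
  by rewrite add0r lnV ?posrE// ler0_norm// ln_le0.
rewrite (logp_ge1 (ltW x1)) logp_le1 ?addr0 ?ger0_norm// ?ln_ge0 ?ltW//.
by rewrite invf_lt1.
Qed.

Lemma rcont_logp (f : R[i] -> R[i]) z : ccont f z -> rcont (fun w => logp (normc (f w))) z.
Proof.
move=> cf; have -> : (fun w => logp (normc (f w))) = fun w => ln (Num.max 1 (normc (f w))).
  by apply/funext => w; rewrite logpE.
apply: rcont_ln; last by rewrite lt_max ltr01.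
move=> e e0; apply: cnearS (rcont_normc cf e0) => w; apply: le_lt_trans.
by rewrite !maxEle; do 2 case: ifPn; rewrite -?ltNge; move=> *;
  rewrite ?subrr ?normr0// ler_norml lerNl ?ler_norml; apply/andP; split;
  rewrite ?ler_normr; lra.
Qed.

End logplus.

(** * The counting function as a finite sum over poles *)

Section counting.
Variable R : realType.
Notation mu := (@lebesgue_measure R).
Implicit Types (f g : R[i] -> R[i]) (z w q : R[i]) (r rho t : R).

(* As [ln 0 = 0], a pole at the origin contributes [ln r]. *)
Definition Nsum (ps : seq R[i]) r : R :=
  \sum_(p <- ps | normc p <= r) (ln r - ln (normc p)).

Lemma pole_countE f (ps : seq R[i]) r0 t :
  (forall z, normc z <= r0 -> pole_order f z = count_mem z ps) -> t <= r0 ->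
  pole_count f t = (count (fun p => normc p <= t) ps)%:R.
Proof.
move=> Hp tr; pose r := undup [seq p <- ps | normc p <= t].
rewrite /pole_count (fsbigE r) ?undup_uniq//; last 2 first.
- by move=> z /=; rewrite mem_undup mem_filter => /andP[].
- move=> z /= zt; rewrite mem_undup mem_filter zt/= Hp ?(le_trans zt)//.
  by move=> /count_memPn ->.
rewrite -natr_sum; congr (_%:R).
transitivity (\sum_(i <- r) iterop (count_mem i [seq p <- ps | (normc p <= t)%R]) addn 1%N 0%N)%N.
  rewrite [LHS]big_mkcond; rewrite [LHS]big_seq [RHS]big_seq; apply: eq_bigr => z.
  rewrite mem_undup mem_filter => /andP[zt zp]; rewrite mem_set//=.
  rewrite Hp ?(le_trans zt)// count_filter.
  have -> : count (predI (pred1 z) (fun p => normc p <= t)) ps = count_mem z ps.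
    by apply: eq_count => x /=; case: eqP => //= ->.
  by rewrite Monoid.iteropE; elim: (count_mem z ps) => // n IH; rewrite iterS -IH.
by rewrite big_undup_iterop_count sum1_size size_filter.
Qed.

Lemma Rint_inv (a r : R) : 0 < a -> a <= r -> \int[mu]_(t in `[a, r]) t^-1 = ln r - ln a.
Proof.
move=> a0 ar; apply: Rint_FTC => //.
  by move=> t /andP[at' _]; apply: inv_continuous; rewrite gt_eqF// (lt_le_trans a0).
by move=> t /andP[at' _]; apply: is_derive1_ln; rewrite (lt_le_trans a0).
Qed.

(** What one pole of modulus [a] contributes to the integral defining [counting_fun]. *)
Lemma Rint_jump (a r : R) : 0 < a ->
  mu.-integrable `]0, r] (EFin \o ((fun t => t^-1) \_ `[a, +oo[)) /\
  \int[mu]_(t in `]0, r]) ((fun t => t^-1) \_ `[a, +oo[) t = if a <= r then ln r - ln a else 0.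
Proof.
move=> a0; have I : `]0, r]%classic `&` `[a, +oo[%classic = `[a, r]%classic :> set R.
  apply/seteqP; split => t /=; rewrite !in_itv/= ?andbT; first by move=> [/andP[_ ->] ->].
  by move=> /andP[at' ->]; rewrite at' (lt_le_trans a0).
split.
  rewrite -restrict_EFin; apply/integrable_restrict => //; rewrite I.
  apply: contI_integrable => t /andP[at' _].
  by apply: inv_continuous; rewrite gt_eqF// (lt_le_trans a0).
rewrite -Rintegral_mkcondr I; case: ifPn => [ar|]; first exact: Rint_inv.
by rewrite -ltNge => ra; rewrite set_itv_ge ?Rintegral_set0// bnd_simp -ltNge.
Qed.

(** The integral is taken pole by pole. Poles at the origin are removed from the integrand by
    [- pole_count f 0] and return in the term [pole_count f 0 * ln r]. *)
Lemma counting_funE f (ps : seq R[i]) r0 r :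
  (forall z, normc z <= r0 -> pole_order f z = count_mem z ps) -> 0 < r -> r <= r0 ->
  counting_fun f r = Nsum ps r.
Proof.
move=> Hp rp rr0; rewrite /counting_fun (pole_countE Hp (ltW (lt_le_trans rp rr0))).
have -> : \int[mu]_(t in `]0, r]) ((pole_count f t - (count (fun p => normc p <= 0) ps)%:R) / t) =
   \int[mu]_(t in `]0, r]) (\sum_(p <- ps | p != 0) ((fun t => t^-1) \_ `[normc p, +oo[) t).
  apply: eq_Rintegral => t; rewrite inE/= in_itv/= => /andP[t0 tr].
  rewrite (pole_countE Hp (le_trans tr rr0)) -!sum1_count !natr_sum.
  transitivity (\sum_(p <- ps | p != 0) (if normc p <= t then t^-1 else 0)); last first.
    by apply: eq_bigr => p _; rewrite /patch mem_setE in_itv/= andbT.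
  elim: (ps) => [|p s IH]; first by rewrite !big_nil subrr mul0r.
  rewrite !big_cons; have -> : (normc p <= 0) = (p == 0) by rewrite -normc_eq0 eq_le normc_ge0 andbT.
  have [->|p0] := eqVneq p 0.
    by rewrite normc0 (ltW t0) -IH; congr (_ / _); ring.
  rewrite /= -IH; case: ifPn => _; last by rewrite add0r.
  by rewrite -addrA mulrDl mul1r.
pose phi (s : seq R[i]) (t : R) : R := \sum_(p <- s | p != 0) ((fun t => t^-1) \_ `[normc p, +oo[) t.
have H (s : seq R[i]) : mu.-integrable `]0, r] (EFin \o phi s) /\
   \int[mu]_(t in `]0, r]) phi s t =
    \sum_(p <- s | p != 0) (if normc p <= r then ln r - ln (normc p) else 0).
  elim: s => [|p s [IH1 IH2]].
    have -> : phi [::] = cst 0 by apply/funext => t; rewrite /phi big_nil.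
    by rewrite big_nil Rintegral_cst// mul0r; split => //; exact: (@integrable0 _ _ _ mu).
  have [p0|p0] := eqVneq p 0.
    have -> : phi (p :: s) = phi s by apply/funext => t; rewrite /phi big_cons p0 eqxx.
    by rewrite big_cons p0 eqxx.
  have pp : 0 < normc p by rewrite normc_gt0.
  have [J1 J2] := @Rint_jump _ r pp.
  have -> : phi (p :: s) = fun t => ((fun t => t^-1) \_ `[normc p, +oo[) t + phi s t.
    by apply/funext => t; rewrite /phi big_cons p0.
  split; first exact: (integrableD (mu := mu) _ J1 IH1).
  by rewrite RintegralD// J2 IH2 big_cons p0.
rewrite -/(phi ps) (H ps).2 /Nsum.
elim: (ps) => [|p s IH]; first by rewrite !big_nil mul0r addr0.
rewrite !big_cons /=; have -> : (normc p <= 0) = (p == 0) by rewrite -normc_eq0 eq_le normc_ge0 andbT.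
have [->|p0] := eqVneq p 0.
  rewrite normc0 (ltW rp) (ln0 (lexx 0)) subr0 -IH -natr1.
  by rewrite /= mulrDl mul1r; ring.
rewrite add0n; case: ifPn => _; last by rewrite add0r IH.
by rewrite -addrA IH.
Qed.

Lemma Nsum_ge0 (ps : seq R[i]) r : 1 <= r -> 0 <= Nsum ps r.
Proof.
move=> r1; apply: sumr_ge0 => p pr; rewrite subr_ge0.
have [->|p0] := eqVneq p 0; first by rewrite normc0 (ln0 (lexx 0)) ln_ge0.
by rewrite ler_ln ?posrE ?normc_gt0// (lt_le_trans ltr01).
Qed.

(** The left side is the circle mean of the logarithms of linear factors, by [ln_mean]; this splits
    it into a constant and a counting function. *)
Lemma Nsum_max (ps : seq R[i]) r : 0 < r ->
  \sum_(p <- ps) ln (Num.max r (normc p)) = \sum_(p <- ps) ln (normc p) + Nsum ps r.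
Proof.
move=> r0; rewrite /Nsum [X in _ + X]big_mkcond -big_split/=; apply: eq_bigr => p _.
case: ifPn => [pr|]; first by rewrite (elimT max_idPl)// addrC subrK.
by rewrite -ltNge addr0 => /ltW rp; rewrite (elimT max_idPr).
Qed.

End counting.

(** * Monotonicity of circle means *)

Section mean_monotone.
Variable R : realType.
Notation mu := (@lebesgue_measure R).
Implicit Types (f g F : R[i] -> R[i]) (z w q : R[i]) (r rho t : R).

(** Tonelli's theorem on the whole plane, for [phi] times the indicator of the square. *)
Lemma swap_integrals (a b : R) (phi : R * R -> R) :
  measurable_fun setT phi -> (forall x, 0 <= phi x) ->
  (\int[mu]_(t in `[a, b]) \int[mu]_(s in `[a, b]) (phi (t, s))%:E =
   \int[mu]_(s in `[a, b]) \int[mu]_(t in `[a, b]) (phi (t, s))%:E)%E.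
Proof.
move=> mphi phi0; pose I : set R := `[a, b]%classic.
have mI : measurable I by exact: measurable_itv.
pose f (x : R * R) : \bar R := ((\1_I x.1 * \1_I x.2) * phi x)%:E.
have mf : measurable_fun setT f.
  apply/measurable_EFinP; apply: measurable_funM => //.
  by apply: measurable_funM; apply: measurableT_comp.
have f0 x : (0%:E <= f x)%E by rewrite lee_fin !mulr_ge0.
have i1 (t : R) : I t -> \1_I t = 1 :> R by move=> It; rewrite indicE mem_set.
have i0 (t : R) : ~ I t -> \1_I t = 0 :> R by move=> It; rewrite indicE memNset.
transitivity (\int[mu]_t \int[mu]_s f (t, s))%E; last first.
  transitivity (\int[mu]_s \int[mu]_t f (t, s))%E; first exact: fubini_tonelli.
  rewrite [RHS]integral_mkcond; apply: eq_integral => s _.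
  rewrite /patch; case: ifPn => [/set_mem Is|/negP/mem_set nIs].
    rewrite [RHS]integral_mkcond; apply: eq_integral => t _.
    rewrite /patch /f /= (i1 _ Is) mulr1; case: ifPn => [/set_mem It|/negP nIt].
      by rewrite i1// mul1r.
    by rewrite i0 ?mul0r// => /mem_set.
  rewrite integral0_eq// => t _; rewrite /f /= (i0 s) ?mulr0 ?mul0r//.
  by move=> /mem_set; apply/negP; move: nIs; rewrite inE => /negP.
rewrite integral_mkcond; apply: eq_integral => t _.
rewrite /patch; case: ifPn => [/set_mem It|/negP nIt].
  rewrite integral_mkcond; apply: eq_integral => s _.
  rewrite /patch /f /= (i1 _ It) mul1r; case: ifPn => [/set_mem Is|/negP nIs].
    by rewrite i1// mul1r.
  by rewrite i0 ?mul0r// => /mem_set.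
rewrite integral0_eq// => s _; rewrite /f /= (i0 t) ?mul0r//.
by move=> /mem_set.
Qed.

(** The Poisson kernel of the disc of radius [normc w], at the boundary point [w]. *)
Definition pkernel (z w : R[i]) : R := (normc w ^+ 2 - normc z ^+ 2) / normc (w - z) ^+ 2.

Lemma pkernelE z w : w != z -> 2 * Re (w / (w - z)) - 1 = pkernel z w.
Proof.
move=> wz; have : w - z != 0 by rewrite subr_eq0.
rewrite -normc_eq0 -sqrf_eq0 /pkernel !sqr_normcE.
case: w z {wz} => a b [c d] /=; set D := (a - c) ^+ 2 + (b - d) ^+ 2 => D0.
by rewrite /D in D0 *; field.
Qed.

Lemma pkernel_ge0 z w : normc z <= normc w -> 0 <= pkernel z w.
Proof.
move=> zw; rewrite divr_ge0 ?exprn_ge0 ?normc_ge0// subr_ge0.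
by rewrite ler_sqr ?nnegrE ?normc_ge0.
Qed.

Lemma pkernel_cont z w : normc z != normc w -> rcont (fun v => pkernel v w) z.
Proof.
move=> zw; have wz : w - z != 0 by rewrite subr_eq0; apply: contraNneq zw => ->.
apply: rcontM.
  apply: rcontB; first exact: rcont_cst.
  by apply: rcontM; exact/rcont_normc/ccont_id.
apply: (rcont_comp (u := fun v => normc (w - v) ^+ 2)).
  apply: rcontM; apply: rcont_normc; apply: ccontB; (try exact: ccont_cst); exact: ccont_id.
by apply: inv_continuous; rewrite expf_neq0// normc_eq0.
Qed.

(** As a function of [z] the kernel is the real part of the holomorphic [2 * w / (w - z) - 1], which
    is 1 at 0. *)
Lemma pkernel_mean w r : 0 < r -> r < normc w -> cmean (fun z => pkernel z w) r = 1.
Proof.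
move=> r0 rw.
have nz z : normc z < normc w -> w - z != 0.
  by move=> zw; rewrite subr_eq0; apply: contraTneq zw => ->; rewrite ltxx.
pose H z := 2%:C * (w / (w - z)) - 1.
have dH z : normc z < normc w -> cdiff H z.
  move=> zw; apply: cdiffB; last exact: cdiff_cst.
  apply: cdiffM; first exact: cdiff_cst.
  apply: cdiff_div; [exact: cdiff_cst| |exact: nz].
  by apply: cdiffB; [exact: cdiff_cst | exact: cdiff_id].
have := @cmean_mvp R H 0 (normc w) r (fun z zr => cdiff_cont (dH z zr)) (fun z zr _ => dH z (andP zr).2).
rewrite r0 rw => /(_ isT) /(congr1 (fun z => Re z)) /=.
have w0 : w != 0 by rewrite -normc_gt0 (lt_trans r0).
have -> : Re (H 0) = 1 by rewrite /H subr0 divff// mulr1 ReB/=; ring.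
move=> <-; apply: eq_cmean; first exact: ltW.
move=> z zr; rewrite -pkernelE; last by rewrite -subr_eq0 nz// zr.
by rewrite /H; case: (w / (w - z)) => a b /=; ring.
Qed.

Lemma circ_cont_comp_circle (u : R[i] -> R) r : 0 <= r -> circ_cont u r ->
  continuous (fun t => u (circle_pt r t)).
Proof.
by move=> r0 cu t; apply: circle_cont; apply: cu; rewrite normc_circle ger0_norm.
Qed.

(** Average the hypothesis over the inner circle and exchange the two integrals: for fixed [w] the
    mean of the kernel is 1. *)
Lemma mean_le_of_poisson (u v : R[i] -> R) r1 r2 : 0 < r1 -> r1 < r2 ->
  circ_cont u r1 -> circ_cont v r2 -> (forall z, 0 <= u z) -> (forall z, 0 <= v z) ->
  (forall z, normc z = r1 -> u z <= cmean (fun w => v w * pkernel z w) r2) ->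
  cmean u r1 <= cmean v r2.
Proof.
move=> r10 r12 cu cv u0 v0 uv; have r20 := lt_trans r10 r12.
have n1 t : normc (circle_pt r1 t) = r1 by rewrite normc_circle gtr0_norm.
have n2 t : normc (circle_pt r2 t) = r2 by rewrite normc_circle gtr0_norm.
rewrite ler_wpM2l ?invr_ge0 ?twopi_ge0//.
pose phi (x : R * R) : R := v (circle_pt r2 x.2) * pkernel (circle_pt r1 x.1) (circle_pt r2 x.2).
have phi0 x : 0 <= phi x.
  by rewrite mulr_ge0// pkernel_ge0// n1 n2 ltW.
have mphi : measurable_fun setT phi.
  apply: measurable_funM.
    apply: (@measurableT_comp _ _ _ _ _ _ (fun s => v (circle_pt r2 s))); last exact: measurable_snd.
    by apply: continuous_measurable_fun; apply: circ_cont_comp_circle => //; exact: ltW.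
  pose D (x : R * R) : R := (r2 * cos x.2 - r1 * cos x.1) ^+ 2 + (r2 * sin x.2 - r1 * sin x.1) ^+ 2.
  have DE x : D x = normc (circle_pt r2 x.2 - circle_pt r1 x.1) ^+ 2 by rewrite sqr_normcE.
  (* Writing the reciprocal of [D] as [expR (- ln D)] exhibits it as a composition of measurable
     functions. *)
  have -> : (fun x : R * R => pkernel (circle_pt r1 x.1) (circle_pt r2 x.2)) =
     (fun x : R * R => (r2 ^+ 2 - r1 ^+ 2) * expR (-1 * ln (D x))).
    apply/funext => x; rewrite /pkernel n1 n2 -DE mulN1r expRN lnK// posrE DE exprn_gt0// normc_gt0 subr_eq0.
    by apply: contraTneq r12 => /(congr1 (@normc R)); rewrite n1 n2 => ->; rewrite ltxx.
  apply: measurable_funM; first exact: measurable_cst.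
  apply: measurableT_comp; first exact: measurable_expR.
  apply: measurable_funM; first exact: measurable_cst.
  apply: measurableT_comp; first exact: measurable_ln.
  have mc : measurable_fun setT (@cos R) by apply: continuous_measurable_fun; exact: continuous_cos.
  have ms : measurable_fun setT (@sin R) by apply: continuous_measurable_fun; exact: continuous_sin.
  apply: measurable_funD; apply: measurable_funX; apply: measurable_funB; apply: measurable_funM;
    (try exact: measurable_cst); apply: measurableT_comp => //; (try exact: measurable_fst); exact: measurable_snd.
have cvt : contI 0 (2 * pi) (fun s => v (circle_pt r2 s)) by apply: circ_contP => //; exact: ltW.
have cut : contI 0 (2 * pi) (fun t => u (circle_pt r1 t)) by apply: circ_contP => //; exact: ltW.
have ckt s : contI 0 (2 * pi) (fun t => pkernel (circle_pt r1 t) (circle_pt r2 s)).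
  apply: (@circ_contP R (fun z => pkernel z (circle_pt r2 s)) r1 (ltW r10)) => z zr.
  by apply: pkernel_cont; rewrite zr n2 lt_eqF.
have cks t : contI 0 (2 * pi) (fun s => v (circle_pt r2 s) * pkernel (circle_pt r1 t) (circle_pt r2 s)).
  apply: (@circ_contP R (fun w => v w * pkernel (circle_pt r1 t) w) r2 (ltW r20)) => w wr.
  apply: rcontM; first exact: cv.
  have wz : w - circle_pt r1 t != 0.
    rewrite subr_eq0; apply: contraTneq r12 => E; move: wr; rewrite E n1 => ->.
    by rewrite ltxx.
  apply: rcontM.
    apply: rcontB; last exact: rcont_cst.
    by apply: rcontM; exact/rcont_normc/ccont_id.
  apply: (rcont_comp (u := fun v => normc (v - circle_pt r1 t) ^+ 2)).
    apply: rcontM; apply: rcont_normc; apply: ccontB; (try exact: ccont_cst); exact: ccont_id.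
  by apply: inv_continuous; rewrite expf_neq0// normc_eq0.
have fin (h : R -> R) : contI 0 (2 * pi) h ->
    (\int[mu]_(t in `[0%R, (2 * pi)%R]) (h t)%:E = (\int[mu]_(t in `[0, 2 * pi]) h t)%R%:E)%E.
  by move=> ch; rewrite /Rintegral fineK//; apply: integrable_fin_num => //; exact: contI_integrable.
have mg : measurable_fun `[0%R, (2 * pi)%R] (fun t => (\int[mu]_(s in `[0%R, (2 * pi)%R]) (phi (t, s))%:E)%E).
  apply: measurable_funTS.
  apply: (eq_measurable_fun (fun t => (\int[mu]_s ((\1_(`[0, 2 * pi]%classic) s * phi (t, s))%:E))%E)).
    move=> t _; rewrite [RHS]integral_mkcond; apply: eq_integral => s _.
    rewrite /patch indicE; have [H|H] := pselect (`[0, 2 * pi]%classic s).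
      by rewrite !mem_set// mul1r.
    by rewrite !memNset// mul0r.
  apply: (@measurable_fun_fubini_tonelli_F _ _ _ _ R mu (fun x => (\1_(`[0, 2 * pi]%classic) x.2 * phi x)%:E)).
    apply/measurable_EFinP; apply: measurable_funM => //.
    by apply: measurableT_comp => //; exact: measurable_snd.
  by move=> x; rewrite lee_fin mulr_ge0.
rewrite -lee_fin -!fin//.
apply: (@le_trans _ _ (\int[mu]_(t in `[0%R, (2 * pi)%R]) ((2 * pi)^-1%:E * \int[mu]_(s in `[0%R, (2 * pi)%R]) (phi (t, s))%:E))%E).
  apply: ge0_le_integral => //.
  - by move=> t _; rewrite lee_fin.
  - apply/measurable_EFinP; apply: measurable_funTS; apply: continuous_measurable_fun.
    by apply: circ_cont_comp_circle => //; exact: ltW.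
  - by apply: measurable_funeM.
  - by move=> t _; rewrite (fin (fun s => phi (t, s)) (cks t)) -EFinM lee_fin; exact: (uv _ (n1 t)).
rewrite ge0_integralZl//; last 2 first.
- by move=> t _; apply: integral_ge0 => s _; rewrite lee_fin.
- by rewrite lee_fin invr_ge0 twopi_ge0.
rewrite swap_integrals//.
have E s : (\int[mu]_(t in `[0%R, (2 * pi)%R]) (phi (t, s))%:E = (2 * pi)%:E * (v (circle_pt r2 s))%:E)%E.
  have cp : contI 0 (2 * pi) (fun t => phi (t, s)) := contIM (@contI_cst R 0 (2 * pi) (v (circle_pt r2 s))) (ckt s).
  rewrite (fin _ cp).
  rewrite -EFinM; congr EFin; rewrite /phi/= RintZ// mulrC; congr (_ * _).
  have := @pkernel_mean (circle_pt r2 s) r1 r10; rewrite n2 => /(_ r12).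
  by move=> /(congr1 (fun x => 2 * pi * x)); rewrite mulr1 /cmean mulrA divff ?mul1r// gt_eqF// twopi_gt0.
under eq_integral do rewrite E.
rewrite ge0_integralZl//; last 3 first.
- apply/measurable_EFinP; apply: measurable_funTS; apply: continuous_measurable_fun.
  by apply: circ_cont_comp_circle => //; exact: ltW.
- by move=> s _; rewrite lee_fin.
- by rewrite lee_fin twopi_ge0.
by rewrite muleA -EFinM mulVf ?mul1e// gt_eqF// twopi_gt0.
Qed.

(** The kernel being positive, the Poisson integral of [logp (normc F)] dominates 0 and the Poisson
    integral of [ln (normc F)], which is [ln (normc F)] itself; hence it dominates
    [logp (normc F)]. *)
Lemma logp_mean_monotone F rho r1 r2 :
  (forall z, normc z < rho -> cdiff F z /\ F z != 0) -> 0 < r1 -> r1 < r2 -> r2 < rho ->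
  cmean (fun z => logp (normc (F z))) r1 <= cmean (fun z => logp (normc (F z))) r2.
Proof.
move=> HF r10 r12 r2rho; have r20 := lt_trans r10 r12.
have cl r : r < rho -> circ_cont (fun z => logp (normc (F z))) r.
  by move=> rr z zr; apply: rcont_logp; apply: cdiff_cont; apply: (HF _ _).1; rewrite zr.
apply: mean_le_of_poisson => //; try (by move=> z; exact: logp_ge0).
- by apply: cl; exact: lt_trans r2rho.
- exact: cl.
move=> z zr; have zr2 : normc z < r2 by rewrite zr.
have wz w : normc w = r2 -> w != z by move=> wr; apply: contraTneq zr2 => <-; rewrite wr ltxx.
have ck : circ_cont (fun w => 2 * Re (w / (w - z)) - 1) r2.
  move=> w wr; apply: rcontB; last exact: rcont_cst.
  apply: rcontM; first exact: rcont_cst.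
  by apply: rcont_Re; exact: (circ_kernel zr2).
have E (u : R[i] -> R) : cmean (fun w => u w * pkernel z w) r2 =
    cmean (fun w => u w * (2 * Re (w / (w - z)) - 1)) r2.
  by apply: eq_cmean; [exact: ltW | move=> w wr; rewrite pkernelE// wz].
have k0 w : normc w = r2 -> 0 <= 2 * Re (w / (w - z)) - 1.
  by move=> wr; rewrite pkernelE ?wz// pkernel_ge0// wr zr ltW.
rewrite E {1}/logp ge_max; apply/andP; split.
  rewrite -(cmean_cst 0 r2); apply: le_cmean; first exact: ltW.
  - by move=> w _; exact: rcont_cst.
  - by move=> w wr; apply: rcontM; [exact: (cl _ r2rho) | exact: ck].
  - by move=> w wr; rewrite mulr_ge0 ?logp_ge0 ?k0.
rewrite (lnF_poisson HF r20 r2rho zr2); apply: le_cmean; first exact: ltW.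
- move=> w wr; apply: rcontM; last exact: ck.
  by apply: (circ_lnF HF r2rho).
- by move=> w wr; apply: rcontM; [exact: (cl _ r2rho) | exact: ck].
- by move=> w wr; rewrite ler_wpM2r ?k0// ln_le_logp.
Qed.

End mean_monotone.

(** * The characteristic *)

Section nevanlinna.
Variable R : realType.
Implicit Types (f g h F : R[i] -> R[i]) (z w q : R[i]) (r rho t : R) (s ps qs : seq R[i]).

(** Not vanishing identically, in usable form: by [mero_identity] a single point where a meromorphic
    [f] is not locally zero suffices. *)
Definition nz_mero f := forall z, exists a b h, local_form f z a b h.

Definition good f r := forall z, normc z = r -> reg f z.

Lemma nz_meroV f : nz_mero f -> nz_mero (fun z => (f z)^-1).
Proof. by move=> lf z; have [a [b [h /local_formV H]]] := lf z; exists b, a, (fun z => (h z)^-1). Qed.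

Lemma regV f z : reg f z -> reg (fun z => (f z)^-1) z.
Proof. by apply: cnearS => w [df f0]; split; [exact: cdiffV | rewrite invr_eq0]. Qed.

Lemma goodV f r : good f r -> good (fun z => (f z)^-1) r.
Proof. by move=> gf z /gf /regV. Qed.

Lemma proximityE f r : proximity f r = cmean (fun z => logp (normc (f z))) r.
Proof. by []. Qed.

Lemma good_cont f r : good f r -> ccirc_cont f r.
Proof. by move=> gf z /gf /cnear_self[/cdiff_cont]. Qed.

Lemma circ_logp f r : ccirc_cont f r -> circ_cont (fun z => logp (normc (f z))) r.
Proof. by move=> cf z zr; apply: rcont_logp; exact: cf. Qed.

Lemma proximity_ge0 f r : 0 <= proximity f r.
Proof.
rewrite /proximity mulr_ge0 ?invr_ge0 ?twopi_ge0//.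
by apply: Rintegral_ge0 => t _; exact: logp_ge0.
Qed.

Lemma proximityV f r : 0 < r -> good f r ->
  proximity f r - proximity (fun z => (f z)^-1) r = cmean (fun z => ln (normc (f z))) r.
Proof.
move=> r0 gf; rewrite !proximityE -cmeanB ?(ltW r0)//.
- apply: eq_cmean; [exact: ltW|] => z /gf /cnear_self[_ fz].
  by rewrite normcV logpV// normc_gt0.
- exact/circ_logp/good_cont.
- exact/circ_logp/good_cont/goodV.
Qed.

Definition sumln s w : R := \sum_(c <- s) ln (normc (w - c)).

Lemma ln_rprod s w : w \notin s -> ln (normc (rprod s w)) = sumln s w.
Proof.
rewrite /sumln /rprod; elim: s => [|c s IH]; first by rewrite !big_nil normc1 ln1.
rewrite inE negb_or !big_cons => /andP[wc ws]; rewrite normcM lnM ?posrE ?IH//.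
  by rewrite normc_gt0 subr_eq0.
by rewrite normc_gt0 rprod_neq0.
Qed.

Lemma sumln_mean s r : 0 < r -> (forall c, c \in s -> normc c != r) ->
  circ_cont (sumln s) r /\ cmean (sumln s) r = \sum_(c <- s) ln (Num.max r (normc c)).
Proof.
move=> r0; elim: s => [|c s IH] Hs.
  have -> : sumln [::] = fun=> 0 by apply/funext => w; rewrite /sumln big_nil.
  by split; [move=> z _; exact: rcont_cst | rewrite cmean_cst big_nil].
have [|IH1 IH2] := IH; first by move=> d ds; apply: Hs; rewrite inE ds orbT.
have -> : sumln (c :: s) = fun w => ln (normc (w - c)) + sumln s w.
  by apply/funext => w; rewrite /sumln big_cons.
have cr : normc c != r by apply: Hs; rewrite mem_head.
have cc : circ_cont (fun w => ln (normc (w - c))) r.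
  move=> w wr; apply: rcont_ln_normc; first by apply: ccontB; [exact: ccont_id | exact: ccont_cst].
  by rewrite subr_eq0; apply: contraNneq cr => <-; rewrite wr.
split; first by move=> w wr; apply: rcontD; [exact: cc | exact: IH1].
by rewrite cmeanD ?(ltW r0)// IH2 ln_mean// big_cons.
Qed.

(** Jensen's formula: the mean of [ln (normc f)] is computed from the factorization, and [Nsum_max]
    separates the counting functions from a constant. That constant is built from the factorization
    on the disc of radius [r0], so it may depend on [r0]. *)
Lemma jensen_disc f r0 : nz_mero f -> exists J, forall r, 0 < r -> r <= r0 -> good f r ->
  characteristic f r = characteristic (fun z => (f z)^-1) r + J.
Proof.
move=> lf; have [rho [F [ps [qs [r0rho HF _ Hf Hp]]]]] := factorization r0 lf.
exists (ln (normc (F 0)) + \sum_(q <- qs) ln (normc q) - \sum_(p <- ps) ln (normc p)).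
move=> r rp rr0 gf; have rrho := le_lt_trans rr0 r0rho.
have Hps z : normc z <= r0 -> pole_order f z = count_mem z ps by move=> /Hp[].
have Hqs z : normc z <= r0 -> pole_order (fun z => (f z)^-1) z = count_mem z qs by move=> /Hp[].
rewrite /characteristic (counting_funE Hps rp rr0) (counting_funE Hqs rp rr0).
have := proximityV rp gf.
have nr c : c \in ps \/ c \in qs -> normc c != r.
  move=> cc; apply/negP => /eqP cr; have [||n1 n2 _] := Hf c; [by rewrite cr | exact: gf|].
  by case: cc => ?; [move: n1 | move: n2] => /negP.
have [c1 m1] := @sumln_mean ps r rp (fun c cs => nr c (or_introl cs)).
have [c2 m2] := @sumln_mean qs r rp (fun c cs => nr c (or_intror cs)).
have cF := circ_lnF HF rrho.
have -> : cmean (fun z => ln (normc (f z))) r =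
    cmean (fun z => ln (normc (F z)) + sumln qs z - sumln ps z) r.
  apply: eq_cmean; [exact: ltW|] => z zr.
  have [||n1 n2 E] := Hf z; [by rewrite zr | exact: gf|].
  have [_ fz] := cnear_self (gf _ zr).
  have [|_ Fz] := HF z; first by rewrite zr.
  rewrite -!ln_rprod//; apply/eqP; rewrite eq_sym subr_eq; apply/eqP.
  by rewrite -!lnM ?posrE ?normc_gt0 ?rprod_neq0// -!normcM E.
rewrite cmeanB ?(ltW rp)//; last by move=> w wr; apply: rcontD; [exact: cF | exact: c2].
rewrite cmeanD ?(ltW rp)// (lnF_mean HF rp rrho) m1 m2 !Nsum_max//.
move: (proximity f r) (proximity _ r) (Nsum ps r) (Nsum qs r) => a b c d.
by move: (ln _) (\sum_(_ <- _) _) (\sum_(_ <- _) _) => x y z; lra.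
Qed.

(** The constant of any disc can be read off at one good radius [r1] inside it; applying
    [jensen_disc] to a disc containing both [r] and [r1] makes it independent of [r]. *)
Lemma first_main f : nz_mero f -> exists J, forall r, 0 < r -> good f r ->
  characteristic f r = characteristic (fun z => (f z)^-1) r + J.
Proof.
move=> lf; have [[r1 [r10 g1]]|N] := pselect (exists r1, 0 < r1 /\ good f r1); last first.
  by exists 0 => r r0 gr; exfalso; apply: N; exists r.
exists (characteristic f r1 - characteristic (fun z => (f z)^-1) r1) => r r0 gr.
have [J HJ] := jensen_disc (Num.max r r1) lf.
have -> := HJ r r0 _ gr; last by rewrite le_max lexx.
have -> := HJ r1 r10 _ g1; last by rewrite le_max lexx orbT.
by rewrite [X in _ = _ + X]addrC addKr.
Qed.

Lemma poles_list f r : nz_mero f -> exists ps, forall z, normc z <= r -> pole_order f z = count_mem z ps.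
Proof.
move=> lf; have [rho [F [ps [qs [_ _ _ _ Hp]]]]] := factorization r lf.
by exists ps => z /Hp[].
Qed.

Lemma counting_ge0 f r : nz_mero f -> 1 <= r -> 0 <= counting_fun f r.
Proof.
move=> lf r1; have [ps Hps] := poles_list r lf.
by rewrite (counting_funE Hps (lt_le_trans ltr01 r1) (lexx r)) Nsum_ge0.
Qed.

Lemma proximity_le_characteristic f r : nz_mero f -> 1 <= r -> proximity f r <= characteristic f r.
Proof. by move=> lf r1; rewrite lerDl counting_ge0. Qed.

Lemma characteristic_ge0 f r : nz_mero f -> 1 <= r -> 0 <= characteristic f r.
Proof. by move=> lf r1; rewrite addr_ge0 ?proximity_ge0 ?counting_ge0. Qed.

(** Each pole of modulus at most [r1] contributes at least [ln r2 - ln r1] to [Nsum], and the others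
    contribute nonnegatively. For poles at the origin this uses [0 <= ln r1]. *)
Lemma pole_count_bound f r1 r2 : nz_mero f -> 1 <= r1 -> r1 < r2 ->
  pole_count f r1 * (ln r2 - ln r1) <= counting_fun f r2.
Proof.
move=> lf r11 r12; have [ps Hps] := poles_list r2 lf.
have r10 := lt_le_trans ltr01 r11; have r20 := lt_trans r10 r12.
rewrite (counting_funE Hps r20 (lexx r2)) (pole_countE Hps (ltW r12)) /Nsum.
have l1 : 0 <= ln r1 by exact: ln_ge0.
have l2 : ln r1 <= ln r2 by rewrite ler_ln// ltW.
elim: (ps) => [|p s IH]; first by rewrite !big_nil mul0r.
rewrite /= big_cons natrD mulrDl.
have pl : normc p <= r2 -> 0 <= ln r2 - ln (normc p).
  move=> pr; rewrite subr_ge0; have [->|p0] := eqVneq p 0.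
    by rewrite normc0 (ln0 (lexx 0)) (le_trans l1).
  by rewrite ler_ln ?posrE ?normc_gt0.
have [pr|pr] := leP (normc p) r1; rewrite /=.
  rewrite (le_trans pr (ltW r12)) mul1r lerD// lerD2l lerN2.
  have [->|p0] := eqVneq p 0; first by rewrite normc0 (ln0 (lexx 0)).
  by rewrite ler_ln ?posrE ?normc_gt0.
rewrite mul0r add0r; case: ifPn => [/pl p0|_//].
by rewrite (le_trans IH)// lerDr.
Qed.

(** [rprod s] with each zero reflected in the circle of radius [r]: same modulus on the circle, no
    zero inside. *)
Definition cprod r s z : R[i] := \prod_(c <- s) (((r ^+ 2)%:C - c^*%C * z) / r%:C).

Lemma cprod_free r s : 0 < r -> (forall c, c \in s -> normc c < r) ->
  exists2 rho, r < rho & forall z, normc z < rho -> cprod r s z != 0.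
Proof.
move=> r0; have rC : r%:C != 0 by rewrite -normc_gt0 normcR normr_gt0 gt_eqF.
elim: s => [|c s IH] Hs.
  by exists (r + 1); [rewrite ltrDl | move=> z _; rewrite /cprod big_nil oner_neq0].
have [|rho rrho H] := IH; first by move=> d ds; apply: Hs; rewrite inE ds orbT.
have [|rho' rrho' H'] := @conj_pole_free R r c r0; first by apply: Hs; rewrite mem_head.
exists (Num.min rho rho'); first by rewrite lt_min rrho.
move=> z; rewrite lt_min => /andP[/H z1 /H' z2].
by rewrite /cprod big_cons mulf_neq0// mulf_neq0// invr_eq0.
Qed.

Lemma cdiff_cprod r s z : cdiff (cprod r s) z.
Proof.
apply: cdiff_prod => c; apply: cdiffM; last exact: cdiff_cst.
by apply: cdiffB; [exact: cdiff_cst | apply: cdiffM; [exact: cdiff_cst | exact: cdiff_id]].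
Qed.

Lemma normc_prod (I : Type) (t : seq I) (G : I -> R[i]) :
  normc (\prod_(i <- t) G i) = \prod_(i <- t) normc (G i).
Proof. by elim/big_rec2: _ => [|i x y _ <-]; rewrite ?normc1 ?normcM. Qed.

Lemma cprod_circle r s z : 0 < r -> normc z = r -> normc (cprod r s z) = normc (rprod s z).
Proof.
move=> r0 zr; rewrite !normc_prod; apply: eq_bigr => c _.
by rewrite (circle_dist_conj c zr r0) normcM normcV normcR gtr0_norm.
Qed.

(** After multiplication by [r] and squaring, the two sides differ by [(r ^+ 2 - normc z ^+ 2) * (r
    ^+ 2 - normc c ^+ 2)]. *)
Lemma reflected_dist r z c : 0 < r -> normc z <= r -> normc c <= r ->
  normc (z - c) <= normc ((r ^+ 2)%:C - c^*%C * z) / r.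
Proof.
move=> r0 zr cr; rewrite ler_pdivlMr// -ler_sqr ?nnegrE ?mulr_ge0 ?normc_ge0 ?(ltW r0)//.
have z2 : normc z ^+ 2 <= r ^+ 2 by rewrite ler_sqr ?nnegrE ?normc_ge0 ?(ltW r0).
have c2 : normc c ^+ 2 <= r ^+ 2 by rewrite ler_sqr ?nnegrE ?normc_ge0 ?(ltW r0).
have : 0 <= (r ^+ 2 - normc z ^+ 2) * (r ^+ 2 - normc c ^+ 2) by rewrite mulr_ge0// subr_ge0.
rewrite exprMn !sqr_normcE => H; rewrite -subr_ge0; apply: le_trans H _.
rewrite le_eqVlt; apply/orP; left; apply/eqP.
by case: z c {zr cr z2 c2} => a b [c d] /=; ring.
Qed.

Lemma rprod_le_cprod r s z : 0 < r -> normc z <= r -> (forall c, c \in s -> normc c <= r) ->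
  normc (rprod s z) <= normc (cprod r s z).
Proof.
move=> r0 zr Hs; rewrite !normc_prod; rewrite big_seq [leRHS]big_seq.
apply: ler_prod => c cs; rewrite normc_ge0/= normcM normcV normcR gtr0_norm//.
by apply: reflected_dist => //; exact: Hs.
Qed.

(* Replacing zeros and poles by their reflections in the circle of radius [r2] keeps the modulus
   on that circle and leaves a zero-free function [F1], to which [logp_mean_monotone] applies. *)
Lemma characteristic_monotone f r1 r2 : nz_mero f -> 0 < r1 -> r1 < r2 ->
  good f r1 -> good f r2 -> characteristic f r1 <= characteristic f r2.
Proof.
move=> lf r10 r12 g1 g2; have r20 := lt_trans r10 r12.
have [rho [F [ps [qs [r2rho HF Hn Hf Hp]]]]] := factorization r2 lf.
have nr r c : normc c < rho -> good f r -> c \in ps \/ c \in qs -> normc c != r.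
  move=> crho gf cc; apply/negP => /eqP cr; have [||n1 n2 _] := Hf c; [by [] | exact: gf|].
  by case: cc => ?; [move: n1 | move: n2] => /negP.
have lp c : c \in ps -> normc c < r2.
  move=> cp; have cr : normc c <= r2 by apply: Hn; rewrite mem_cat cp.
  by rewrite lt_neqAle cr andbT; apply: nr => //; [exact: le_lt_trans r2rho | left].
have lq c : c \in qs -> normc c < r2.
  move=> cp; have cr : normc c <= r2 by apply: Hn; rewrite mem_cat cp orbT.
  by rewrite lt_neqAle cr andbT; apply: nr => //; [exact: le_lt_trans r2rho | right].
have [rhop rp Hcp] := cprod_free r20 lp; have [rhoq rq Hcq] := cprod_free r20 lq.
pose rho1 := Num.min rho (Num.min rhop rhoq).
have r2rho1 : r2 < rho1 by rewrite !lt_min r2rho rp rq.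
pose F1 z := F z * cprod r2 qs z / cprod r2 ps z.
have HF1 z : normc z < rho1 -> cdiff F1 z /\ F1 z != 0.
  rewrite !lt_min => /and3P[/HF[dF Fz] /Hcp pz /Hcq qz]; split.
    apply: cdiff_div => //; last exact: cdiff_cprod.
    by apply: cdiffM => //; exact: cdiff_cprod.
  by rewrite mulf_neq0 ?invr_eq0// mulf_neq0.
have Hps z : normc z <= r2 -> pole_order f z = count_mem z ps by move=> /Hp[].
rewrite /characteristic (counting_funE Hps r10 (ltW r12)) (counting_funE Hps r20 (lexx _)).
have N1 := Nsum_max ps r10; have N2 := Nsum_max ps r20.
have E2 : proximity f r2 = cmean (fun z => logp (normc (F1 z))) r2.
  rewrite proximityE; apply: eq_cmean; [exact: ltW|] => z zr; congr logp.
  have [||n1 n2 E] := Hf z; [by rewrite zr | exact: g2|].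
  have [_ fz] := cnear_self (g2 _ zr).
  rewrite /F1 normcM normcV normcM !cprod_circle// -normcM -E normcM mulfK//.
  by rewrite gt_eqF// normc_gt0 rprod_neq0.
have [cs ms] := @sumln_mean ps r1 r10 (fun c cs => nr r1 c (lt_trans (lp c cs) r2rho) g1 (or_introl cs)).
have Hcp' z : normc z < rho1 -> cdiff (cprod r2 ps) z /\ cprod r2 ps z != 0.
  by rewrite !lt_min => /and3P[_ /Hcp pz _]; split => //; exact: cdiff_cprod.
have r1rho1 := lt_trans r12 r2rho1.
(* On the inner circle, reflecting zeros can only increase the modulus, and putting the poles back
   costs [normc (cprod r2 ps z) / normc (rprod ps z) >= 1]. The mean of its logarithm is exactly
   [Nsum ps r2 - Nsum ps r1]. *)
have E1 : proximity f r1 <= cmean (fun z => logp (normc (F1 z)) + (ln (normc (cprod r2 ps z)) - sumln ps z)) r1.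
  rewrite proximityE; apply: le_cmean; first exact: ltW.
  - exact/circ_logp/good_cont.
  - move=> z zr; apply: rcontD.
      by apply: rcont_logp; apply: cdiff_cont; apply: (HF1 _ _).1; rewrite zr.
    by apply: rcontB; [exact: (circ_lnF Hcp' r1rho1) | exact: cs].
  move=> z zr; have zr2 : normc z <= r2 by rewrite zr ltW.
  have [||n1 n2 E] := Hf z; [by rewrite zr (lt_trans r12) | exact: g1|].
  have cp0 : cprod r2 ps z != 0 by apply: (Hcp' _ _).2; rewrite zr.
  have rp0 := rprod_neq0 n1.
  have Q : normc (cprod r2 ps z) / normc (rprod ps z) >= 1.
    by rewrite ler_pdivlMr ?normc_gt0// mul1r rprod_le_cprod// => c /lp /ltW.
  rewrite -ln_rprod// -lnV ?posrE ?normc_gt0// -lnM ?posrE ?invr_gt0 ?normc_gt0//.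
  rewrite -logp_ge1//; apply: le_trans (logpM _ _); rewrite ?normc_ge0 ?(le_trans ler01 Q)//.
  apply: le_logp; rewrite /F1 normcM normcV mulrA divfK ?gt_eqF ?normc_gt0//.
  rewrite ler_pdivlMr ?normc_gt0// -normcM E !normcM ler_wpM2l ?normc_ge0//.
  by apply: rprod_le_cprod => // c /lq /ltW.
have M := logp_mean_monotone HF1 r10 r12 r2rho1; rewrite -E2 in M.
have C0 : ln (normc (cprod r2 ps 0)) = \sum_(c <- ps) ln (Num.max r2 (normc c)).
  rewrite [RHS]big_seq (eq_bigr (fun=> ln r2)); last by move=> c /lp /ltW /max_idPl ->.
  rewrite -big_seq normc_prod; elim: (ps) => [|c s IH]; first by rewrite !big_nil ln1.
  have rC : normc (((r2 ^+ 2)%:C - c^*%C * 0) / r2%:C) = r2.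
    by rewrite mulr0 subr0 normcM normcV !normcR !gtr0_norm ?exprn_gt0// expr2 mulfK// gt_eqF.
  rewrite !big_cons rC lnM ?posrE// ?IH// prodr_gt0// => d _.
  by rewrite mulr0 subr0 normcM normcV !normcR !gtr0_norm ?exprn_gt0 ?divr_gt0 ?exprn_gt0.
move: E1; rewrite cmeanD ?(ltW r10)//; last 2 first.
- by apply: circ_logp => z zr; apply: cdiff_cont; apply: (HF1 _ _).1; rewrite zr.
- by move=> w wr; apply: rcontB; [exact: (circ_lnF Hcp' r1rho1) | exact: cs].
rewrite cmeanB ?(ltW r10)//; last exact: (circ_lnF Hcp' r1rho1).
rewrite (lnF_mean Hcp' r10 r1rho1) ms C0 N1 N2.
move: M; move: (proximity f r1) (proximity f r2) (cmean _ _) (Nsum _ _) (Nsum _ _) (\sum_(_ <- _) _).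
by move=> *; lra.
Qed.

(** * Growth of the characteristic of a non-constant function *)

Lemma counting_pole0 f r a b h : nz_mero f -> local_form f 0 a b h -> (0 < b)%N -> 1 <= r ->
  ln r <= counting_fun f r.
Proof.
move=> lf lf0 b0 r1; have [ps Hps] := poles_list r lf; have r0 := lt_le_trans ltr01 r1.
rewrite (counting_funE Hps r0 (lexx _)) /Nsum.
have p0 : 0 \in ps.
  by rewrite -has_pred1 has_count -Hps ?normc0 ?(ltW r0)// (pole_order_local lf0).
rewrite (big_rem 0)// normc0 (ltW r0)/= (ln0 (lexx 0)) subr0 lerDl.
exact: Nsum_ge0.
Qed.

(** At a pole, the added term [c * (z - z0) ^+ b] does not change the leading value of the local
    factor. Elsewhere [f - c] stays bounded, and [power_order] forbids a pole. *)
Lemma pole_orderB f (c : R[i]) z0 : nz_mero f -> nz_mero (fun z => f z - c) ->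
  pole_order (fun z => f z - c) z0 = pole_order f z0.
Proof.
move=> lf lg; have [a [b [h lf0]]] := lf z0; have [a' [b' [h' lg0]]] := lg z0.
rewrite (pole_order_local lf0); have [dh h0 ab fh] := lf0.
have ch : ccont h z0 by apply: cdiff_cont; exact: cnear_self dh.
have dz (y : R[i]) n : cdiff (fun z => (z - z0) ^+ n) y.
  by apply: cdiffX; apply: cdiffB; [exact: cdiff_id | exact: cdiff_cst].
have [b0|b0] := posnP b; last first.
  have a0 : a = 0%N by move: ab; rewrite (gtn_eqF b0) orbF => /eqP.
  apply: (@pole_order_local _ _ _ 0 b (fun z => h z - c * (z - z0) ^+ b)); split => //.
  - apply: cnearS dh => z dhz; apply: cdiffB => //; apply: cdiffM; [exact: cdiff_cst | exact: dz].
  - by rewrite subrr expr0n (gtn_eqF b0) mulr0 subr0.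
  - apply: cnearS fh => z fz zz0; rewrite fz// a0 expr0 mul1r.
    have zb : (z - z0) ^+ b != 0 by rewrite expf_neq0// subr_eq0.
    by rewrite mulrBr mulrCA mulVf// mulr1.
rewrite (pole_order_local lg0) b0; have [dh' h'0 ab' gh'] := lg0.
have ch' : ccont h' z0 by apply: cdiff_cont; exact: cnear_self dh'.
have [//|b'0] := posnP b'.
have a'0 : a' = 0%N by move: ab'; rewrite (gtn_eqF b'0) orbF => /eqP.
have := @power_order R (fun z => (z - z0) ^+ a * h z - c) h' z0 b' 0.
rewrite leqn0 => H; apply/eqP; apply: H => //.
  apply: ccontB; last exact: ccont_cst.
  by apply: ccontM => //; exact: cdiff_cont.
apply: cnearS (cnearI fh gh') => z [fz gz] zz0; have := gz zz0; rewrite fz// b0 a'0 !expr0 divr1 => ->.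
by rewrite mulr1 div1r mulrAC mulVf ?mul1r// expf_neq0// subr_eq0.
Qed.

Lemma proximityB_le f (c : R[i]) r : 0 < r -> ccirc_cont f r ->
  proximity (fun z => f z - c) r <= proximity f r + (logp (normc c) + ln 3).
Proof.
move=> r0 cf; rewrite !proximityE -[X in _ + X](cmean_cst _ r) -cmeanD ?(ltW r0)//.
- apply: le_cmean; first exact: ltW.
  + by apply: circ_logp => z zr; apply: ccontB; [exact: cf | exact: ccont_cst].
  + by move=> z zr; apply: rcontD; [apply: rcont_logp; exact: cf | exact: rcont_cst].
  + move=> z _; apply: le_trans (le_logp (normcB _ _)) _.
    (* Two terms, hence the constant [ln 3] from the successor in [logp_sum]. *)
    have := @logp_sum R bool [:: true; false] (fun b => if b then normc (f z) else normc c).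
    rewrite !big_cons !big_nil !addr0 => /(_ _)/le_trans; apply.
      by case; exact: normc_ge0.
    by rewrite addrC addrA.
- exact: circ_logp.
- by move=> z _; exact: rcont_cst.
Qed.

(** A pole at the origin alone contributes [ln r] to the counting function. If [f] has none there,
    subtracting its value [c] at 0 creates a zero, and the first main theorem transfers the pole of
    [1 / (f - c)] back to [f]. *)
Lemma characteristic_unbounded f : nz_mero f -> (~ exists c : R[i], mero_eq f (cst c)) ->
  meromorphic f ->
  exists (c : R[i]) (K : R), nz_mero (fun z => f z - c) /\
    forall r, 1 <= r -> good f r -> good (fun z => f z - c) r -> ln r <= characteristic f r + K.
Proof.
move=> lf nc mf; have [a [b [h lf0]]] := lf 0; have [dh h0 ab fh] := lf0.
(* The limit of [f] at 0: [h 0] at a point of order 0, and 0 at a zero. At a pole nothing is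
   subtracted. *)
pose c : R[i] := if (b == 0%N) && (a == 0%N) then h 0 else 0.
have mg : meromorphic (fun z => f z - c).
  move=> z0; have [k [g [dg fg]]] := mf z0; exists k, (fun z => g z - c * (z - z0) ^+ k); split.
    move: dg => /holomorphic_cdiff dg; apply/holomorphic_cdiff; apply: cnearS dg => z dgz.
    apply: cdiffB => //; apply: cdiffM; first exact: cdiff_cst.
    by apply: cdiffX; apply: cdiffB; [exact: cdiff_id | exact: cdiff_cst].
  move: fg => /dcnearP fg; apply/dcnearP; apply: cnearS fg => z fz zz0; rewrite fz//.
  have zk : (z - z0) ^+ k != 0 by rewrite expf_neq0// subr_eq0.
  by rewrite mulrBl mulfK.
have lg : nz_mero (fun z => f z - c).
  apply: mero_identity => //; apply: contrapT => N; apply: nc; exists c => z0; apply/dcnearP.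
  have : zero_near (fun z => f z - c) z0 by apply: contrapT => nz; apply: N; exists z0.
  by apply: cnearS => z fz zz0; apply/eqP; rewrite -subr_eq0; apply/eqP; exact: fz.
have [b0|b0] := posnP b; last first.
  exists c, 0; split => // r r1 _ _; rewrite addr0 (le_trans (counting_pole0 lf lf0 b0 r1))//.
  by rewrite lerDr proximity_ge0.
have [a' [b' [h' lg0]]] := lg 0; have [dh' h'0 ab' gh'] := lg0.
have ch : ccont h 0 by apply: cdiff_cont; exact: cnear_self dh.
have ch' : ccont h' 0 by apply: cdiff_cont; exact: cnear_self dh'.
have b'0 : b' = 0%N.
  by rewrite -(pole_order_local lg0) pole_orderB// (pole_order_local lf0).
have a'0 : (0 < a')%N.
  rewrite lt0n; apply/negP => /eqP a'0.
  pose u (z : R[i]) : R[i] := z ^+ a * h z - c.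
  have cu : ccont u 0.
    apply: ccontB; last exact: ccont_cst.
    by apply: ccontM => //; apply: ccontX; exact: ccont_id.
  have u0 : u 0 = 0.
    rewrite /u /c b0 eqxx/= expr0n; case: (a == 0%N); rewrite ?mul1r ?mul0r subrr//.
  have := ccont_neq0 (ccontB ch' cu); rewrite u0 subr0 => /(_ h'0) nz.
  have C : cnear 0 (fun z : R[i] => z != 0 -> False).
    apply: cnearS (cnearI (cnearI fh gh') nz) => z [[fz gz] nz'] z0.
    move: (gz z0) nz'; rewrite fz// a'0 b'0 b0 !subr0 !expr0 !divr1 mul1r /u => <-.
    by rewrite subrr eqxx.
  by have [z _] := cnear_punct C.
have [J HJ] := first_main lg.
exists c, (logp (normc c) + ln 3 - J); split => // r r1 gf gg; have r0 := lt_le_trans ltr01 r1.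
have H1 := HJ r r0 gg.
have H2 : ln r <= characteristic (fun z => (f z - c)^-1) r.
  rewrite (le_trans (counting_pole0 (nz_meroV lg) (local_formV lg0) a'0 r1))//.
  by rewrite lerDr proximity_ge0.
have H3 := proximityB_le c r0 (good_cont gf).
have PO : pole_order (fun z => f z - c) = pole_order f.
  by apply/funext => z; rewrite pole_orderB.
have H4 : counting_fun (fun z => f z - c) r = counting_fun f r by rewrite /counting_fun /pole_count PO.
move: H1 H2 H3; rewrite /characteristic H4.
move: (counting_fun f r) (proximity f r) (proximity _ r) (logp _ + ln 3) (counting_fun _ r) (proximity _ r) (ln r).
by move=> *; lra.
Qed.

End nevanlinna.

(** * The logarithmic difference on a circle *)

Section shift_estimate.
Variable R : realType.
Implicit Types (f g h F : R[i] -> R[i]) (z w q : R[i]) (r rho t : R) (s ps qs : seq R[i]).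

Lemma circ_pow d r q : 0 < r -> normc q != r ->
  circ_cont (fun w => expR (d * (ln r - ln (normc (w - q))))) r.
Proof.
move=> r0 qr w wr; apply: rcont_expR; apply: rcontM; first exact: rcont_cst.
apply: rcontB; first exact: rcont_cst.
apply: rcont_ln_normc; first by apply: ccontB; [exact: ccont_id | exact: ccont_cst].
by rewrite subr_eq0; apply: contraNneq qr => <-; rewrite wr.
Qed.

Lemma logp_ratio_le (x y k d : R) : 0 < k -> 0 < d <= 1 -> 0 < y -> x <= y + k ->
  logp (x / y) <= (1 + d^-1) * expR (d * (ln k - ln y)).
Proof.
move=> k0 d01 y0 xy; have ky : 0 < k / y by rewrite divr_gt0.
apply: (@le_trans _ _ (logp (1 + k / y))).
  by apply: le_logp; rewrite ler_pdivrMr// mulrDl mul1r divfK ?gt_eqF.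
rewrite logp_ge1; last by rewrite lerDl ltW.
by rewrite (le_trans (ln1D_le_pow ky d01))// lnM ?lnV ?posrE ?invr_gt0.
Qed.

Lemma logp_rprod_div_le s (x y : R[i]) (k d : R) : 0 < k -> 0 < d <= 1 -> y \notin s ->
  normc (x - y) <= k -> logp (normc (rprod s x / rprod s y)) <=
    \sum_(q <- s) (1 + d^-1) * expR (d * (ln k - ln (normc (y - q)))).
Proof.
move=> k0 d01 + xy; elim: s => [|q s IH].
  by rewrite big_nil /rprod !big_nil divr1 normc1 /logp ln1 maxxx.
rewrite inE negb_or big_cons => /andP[yq ys].
have yq0 : 0 < normc (y - q) by rewrite normc_gt0 subr_eq0.
have -> : rprod (q :: s) x / rprod (q :: s) y = ((x - q) / (y - q)) * (rprod s x / rprod s y).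
  by rewrite /rprod !big_cons invfM mulrACA.
rewrite normcM (le_trans (logpM _ _)) ?normc_ge0// lerD ?IH//.
rewrite normcM normcV; apply: logp_ratio_le => //.
have -> : x - q = (y - q) + (x - y) by rewrite [RHS]addrC addrA subrK.
by rewrite (le_trans (normcD _ _))// lerD2l.
Qed.

Lemma pole_count_size f ps r : (forall p, p \in ps -> normc p <= r) ->
  (forall z, normc z <= r -> pole_order f z = count_mem z ps) ->
  (size ps)%:R = pole_count f r.
Proof.
move=> Hn Hp; rewrite (pole_countE Hp (lexx r)); congr (_%:R).
by apply/esym/eqP; rewrite -all_count; apply/allP => p /Hn.
Qed.

Lemma le_cmean_sum (I : eqType) (q : seq I) (G : I -> R[i] -> R) (M : I -> R) r : 0 <= r ->
  (forall i, i \in q -> circ_cont (G i) r /\ cmean (G i) r <= M i) ->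
  circ_cont (fun z => \sum_(i <- q) G i z) r /\
  cmean (fun z => \sum_(i <- q) G i z) r <= \sum_(i <- q) M i.
Proof.
move=> r0; elim: q => [|i q IH] HG.
  have -> : (fun z => \sum_(i <- [::]) G i z) = fun=> 0 by apply/funext => z; rewrite big_nil.
  by split; [move=> z _; exact: rcont_cst | rewrite cmean_cst big_nil].
have [|c1 c2] := IH; first by move=> j jq; apply: HG; rewrite inE jq orbT.
have -> : (fun z => \sum_(j <- i :: q) G j z) = fun z => G i z + \sum_(j <- q) G j z.
  by apply/funext => z; rewrite big_cons.
have [ci mi] := HG i (mem_head _ _).
split; first by move=> w wr; apply: rcontD; [exact: ci | exact: c1].
by rewrite cmeanD// big_cons lerD.
Qed.

(** [|ln |f||] splits into the logarithms giving the two proximities. For a linear factor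
    [normc (z - c) <= 2 * r] gives [|ln (normc (z - c))| <= 2 * ln (2 * r) - ln (normc (z - c))],
    and the subtracted mean is nonnegative as [1 <= r]. *)
Lemma cmean_abs_lnF f F rho ps qs r : nz_mero f -> 1 <= r -> r < rho -> good f r ->
  (forall z, normc z < rho -> cdiff F z /\ F z != 0) ->
  (forall p, p \in ps ++ qs -> normc p <= r) ->
  (forall z, normc z < rho -> reg f z ->
      [/\ z \notin ps, z \notin qs & f z * rprod ps z = F z * rprod qs z]) ->
  cmean (fun w => `|ln (normc (F w))|) r <=
    proximity f r + proximity (fun z => (f z)^-1) r + (size (ps ++ qs))%:R * (2 * ln (2 * r)).
Proof.
move=> lf r1 rrho gf HF Hn Hf; have r0 := lt_le_trans ltr01 r1; have r00 := ltW r0.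
have nr c : c \in ps ++ qs -> normc c != r.
  rewrite mem_cat => cc; apply/negP => /eqP cr.
  have [||n1 n2 _] := Hf c; [by rewrite cr | exact: gf|].
  by move: cc => /orP[] ?; [move: n1 | move: n2] => /negP.
have [cs ms] := sumln_mean r0 nr.
have cF := circ_lnF HF rrho.
have c1 := circ_logp (good_cont gf); have c2 := circ_logp (good_cont (goodV gf)).
rewrite !proximityE -cmeanD//.
have c12 : circ_cont (fun z => logp (normc (f z)) + logp (normc (f z)^-1)) r.
  by move=> w wr; apply: rcontD; [exact: c1 | exact: c2].
have l2r : 0 <= ln (2 * r) by rewrite ln_ge0// (le_trans r1)// ler_peMl// ler1n.
pose L := (size (ps ++ qs))%:R * (2 * ln (2 * r)).
have cL : circ_cont (fun z => L - sumln (ps ++ qs) z) r.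
  by move=> w wr; apply: rcontB; [exact: rcont_cst | exact: cs].
apply: (@le_trans _ _ (cmean (fun z => (logp (normc (f z)) + logp (normc (f z)^-1)) + (L - sumln (ps ++ qs) z)) r)).
  apply: le_cmean => //.
  - by move=> w wr; apply: rcont_abs; exact: cF.
  - by move=> w wr; apply: rcontD; [exact: c12 | exact: cL].
  move=> z zr; have [||n1 n2 E] := Hf z; [by rewrite zr | exact: gf|].
  have [_ fz] := cnear_self (gf _ zr).
  have [|_ Fz] := HF z; first by rewrite zr.
  have lE : ln (normc (F z)) = ln (normc (f z)) + sumln ps z - sumln qs z.
    rewrite -!ln_rprod//; apply/eqP; rewrite eq_sym subr_eq; apply/eqP.
    by rewrite -!lnM ?posrE ?normc_gt0 ?rprod_neq0// -!normcM E.
  rewrite normcV -abs_ln ?normc_gt0// lE -addrA.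
  apply: (le_trans (ler_normD _ _)); rewrite lerD2l.
  have S s : (forall c, c \in s -> normc c <= r) -> z \notin s ->
      `|sumln s z| <= (size s)%:R * (2 * ln (2 * r)) - sumln s z.
    rewrite /sumln; elim: s => [|c s IH] Hs; first by rewrite big_nil normr0 mul0r subrr.
    rewrite inE negb_or big_cons => /andP[zc zs]; rewrite (le_trans (ler_normD _ _))//=.
    have {}IH := IH (fun d ds => Hs d ltac:(by rewrite inE ds orbT)) zs.
    have zc0 : 0 < normc (z - c) by rewrite normc_gt0 subr_eq0.
    have : `|ln (normc (z - c))| <= 2 * ln (2 * r) - ln (normc (z - c)).
      have B : logp (normc (z - c)) <= ln (2 * r).
        rewrite -(logp_ge1 (x := 2 * r)); last by rewrite (le_trans r1)// ler_peMl// ler1n.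
        apply: le_logp; rewrite (le_trans (normcB _ _))// zr mulrDl mul1r lerD2l.
        by apply: Hs; rewrite mem_head.
      have := abs_ln zc0; have := logpV zc0; move: B.
      by move: (logp (_^-1)) (logp _) (ln (normc _)) (`|_|) (ln _) => *; lra.
    rewrite -(natr1 (size s)) mulrDl mul1r; move: IH.
    move=> H1 H2; apply: le_trans (lerD H2 H1) _; rewrite le_eqVlt; apply/orP; left; apply/eqP.
    clear; move: (ln (2 * r)) (\sum_(i <- s) ln (normc (z - i))) ((size s)%:R : R) => a b x; ring.
  rewrite -[sumln ps z - _]opprB normrN.
  have cat : sumln (ps ++ qs) z = sumln ps z + sumln qs z by rewrite /sumln big_cat.
  have S1 := S ps (fun c cs => Hn c ltac:(by rewrite mem_cat cs)) n1.
  have S2 := S qs (fun c cs => Hn c ltac:(by rewrite mem_cat cs orbT)) n2.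
  rewrite (le_trans (ler_normB _ _))// cat /L size_cat natrD mulrDl.
  move: S1 S2; move: (sumln ps z) (sumln qs z) ((size ps)%:R * _) ((size qs)%:R * _) => a b x y S1 S2.
  by rewrite addrC (le_trans (lerD S1 S2))// le_eqVlt; apply/orP; left; apply/eqP; ring.
rewrite cmeanD// lerD2l cmeanB//; last by move=> w _; exact: rcont_cst.
rewrite cmean_cst lerBlDr lerDl ms big_seq; apply: sumr_ge0 => c _.
by rewrite ln_ge0// le_max r1.
Qed.

(** The first summand comes from the zero-free factor, by [lnF_diff] and [cmean_abs_lnF] on the
    circle of radius [r1]. The second comes from the linear factors, each costing the same by
    [mean_pow]. *)
Lemma shift_mean f (a : R[i]) (c d r r1 : R) : nz_mero f -> normc a <= c -> 0 < d < 1 ->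
  1 <= r -> r + c < r1 -> good f r -> good (fun z => f (z + a)) r -> good f r1 ->
  (forall z, normc z = r -> reg f (z + a)) ->
  circ_cont (fun z => logp (normc (f (z + a) / f z))) r /\
  cmean (fun z => logp (normc (f (z + a) / f z))) r <=
    2 * (r1 * c / (r1 - (r + c)) ^+ 2) * (proximity f r1 + proximity (fun z => (f z)^-1) r1 +
       (pole_count f r1 + pole_count (fun z => (f z)^-1) r1) * (2 * ln (2 * r1))) +
    (pole_count f r1 + pole_count (fun z => (f z)^-1) r1) *
      ((1 + d^-1) * expR (d * (ln (c + 1) - ln r)) * (cos (d * (pi / 2)))^-1).
Proof.
move=> lf ac d01 r11 rcr1 gr gar gr1 regs; have r0 := lt_le_trans ltr01 r11; have r00 := ltW r0.
have d0 : 0 < d by case/andP: d01.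
have d1 : 0 < d <= 1 by rewrite d0 ltW//; case/andP: d01.
have c0 : 0 <= c by rewrite (le_trans (normc_ge0 a)).
have c10 : 0 < c + 1 by rewrite ltr_wpDl.
have rr1 : r < r1 by rewrite (le_lt_trans _ rcr1)// lerDl.
have r10 := lt_trans r0 rr1; have r1r1 : 1 <= r1 by rewrite (le_trans r11)// ltW.
have [rho [F [ps [qs [r1rho HF Hn Hf Hp]]]]] := factorization r1 lf.
have Sp := @pole_count_size f ps r1 (fun p pp => Hn p ltac:(by rewrite mem_cat pp)) (fun z zr => (Hp z zr).1).
have Sq := @pole_count_size (fun z => (f z)^-1) qs r1 (fun p pp => Hn p ltac:(by rewrite mem_cat pp orbT)) (fun z zr => (Hp z zr).2).
rewrite -Sp -Sq -natrD -size_cat.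
have U := cmean_abs_lnF lf r1r1 r1rho gr1 HF Hn Hf.
set cu := cmean _ r1 in U.
have za z : normc z = r -> normc (z + a) <= r + c.
  by move=> zr; rewrite (le_trans (normcD _ _))// zr lerD2l.
have zar z : normc z = r -> normc (z + a) < r1 by move=> /za /le_lt_trans; apply.
(* The places where the linear factors of [f (z + a) / f z] blow up: zeros of [f], and poles of [f]
   moved by [- a]. *)
pose cs := qs ++ [seq p - a | p <- ps].
have csr q : q \in cs -> normc q != r.
  rewrite mem_cat => qc; apply/negP => /eqP qr; move: qc => /orP[qq|/mapP[p pp qE]].
    have [||_ n2 _] := Hf q; [by rewrite qr (lt_trans rr1) | exact: gr|].
    by rewrite qq in n2.
  have pE : q + a = p by rewrite qE subrK.
  have [||n1 _ _] := Hf (q + a); [exact: lt_trans (zar _ qr) r1rho | exact: regs|].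
  by rewrite pE pp in n1.
(* [c + 1] instead of [c] keeps the step size positive when no shift occurs; [- ln r] cancels the
   normalization in [mean_pow]. *)
pose C0 := (1 + d^-1) * expR (d * (ln (c + 1) - ln r)).
have C00 : 0 <= C0 by rewrite mulr_ge0 ?expR_ge0// addr_ge0 ?invr_ge0// ltW.
pose G q w := C0 * expR (d * (ln r - ln (normc (w - q)))).
have cG q : q \in cs -> circ_cont (G q) r.
  by move=> qc; apply: circ_contZ; apply: circ_pow => //; exact: csr.
have [|cS mS] := @le_cmean_sum _ cs G (fun=> C0 * (cos (d * (pi / 2)))^-1) r r00.
  move=> q qc; split; first exact: cG.
  rewrite cmeanZ//; last by apply: circ_pow => //; exact: csr.
  by rewrite ler_wpM2l//; apply: mean_pow => //; exact: csr.
have sz : size cs = size (ps ++ qs) by rewrite !size_cat size_map addnC.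
rewrite big_const_seq count_predT iter_addr_0 -[_ *+ size cs]mulr_natl sz in mS.
have cf : circ_cont (fun z => logp (normc (f (z + a) / f z))) r.
  move=> z zr; apply: rcont_logp; apply: ccont_div.
  - exact: (good_cont gar).
  - exact: (good_cont gr).
  - by have [] := cnear_self (gr _ zr).
split=> //; set K := 2 * _.
apply: (@le_trans _ _ (cmean (fun z => K * cu + \sum_(q <- cs) G q z) r)); last first.
  rewrite cmeanD//; last by move=> w _; exact: rcont_cst.
  rewrite cmean_cst lerD// ler_wpM2l//.
  rewrite mulr_ge0// divr_ge0 ?exprn_ge0 ?mulr_ge0 ?(ltW r10)//.
  by rewrite subr_ge0 ltW.
apply: le_cmean => //.
  by move=> w wr; apply: rcontD; [exact: rcont_cst | exact: cS].
move=> z zr; have zrho : normc z < rho by rewrite zr (lt_trans rr1).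
have zarho := lt_trans (zar _ zr) r1rho.
have [n1 n2 E] := Hf z zrho (gr _ zr); have [m1 m2 E'] := Hf _ zarho (regs _ zr).
have [_ Fz] := HF _ zrho; have [_ Fza] := HF _ zarho.
have D := @lnF_diff R F rho r1 HF r10 r1rho (z + a) z (zar _ zr) ltac:(by rewrite zr).
have rp1 := rprod_neq0 n1; have rq1 := rprod_neq0 n2.
have rp2 := rprod_neq0 m1; have rq2 := rprod_neq0 m2.
have fE : f z = F z * rprod qs z / rprod ps z by rewrite -E mulfK.
have fE' : f (z + a) = F (z + a) * rprod qs (z + a) / rprod ps (z + a) by rewrite -E' mulfK.
have -> : f (z + a) / f z = (F (z + a) / F z) * ((rprod qs (z + a) / rprod qs z) * (rprod ps z / rprod ps (z + a))).
  by rewrite fE fE'; field; rewrite rp1 rp2 rq1 Fz.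
rewrite normcM (le_trans (logpM _ _)) ?normc_ge0// lerD//.
  apply: (@le_trans _ _ `|ln (normc (F (z + a))) - ln (normc (F z))|).
    rewrite normcM normcV -lnV ?posrE ?normc_gt0// -lnM ?posrE ?invr_gt0 ?normc_gt0//.
    by rewrite abs_ln ?lerDl ?logp_ge0// divr_gt0 ?normc_gt0.
  apply: (le_trans D); rewrite /K ler_wpM2r//.
    rewrite -(cmean_cst 0 r1); apply: le_cmean; first exact: ltW.
    - by move=> w _; exact: rcont_cst.
    - by move=> w wr; apply: rcont_abs; exact: (circ_lnF HF r1rho).
    - by move=> w _; exact: normr_ge0.
  have -> : z + a - z = a by rewrite addrC addKr.
  rewrite ler_wpM2l// zr.
  have zac := za _ zr; have rc : r <= r + c by rewrite lerDl.
  have p1 : 0 < r1 - (r + c) by rewrite subr_gt0.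
  have p2 : r1 - (r + c) <= r1 - normc (z + a) by rewrite lerD2l lerN2.
  have p3 : r1 - (r + c) <= r1 - r by rewrite lerD2l lerN2.
  rewrite ler_pM ?mulr_ge0 ?normc_ge0 ?(ltW r10)//.
  - by rewrite invr_ge0 mulr_ge0 // (le_trans (ltW p1)).
  - by rewrite ler_wpM2l// ltW.
  rewrite lef_pV2 ?posrE ?mulr_gt0 ?exprn_gt0// ?(lt_le_trans p1)//.
  by rewrite expr2 ler_pM// ltW.
rewrite normcM (le_trans (logpM _ _)) ?normc_ge0// /cs big_cat big_map/=.
have GE q w : G q w = (1 + d^-1) * expR (d * (ln (c + 1) - ln (normc (w - q)))).
  rewrite /G /C0 -mulrA -expRD; congr (_ * expR _).
  by move: (ln _) (ln _) (ln _) => x1 x2 x3; ring.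
have kc : normc a <= c + 1 by rewrite (le_trans ac)// lerDl.
rewrite lerD//.
  rewrite (eq_bigr _ (fun q _ => GE q z)); apply: logp_rprod_div_le => //.
  by rewrite addrC addKr.
rewrite (eq_bigr (fun p => (1 + d^-1) * expR (d * (ln (c + 1) - ln (normc (z + a - p)))))).
  by apply: logp_rprod_div_le => //; rewrite -normcN opprB addrC addKr.
by move=> p _; rewrite GE opprB addrA addrAC.
Qed.

End shift_estimate.

(** * Exceptional sets and growth *)

Section exceptional.
Variable R : realType.
Implicit Types (A B E : set R) (f g h : R[i] -> R[i]) (z w : R[i]) (r t x y e : R) (k : nat).
Local Notation mu := (@lebesgue_measure R).

Lemma measurable_inv E : measurable E -> E `<=` `]0, +oo[ ->
  measurable_fun E (fun r : R => (r^-1)%:E).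
Proof.
move=> mE E0; apply: (measurable_funS _ E0).
  exact: measurable_itv.
apply/measurable_EFinP; apply: open_continuous_measurable_fun; first exact: interval_open.
move=> x; rewrite inE /= in_itv/= andbT => x0.
by apply: inv_continuous; rewrite gt_eqF.
Qed.

Lemma flmU A B : finite_log_measure A -> finite_log_measure B -> finite_log_measure (A `|` B).
Proof.
move=> [A0 mA iA] [B0 mB iB]; have mAB : measurable (A `|` B) by exact: measurableU.
have AB0 : A `|` B `<=` `]0, +oo[ by move=> x [/A0|/B0].
split=> //.
have pos x : (A `|` B) x -> (0 <= (x^-1)%:E)%E.
  by move=> /AB0; rewrite /= in_itv/= andbT lee_fin invr_ge0 => /ltW.
have ABE : A `|` B = A `|` (B `\` A) by rewrite setUDr setDv setD0.
have mD : measurable (B `\` A) by exact: measurableD.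
rewrite ABE ge0_integral_setU//; last 3 first.
- by rewrite -ABE; exact: measurable_inv.
- by rewrite -ABE.
- by rewrite disj_set2E setDIK.
rewrite lte_add_pinfty// (le_lt_trans _ iB)//; apply: ge0_subset_integral => //.
- exact: measurable_inv.
- by move=> x Bx; apply: pos; right.
Qed.

(** Making the cover disjoint turns the integral over the union into a series, dominated term by
    term. *)
Lemma flm_cover E (F : nat -> set R) : measurable E -> E `<=` `]0, +oo[ ->
  (forall k, measurable (F k)) -> E `<=` \bigcup_k F k -> (forall k, F k `<=` `]0, +oo[) ->
  (\sum_(k <oo) \int[mu]_(r in F k) (r^-1)%:E < +oo)%E -> finite_log_measure E.
Proof.
move=> mE E0 mF EF F0 Fi; split=> //; apply: le_lt_trans Fi.
have mS k : measurable (seqDU F k).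
  by apply: measurableD => //; exact: bigsetU_measurable.
have mb : measurable (\bigcup_k F k) by exact: bigcupT_measurable.
have pos x : (\bigcup_k F k) x -> (0 <= (x^-1)%:E)%E.
  by move=> [k _ /F0]; rewrite /= in_itv/= andbT lee_fin invr_ge0 => /ltW.
have mf : measurable_fun (\bigcup_k F k) (fun r : R => (r^-1)%:E).
  by apply: measurable_inv => // x [k _ /F0].
apply: (@le_trans _ _ (\int[mu]_(r in \bigcup_k F k) (r^-1)%:E)%E).
  exact: ge0_subset_integral.
rewrite (seqDU_bigcup_eq F) in mf pos *; rewrite ge0_integral_bigcup//.
- apply: lee_nneseries => [k _ _|k _].
    by apply: integral_ge0 => x Fx; apply: pos; exists k.
  apply: ge0_subset_integral => //.
  + exact: mS.
  + exact: mF.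
  + by apply: measurable_inv.
  + by move=> x Fx; apply: pos; rewrite -seqDU_bigcup_eq; exists k.
  exact: subset_seqDU.
Qed.

Lemma flm_countable E : E `<=` `]0, +oo[ -> countable E -> finite_log_measure E.
Proof.
move=> E0 cE; have mE : measurable E by exact: countable_measurable.
split=> //; rewrite null_set_integral//; first exact: measurable_inv.
exact: countable_lebesgue_measure0.
Qed.

Lemma flm_bigU (I : eqType) (s : seq I) (P : I -> set R -> Prop) :
  (forall i, i \in s -> exists2 E, finite_log_measure E & P i E) ->
  (forall i A B, A `<=` B -> P i A -> P i B) ->
  exists2 E, finite_log_measure E & forall i, i \in s -> P i E.
Proof.
move=> H mP; elim: s H => [|i s IH] H.
  by exists set0 => //; apply: flm_countable.
have [E fE PE] := H i (mem_head _ _).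
have [|D fD PD] := IH; first by move=> j js; apply: H; rewrite inE js orbT.
exists (E `|` D); first exact: flmU.
move=> j; rewrite inE => /orP[/eqP->|/PD]; first by apply: mP PE; exact: subsetUl.
by apply: mP; exact: subsetUr.
Qed.

(** The integrand is at most its value [(1 + x) / b] at the left end, on an interval of length
    [b * x / (1 + x)]. *)
Lemma inv_integral_le (b x : R) : 0 < b -> 0 < x ->
  (\int[mu]_(r in `[(b / (1 + x))%R, b]) (r^-1)%:E <= x%:E)%E.
Proof.
move=> b0 x0; have x1 : 0 < 1 + x by rewrite addr_gt0.
have a0 : 0 < b / (1 + x) by rewrite divr_gt0.
have ab : b / (1 + x) < b by rewrite ltr_pdivrMr// ltr_pMr// ltrDl.
have sub : `[b / (1 + x), b]%classic `<=` (`]0, +oo[%classic : set R).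
  by move=> r /=; rewrite !in_itv/= andbT => /andP[/(lt_le_trans a0)].
apply: (@le_trans _ _ (\int[mu]_(r in `[(b / (1 + x))%R, b]) (cst ((b / (1 + x))^-1)%:E r))%E).
  apply: ge0_le_integral => //.
  - by move=> r /sub; rewrite /= in_itv/= andbT lee_fin invr_ge0 => /ltW.
  - exact: measurable_inv.
  - move=> r /=; rewrite in_itv/= lee_fin => /andP[ar _].
    by rewrite lef_pV2 ?posrE// (lt_le_trans a0).
rewrite integral_cst//= lebesgue_measure_itv/= lte_fin ab -EFinD -EFinM lee_fin.
rewrite le_eqVlt; apply/orP; left; apply/eqP; field; rewrite !gt_eqF//.
Qed.

(* On the set where [psi ^ e] lies in [[2^k, 2^(k+1))], the inequality can only fail within a
   factor [1 + 2^-k] of the supremum of that set, i.e. on a set of logarithmic measure at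
   most [2^-k]. *)
Lemma borel_growth (psi : R -> R) e r0 : 0 < e -> 0 < r0 ->
  (forall x y, r0 <= x -> x <= y -> psi x <= psi y) ->
  (forall M, exists2 x, r0 <= x & M <= psi x) -> 1 <= psi r0 ->
  exists2 E, finite_log_measure E & forall r, r0 <= r -> ~ E r ->
    psi (r + r * expR (- e * ln (psi r))) <= expR (ln 2 / e) * psi r.
Proof.
move=> e0 r00 mono unb p1.
have l2 : 0 < ln 2 :> R by rewrite ln_gt0// ltr1n.
have psi1 r : r0 <= r -> 1 <= psi r by move=> rr; rewrite (le_trans p1)// mono.
have psi0 r : r0 <= r -> 0 < psi r by move=> rr; rewrite (lt_le_trans ltr01)// psi1.
pose lam r := e * ln (psi r) / ln 2.
have lam0 r : r0 <= r -> 0 <= lam r.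
  by move=> rr; rewrite /lam divr_ge0 ?(ltW l2)// mulr_ge0 ?(ltW e0)// ln_ge0// psi1.
pose A k : set R := [set r | r0 <= r /\ Num.truncn (lam r) = k].
have lamA k r : A k r -> k%:R <= lam r < k.+1%:R.
  by move=> [rr <-]; apply: truncn_itv; exact: lam0.
have ubA k : has_ubound (A k).
  have [x xr Mx] := unb (expR (k.+1%:R * ln 2 / e)).
  exists x => r Ar; rewrite leNgt; apply/negP => xr'.
  have [rr _] := Ar; have /andP[_] := lamA _ _ Ar; rewrite ltNge => /negP; apply.
  rewrite /lam ler_pdivlMr// -ler_pdivrMl// mulrC.
  rewrite -[X in X <= _]expRK ler_ln ?posrE ?expR_gt0//; last exact: psi0.
  by rewrite (le_trans Mx)// mono// ltW.
pose b k := sup (A k).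
(* This is [2^-k], in the form summed by [epsilon_trick0]; the total is 2. *)
pose h k : R := 2 / (2 ^ k.+1)%:R.
have h0 k : 0 < h k by rewrite divr_gt0// ltr0n expn_gt0.
(* An empty level has [sup] equal to 0 and contributes nothing. *)
pose E k : set R := if 0 < b k then `[(b k / (1 + h k))%R, b k]%classic else set0.
have mE k : measurable (E k) by rewrite /E; case: ifP.
have E0 k : E k `<=` `]0, +oo[.
  rewrite /E; case: ifP => [bk r /=|_ r //]; rewrite !in_itv/= andbT => /andP[br _].
  by rewrite (lt_le_trans _ br)// divr_gt0// addr_gt0.
exists (\bigcup_k E k).
  apply: (@flm_cover _ E) => //; first exact: bigcupT_measurable.
    by move=> r [k _ /E0].
  apply: (@le_lt_trans _ _ 2%:E); last exact: ltry.
  apply: le_trans (@epsilon_trick0 R 2 xpredT _) => //.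
  apply: lee_nneseries => [k _ _|k _].
    apply: integral_ge0 => x /E0; rewrite /= in_itv/= andbT lee_fin invr_ge0 => /ltW //.
  rewrite /E; case: ifP => bk; first exact: inv_integral_le.
  by rewrite integral_set0 lee_fin ltW.
move=> r rr nE; have rp := lt_le_trans r00 rr.
pose k := Num.truncn (lam r).
have Ar : A k r by [].
have rb : r <= b k by apply: ub_le_sup.
have bk := lt_le_trans rp rb.
have x1 : 0 < 1 + h k by rewrite addr_gt0.
have rlt : r * (1 + h k) < b k.
  rewrite -ltr_pdivlMr// ltNge; apply/negP => bkr; apply: nE; exists k => //.
  by rewrite /E bk /= in_itv/= bkr.
have /andP[k1 k2] := lamA _ _ Ar.
have tau : expR (- e * ln (psi r)) <= h k.
  have -> : h k = expR (- (k%:R * ln 2)).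
    rewrite /h expnS natrM invfM mulrA divff ?mul1r ?pnatr_eq0// expRN natrX expRM_natl lnK ?posrE//.
  rewrite ler_expR mulNr lerN2 -ler_pdivlMr//.
(* As [r * (1 + h k)] stays below the supremum of the level, some point of the same level lies
   beyond the enlarged radius; within a level [psi] varies by at most a factor [2^(1/e)]. *)
have [s As rs] : exists2 s, A k s & r + r * expR (- e * ln (psi r)) < s.
  apply: sup_gt; first by exists r.
  by rewrite (le_lt_trans _ rlt)// mulrDr mulr1 lerD2l ler_wpM2l// ltW.
have [sr0 _] := As; have /andP[_ s2] := lamA _ _ As.
have r1 : r0 <= r + r * expR (- e * ln (psi r)).
  by rewrite (le_trans rr)// lerDl mulr_ge0 ?expR_ge0 ?ltW.
apply: (le_trans (mono _ _ r1 (ltW rs))).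
rewrite -ler_ln ?posrE ?mulr_gt0 ?expR_gt0 ?psi0//.
rewrite lnM ?posrE ?expR_gt0 ?psi0// expRK.
have : lam s <= lam r + 1 by rewrite (le_trans (ltW s2))// -natr1 lerD2r.
rewrite /lam -(ler_pM2r l2) mulrDl !divfK ?gt_eqF// mul1r -(ler_pM2l (x := e^-1)) ?invr_gt0//.
by rewrite mulrDr !mulKf ?gt_eqF// [e^-1 * ln 2]mulrC addrC.
Qed.

(** * Circles through irregular points *)

Lemma bad_countable (P : R[i] -> Prop) : (forall z0, cnear z0 (fun z => z != z0 -> P z)) ->
  countable [set r | exists2 z, normc z = r & ~ P z].
Proof.
move=> HP; apply: (@sub_countable _ _ _ (\bigcup_n (@normc R @` [set z | normc z <= n%:R /\ ~ P z]))).
  apply: subset_card_le => r [z zr Pz].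
  exists (Num.truncn r).+1 => //; exists z => //; split=> //; rewrite zr.
  by have /andP[_ /ltW] := truncn_itv (le_trans (normc_ge0 z) (ltac:(by rewrite zr) : normc z <= r)).
apply: bigcup_countable => // n _; apply: finite_set_countable; apply: finite_image.
have [s us sP] := discrete_finite HP n%:R.
apply/finite_seqP; exists s; apply/seteqP; split=> z /=; by rewrite sP.
Qed.

Lemma flm_bad (P : R[i] -> Prop) (c : R) : (forall z0, cnear z0 (fun z => z != z0 -> P z)) ->
  exists2 E, finite_log_measure E & forall r, 0 < r -> ~ E r -> forall z, normc z = r + c -> P z.
Proof.
move=> HP; pose B : set R := [set r | exists2 z, normc z = r & ~ P z].
exists (((fun x => x - c) @` B) `&` `]0, +oo[).
  apply: flm_countable; first exact: subIsetr.
  apply: (@sub_countable _ _ _ ((fun x => x - c) @` B)); first by apply: subset_card_le; exact: subIsetl.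
  exact: sub_countable (card_image_le _ _) (bad_countable HP).
move=> r r0 nE z zr; apply: contrapT => Pz; apply: nE; split; last by rewrite /= in_itv/= r0.
by exists (r + c); [exists z | rewrite addrK].
Qed.

(** An open interval of bad radii would be countable, yet of positive measure. *)
Lemma good_between (P : R[i] -> Prop) x y : (forall z0, cnear z0 (fun z => z != z0 -> P z)) ->
  x < y -> exists t, x < t < y /\ forall z, normc z = t -> P z.
Proof.
move=> HP xy; apply: contrapT => H.
have sub : `]x, y[%classic `<=` [set r | exists2 z, normc z = r & ~ P z].
  move=> t /=; rewrite in_itv/= => txy; apply: contrapT => nt; apply: H; exists t; split=> // z zt.
  by apply: contrapT => Pz; apply: nt; exists z.
have /countable_lebesgue_measure0 : countable (`]x, y[%classic : set R).
  by apply: sub_countable (bad_countable HP); exact: subset_card_le.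
by rewrite lebesgue_measure_itv/= lte_fin xy -EFinD => /eqP; rewrite eqe subr_eq0 gt_eqF.
Qed.

Lemma cnear_shift z (a : R[i]) (P : R[i] -> Prop) : cnear (z + a) P -> cnear z (fun w => P (w + a)).
Proof.
move=> [e e0 H]; exists e => // w wz; apply: H.
by rewrite opprD addrACA subrr addr0.
Qed.

Lemma shift_punct (a : R[i]) (P : R[i] -> Prop) : (forall z0, cnear z0 (fun z => z != z0 -> P z)) ->
  forall z0, cnear z0 (fun z => z != z0 -> P (z + a)).
Proof.
move=> HP z0; apply: cnearS (cnear_shift (HP (z0 + a))) => w Pw wz; apply: Pw.
by rewrite (inj_eq (addIr a)).
Qed.

Lemma nz_mero_reg f : nz_mero f -> forall z0, cnear z0 (fun z => z != z0 -> reg f z).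
Proof. by move=> lf z0; have [a [b [h /local_form_reg]]] := lf z0. Qed.

(** [characteristic_unbounded] wants a radius good for [f] and for [f - c], whereas [r] is only good
    for [f]. Such a radius is found in the unit interval below [r], and monotonicity brings the
    bound to [r]. *)
Lemma characteristic_infty f : nz_mero f -> (~ exists c : R[i], mero_eq f (cst c)) ->
  meromorphic f -> forall M, exists2 r0, 1 <= r0 & forall r, r0 <= r -> good f r -> M <= characteristic f r.
Proof.
move=> lf nc mf M; have [c [K [lc H]]] := characteristic_unbounded lf nc mf.
exists (expR (M + K) + 2); first by rewrite -lerBlDr (le_trans _ (expR_ge0 _))// lerBlDr; lra.
move=> r rM gr.
have [||t [/andP[t1 t2] gt]] := @good_between (fun z => reg f z /\ reg (fun w => f w - c) z) (r - 1) r.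
- move=> z0; apply: cnearS (cnearI (nz_mero_reg lf z0) (nz_mero_reg lc z0)) => z [A B] zz.
  by split; [exact: A|exact: B].
- by rewrite ltrBlDr ltrDl.
have e0 := expR_gt0 (M + K).
have tl : 1 <= t by apply: ltW; apply: le_lt_trans t1; move: rM e0; lra.
have te : expR (M + K) <= t by apply: ltW; apply: le_lt_trans t1; move: rM e0; lra.
have t0 : 0 < t by rewrite (lt_le_trans ltr01).
have gf : good f t by move=> z /gt[].
apply: le_trans (characteristic_monotone lf t0 t2 gf gr).
have := H t tl gf (fun z zt => (gt z zt).2); rewrite -lerBlDr; apply: le_trans.
by rewrite lerBrDr -[X in X <= _]expRK ler_ln ?posrE.
Qed.

(** [borel_growth] is applied to [S], the supremum of the characteristic over good radii from 1 up
    to [x]. It is monotone everywhere from 2 on and equals the characteristic at good radii. *)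
Lemma characteristic_growth f (c e : R) : nz_mero f -> (~ exists c : R[i], mero_eq f (cst c)) ->
  meromorphic f -> 0 <= c -> 0 < e ->
  exists2 E, finite_log_measure E & exists2 r0, 1 <= r0 & forall r, r0 <= r -> ~ E r -> good f (r + c) ->
    1 <= characteristic f (r + c) /\
    forall t, 1 <= t -> t <= r + c + r * expR (- e * ln (characteristic f (r + c))) -> good f t ->
      characteristic f t <= expR (ln 2 / e) * characteristic f (r + c).
Proof.
move=> lf nc mf c0 e0; have HP := nz_mero_reg lf.
have Tinf := characteristic_infty lf nc mf.
pose A x := [set characteristic f t | t in [set t | [/\ 1 <= t, t <= x & good f t]]].
have ubA x : has_ubound (A x).
  have [y [/andP[xy _] gy]] := @good_between _ x (x + 1) HP ltac:(by rewrite ltrDl).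
  exists (characteristic f y) => _ [t [t1 tx gt] <-].
  apply: (characteristic_monotone lf) => //; [exact: lt_le_trans t1|exact: le_lt_trans xy].
pose S x := sup (A x).
have S_ge t x : 1 <= t -> t <= x -> good f t -> characteristic f t <= S x.
  by move=> t1 tx gt; apply: ub_le_sup => //; exists t.
have A2 x : 2 <= x -> A x !=set0.
  move=> x2; have [y [/andP[y1 y2] gy]] := @good_between _ 1 2 HP ltac:(lra).
  exists (characteristic f y); exists y => //; split=> //; first exact: ltW.
  by rewrite ltW// (lt_le_trans y2).
have S_good x : 2 <= x -> good f x -> S x = characteristic f x.
  move=> x2 gx; apply/eqP; rewrite eq_le; apply/andP; split; last by apply: S_ge => //; lra.
  apply: ge_sup; first exact: A2.
  move=> _ [t [t1 tx gt] <-]; have [-> //|ntx] := eqVneq t x.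
  have {}tx : t < x by rewrite lt_neqAle ntx.
  by apply: (characteristic_monotone lf) => //; exact: lt_le_trans t1.
have S_mono x y : 2 <= x -> x <= y -> S x <= S y.
  move=> x2 xy; apply: ge_sup; first exact: A2.
  move=> _ [t [t1 tx gt] <-]; apply: S_ge => //; exact: le_trans xy.
have S_inf M : exists2 x, 2 <= x & M <= S x.
  have [r0 r01 H] := Tinf M.
  have [y [/andP[xy _] gy]] := @good_between _ (r0 + 1) (r0 + 2) HP ltac:(lra).
  exists y; first lra.
  by apply: (@le_trans _ _ (characteristic f y)); [apply: H => //; lra | apply: S_ge => //; lra].
have [x0 x02 Sx0] := S_inf 1.
have [||||E fE HE] := @borel_growth (fun r => S (r + c)) e x0 e0.
- lra.
- by move=> x y xx xy; apply: S_mono; [lra | lra].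
- move=> M; have [x x2 Mx] := S_inf M; exists (x0 + x); first by lra.
  by apply: (le_trans Mx); apply: S_mono => //; lra.
- by apply: (le_trans Sx0); apply: S_mono => //; lra.
exists E => //; exists x0; first lra.
move=> r rx nE gr; have := HE r rx nE; rewrite /= (S_good (r + c)) => [H|//|//]; last by lra.
split.
  by rewrite -(S_good (r + c)) => [|//|//]; [apply: (le_trans Sx0); apply: S_mono => //; lra | lra].
move=> t t1 tx gt; apply: le_trans H; apply: S_ge => //.
by rewrite addrAC.
Qed.

End exceptional.

(** * The logarithmic difference and the characteristic *)

Section shift_asymptotics.
Variable R : realType.
Implicit Types (E : set R) (f g : R[i] -> R[i]) (z w a : R[i]) (r c d : R).

(** [n] carries [tau^-1] and the squared gap [tau^-1 ^+ 2 / r]. The factor [1 / r] is partly spent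
    on [ln (2 * r1)], and both summands end with [tau^-1 ^+ 3] and [r^-d]. *)
Lemma shift_bound_arith (c d K D X tau r r1 m n : R) : 0 <= c -> 0 < d < 1 -> 0 <= K ->
  1 <= r -> 0 < tau <= 1 -> 0 <= D -> 0 <= X ->
  r * tau / 3 <= r1 - (r + c) -> r1 <= 3 * r -> 0 <= m <= 2 * (D * X) ->
  0 <= n <= 36 * (D * X) / tau ->
  2 * (r1 * c / (r1 - (r + c)) ^+ 2) * (m + n * (2 * ln (2 * r1))) +
    n * ((1 + d^-1) * expR (d * (ln (c + 1) - ln r)) * K) <=
  (54 * c * (2 + 72 * (expR ((1 - d) * ln 6) / (1 - d))) +
    36 * ((1 + d^-1) * expR (d * ln (c + 1)) * K)) * D * (X * tau^-1 ^+ 3) * expR (- d * ln r).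
Proof.
move=> c0 /andP[d0 d1] K0 r1' /andP[t0 t1] D0 X0 gap r13 /andP[m0 mle] /andP[n0 nle].
have r0 : 0 < r by exact: lt_le_trans r1'.
set S := expR (- d * ln r); set L := expR _ / _.
have S0 : 0 < S := expR_gt0 _.
have d10 : 0 < 1 - d by rewrite subr_gt0.
have L0 : 0 <= L by rewrite divr_ge0 ?expR_ge0 ?ltW.
have rS : r * S = expR ((1 - d) * ln r).
  by rewrite -{1}(@lnK _ r) ?posrE// -expRD; congr expR; ring.
have rS1 : 1 <= r * S.
  by rewrite rS -[X in X <= _]expR0 ler_expR mulr_ge0 ?(ltW d10) ?ln_ge0.
have r10 : 0 < r1.
  have : 0 < r * tau / 3 by rewrite divr_gt0// mulr_gt0.
  by move: gap r0 c0; move: (r * tau / 3) => q; lra.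
(* From [2 * r1 <= 6 * r] and [ln y <= y^(1 - d) / (1 - d)] at [y = 6 * r]; [r * S] is
   [r^(1 - d)]. *)
have ln6 : ln (2 * r1) <= L * (r * S).
  apply: (@le_trans _ _ (ln (6 * r))).
    by rewrite ler_ln ?posrE; [move: r13; lra | lra | lra].
  rewrite rS /L mulrAC -expRD -mulrDr -lnM ?posrE// ler_pdivlMr// mulrC.
  by rewrite (le_trans _ (expR_ge1Dx _))// lerDr.
have T1 : 1 <= tau^-1 by rewrite invf_ge1.
have g0 : 0 < r * tau / 3 by rewrite divr_gt0// mulr_gt0.
(* 27 is 3 from [r1 <= 3 * r] times 9 from the squared gap. *)
have F1 : r1 * c / (r1 - (r + c)) ^+ 2 <= 27 * c * tau^-1 ^+ 2 / r.
  apply: (@le_trans _ _ (3 * r * c / (r * tau / 3) ^+ 2)).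
    rewrite ler_pM ?mulr_ge0 ?invr_ge0 ?exprn_ge0 ?(ltW r10)//.
    - by rewrite (le_trans (ltW g0)).
    - by rewrite ler_wpM2r.
    rewrite lef_pV2 ?posrE ?exprn_gt0 ?(lt_le_trans g0)//.
    by rewrite lerXn2r ?nnegrE ?(le_trans (ltW g0))// ltW.
  by rewrite le_eqVlt; apply/orP; left; apply/eqP; field; rewrite !gt_eqF.
have DX : 0 <= D * X by rewrite mulr_ge0.
have rS0 : 0 <= r * S by rewrite (le_trans ler01).
have T0 : 0 <= tau^-1 by rewrite (le_trans ler01).
have l0 : 0 <= L * (r * S) by rewrite mulr_ge0.
have F2 : m + n * (2 * ln (2 * r1)) <= D * X * (r * S) * tau^-1 * (2 + 72 * L).
  have A : m <= 2 * (D * X) * ((r * S) * tau^-1).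
    by rewrite (le_trans mle)// ler_peMr ?mulr_ge0// -[X in X <= _]mulr1 ler_pM.
  have B : n * (2 * ln (2 * r1)) <= 36 * (D * X) / tau * (2 * (L * (r * S))).
    apply: (@le_trans _ _ (n * (2 * (L * (r * S))))); first by rewrite ler_wpM2l// ler_wpM2l.
    by rewrite ler_wpM2r// mulr_ge0.
  apply: (le_trans (lerD A B)).
  by rewrite le_eqVlt; apply/orP; left; apply/eqP; ring.
have dE : expR (d * (ln (c + 1) - ln r)) = expR (d * ln (c + 1)) * S.
  by rewrite -expRD; congr expR; ring.
rewrite dE; set W := expR (d * ln (c + 1)).
have W0 : 0 <= W := expR_ge0 _.
have c1 : 0 <= 2 + 72 * L by rewrite addr_ge0// mulr_ge0.
have P1 : 2 * (r1 * c / (r1 - (r + c)) ^+ 2) * (m + n * (2 * ln (2 * r1))) <=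
    54 * c * (2 + 72 * L) * D * (X * tau^-1 ^+ 3) * S.
  apply: (@le_trans _ _ (2 * (27 * c * tau^-1 ^+ 2 / r) * (D * X * (r * S) * tau^-1 * (2 + 72 * L)))).
    apply: (@le_trans _ _ (2 * (r1 * c / (r1 - (r + c)) ^+ 2) * (D * X * (r * S) * tau^-1 * (2 + 72 * L)))).
      rewrite ler_wpM2l// mulr_ge0// divr_ge0 ?sqr_ge0//.
      by rewrite mulr_ge0// ltW.
    rewrite ler_wpM2r//; last by rewrite ler_wpM2l.
    by rewrite mulr_ge0// mulr_ge0// mulr_ge0.
  by rewrite le_eqVlt; apply/orP; left; apply/eqP; field; rewrite !gt_eqF.
have d1' : 0 <= 1 + d^-1 by rewrite addr_ge0// invr_ge0 ltW.
have P2 : n * ((1 + d^-1) * (W * S) * K) <= 36 * ((1 + d^-1) * W * K) * D * (X * tau^-1 ^+ 3) * S.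
  apply: (@le_trans _ _ (36 * (D * X) * tau^-1 ^+ 3 * ((1 + d^-1) * (W * S) * K))).
    rewrite ler_wpM2r ?mulr_ge0// ?(ltW S0)// (le_trans nle)// ler_wpM2l ?mulr_ge0//.
    by rewrite exprS ler_peMr// expr_ge1.
  by rewrite le_eqVlt; apply/orP; left; apply/eqP; ring.
apply: (le_trans (lerD P1 P2)).
by rewrite le_eqVlt; apply/orP; left; apply/eqP; ring.
Qed.

Lemma reg_shift f a z : reg f (z + a) -> reg (fun w => f (w + a)) z.
Proof.
move=> /cnear_shift; apply: cnearS => w [dw nw]; split=> //.
by apply: (cdiff_comp (g := fun v => v + a)) dw; apply: cdiffD; [exact: cdiff_id | exact: cdiff_cst].
Qed.

Lemma counting_le_characteristic f r : counting_fun f r <= characteristic f r.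
Proof. by rewrite /characteristic lerDr proximity_ge0. Qed.

Lemma pole_count_ge0 f r : 0 <= pole_count f r.
Proof. by rewrite /pole_count; apply: fsumr_ge0 => z _; exact: ler0n. Qed.

(** The difference analogue of the lemma on the logarithmic derivative. [E] and [C] do not depend on
    the shift [a], so one exceptional set serves all shifts of both difference polynomials. *)
Lemma shift_proximity f c d (eps : R) : nz_mero f -> (~ exists c : R[i], mero_eq f (cst c)) ->
  meromorphic f -> 0 <= c -> 0 < d < 1 -> 0 < eps ->
  exists2 E, finite_log_measure E & exists2 C, 0 <= C & exists2 r0, 1 <= r0 &
    forall r, r0 <= r -> ~ E r ->
    [/\ good f r, 1 <= characteristic f (r + c) &
     forall a, normc a <= c -> (forall z, normc z = r -> reg f (z + a)) ->
      circ_cont (fun z => logp (normc (f (z + a) / f z))) r /\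
      cmean (fun z => logp (normc (f (z + a) / f z))) r <=
        C * (expR ((1 + eps) * ln (characteristic f (r + c))) * expR (- d * ln r))].
Proof.
move=> lf nc mf c0 d01 eps0; have HP := nz_mero_reg lf.
(* With [tau = T(r + c)^-e], the pole counts cost [tau^-1] and the Schwarz kernel [tau^-2]. *)
pose e := eps / 3; have e0 : 0 < e by rewrite divr_gt0.
have [E1 fE1 [r0 r01 HE1]] := characteristic_growth lf nc mf c0 e0.
have [E2 fE2 HE2] := flm_bad 0 HP.
have [E3 fE3 HE3] := flm_bad c HP.
have [J HJ] := first_main lf.
have lV := nz_meroV lf.
exists (E1 `|` E2 `|` E3); first by do 2?apply: flmU.
(* [D * X] bounds the characteristics of [f] and of [1 / f] at the radii used; the constant [J] is
   absorbed because [1 <= X]. *)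
pose B := expR (ln 2 / e) : R; pose D := B + `|J|.
have B0 : 0 <= B := expR_ge0 _.
have D0 : 0 <= D by rewrite addr_ge0.
pose K := (cos (d * (pi / 2)))^-1 : R.
have K0 : 0 <= K.
  case/andP: (d01) => d0 d1.
  rewrite invr_ge0 ltW// cos_gt0_pihalf//.
  have p0 : 0 < pi / 2 :> R by rewrite divr_gt0// pi_gt0.
  by rewrite (lt_trans _ (mulr_gt0 d0 p0)) ?oppr_lt0//= -[X in _ < X]mul1r ltr_pM2r.
have d10 : 0 < 1 - d by case/andP: d01; rewrite subr_gt0.
have d1' : 0 <= 1 + d^-1 by rewrite addr_ge0// invr_ge0 ltW//; case/andP: d01.
exists ((54 * c * (2 + 72 * (expR ((1 - d) * ln 6) / (1 - d))) +
    36 * ((1 + d^-1) * expR (d * ln (c + 1)) * K)) * D).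
  rewrite mulr_ge0// addr_ge0//.
    by rewrite mulr_ge0// ?mulr_ge0// addr_ge0// mulr_ge0// divr_ge0 ?expR_ge0// ltW.
  by rewrite mulr_ge0// mulr_ge0// mulr_ge0// expR_ge0.
(* Ensures [c <= r], so that every radius up to [r + c + r * tau] is at most [3 * r]. *)
exists (r0 + c); first by rewrite (le_trans r01)// lerDl.
move=> r rr nE.
have [rr0 cr] : r0 <= r /\ c <= r by split; lra.
have r1 : 1 <= r by rewrite (le_trans r01).
have rp : 0 < r by rewrite (lt_le_trans ltr01).
have gr : good f r by move=> z zr; apply: (HE2 r) => //; [by move=> ?; apply: nE; left; right | rewrite addr0].
have grc : good f (r + c) by move=> z zr; apply: (HE3 r) => // ?; apply: nE; right.
have [X1 HX] := HE1 r rr0 (fun x => nE (or_introl (or_introl x))) grc.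
split=> // a ac ra.
move: X1 HX; set X := characteristic f (r + c); set tau := expR _ => X1 HX.
have t0 : 0 < tau := expR_gt0 _.
have t1 : tau <= 1 by rewrite -expR0 ler_expR mulNr oppr_le0 mulr_ge0 ?(ltW e0) ?ln_ge0.
have rt : 0 < r * tau by rewrite mulr_gt0.
have rtr : r * tau <= r by rewrite ler_piMr// ltW.
(* Two good radii are needed within reach of the growth estimate: [s1] for [shift_mean], and [s2] to
   bound the pole counts at [s1] by counting functions. *)
have [s1 [/andP[a1 b1] g1]] := @good_between _ _ (r + c + r * tau / 3) (r + c + r * tau / 2) HP ltac:(move: rt; move: (r * tau) => q; lra).
have [s2 [/andP[a2 b2] g2]] := @good_between _ _ (r + c + r * tau * 2 / 3) (r + c + r * tau) HP ltac:(move: rt; move: (r * tau) => q; lra).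
have [s11 s12 s2le s13] : [/\ 1 <= s1, s1 < s2, s2 <= 3 * r & s1 <= r + c + r * tau].
  by move: rt rtr a1 b1 a2 b2; move: (r * tau) => q *; split; lra.
have s21 : 1 <= s2 by rewrite (le_trans s11)// ltW.
have T1 := HX s1 s11 s13 g1; have T2 := HX s2 s21 (ltW b2) g2.
rewrite -/B in T1 T2.
have s10 : 0 < s1 by rewrite (lt_le_trans ltr01).
have s20 : 0 < s2 by rewrite (lt_le_trans ltr01).
have X0 : 0 <= X by rewrite (le_trans ler01).
have JX : `|J| <= `|J| * X by rewrite ler_peMr.
have jl : - J <= `|J| by rewrite -normrN ler_norm.
have BD : B * X <= D * X by rewrite ler_wpM2r// lerDl.
have V s : 0 < s -> good f s -> characteristic f s <= B * X -> characteristic (fun z => (f z)^-1) s <= D * X.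
  move=> sp gs; rewrite (HJ _ sp gs) -lerBrDr => /le_trans; apply.
  by rewrite /D mulrDl lerD2l (le_trans jl).
have V1 := V s1 s10 g1 T1; have V2 := V s2 s20 g2 T2.
(* [ln (s2 / s1) >= 1 - s1 / s2], where [s2 - s1 >= r * tau / 6] and [s2 <= 3 * r]. *)
have gap : tau / 18 <= ln s2 - ln s1.
  rewrite -ln_div ?posrE//.
  have -> : s2 / s1 = (s1 / s2)^-1 by rewrite invf_div.
  rewrite lnV ?posrE ?divr_gt0// lerNr.
  have := @le_ln1Dx R (s1 / s2 - 1); rewrite addrCA subrr addr0 => /(_ _)/le_trans; apply.
    by rewrite ltrBrDr addNr divr_gt0.
  rewrite lerBlDr -ler_pdivlMr ?invr_gt0// invrK.
  have t3 : s2 * tau <= 3 * r * tau by rewrite ler_wpM2r// ltW.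
  rewrite mulrDl mulNr mul1r mulrAC.
  move: t3 a1 b1 a2 b2; rewrite -mulrA [tau * s2]mulrC; move: (r * tau) (s2 * tau) => q q'; lra.
have n0 g : nz_mero g -> characteristic g s2 <= D * X -> pole_count g s1 <= 18 * (D * X) / tau.
  move=> lg gD; have := pole_count_bound lg s11 s12 => /le_trans/(_ (counting_le_characteristic g s2)).
  move=> /le_trans/(_ gD) H.
  rewrite ler_pdivlMr// -ler_pdivrMl// mulrC -mulrA; apply: le_trans H.
  by rewrite ler_wpM2l ?pole_count_ge0// mulrC.
have N1 := n0 f lf (le_trans T2 BD); have N2 := n0 _ lV V2.
have M1 := le_trans (proximity_le_characteristic lf s11) (le_trans T1 BD).
have M2 := le_trans (proximity_le_characteristic lV s11) V1.
have gar : good (fun z => f (z + a)) r by move=> z zr; apply: reg_shift; exact: ra.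
have rcs : r + c < s1 by move: rt a1; move: (r * tau) => q; lra.
have [cc H] := @shift_mean R f a c d r s1 lf ac d01 r1 rcs gr gar g1 ra.
split=> //; apply: (le_trans H).
have -> : expR ((1 + eps) * ln X) = X * tau^-1 ^+ 3.
  rewrite /tau -expRN -expRM_natl -[X in _ = X * _]lnK ?posrE ?(lt_le_trans ltr01)// -expRD; congr expR.
  by rewrite /e; field.
rewrite [X in _ <= X]mulrA -/K.
apply: shift_bound_arith => //.
- by rewrite t0 t1.
- by rewrite lerBrDl ltW.
- by rewrite (le_trans (ltW s12)).
- rewrite addr_ge0 ?proximity_ge0//=; move: M1 M2; move: (proximity _ _) (proximity _ _) (D * X) => x y q; lra.
- rewrite addr_ge0 ?pole_count_ge0//=; move: N1 N2; move: (pole_count _ _) (pole_count _ _) => x y N1 N2.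
  rewrite (le_trans (lerD N1 N2))// -!mulrA.
  by rewrite le_eqVlt; apply/orP; left; apply/eqP; ring.
Qed.

End shift_asymptotics.

(** * Difference polynomials *)

Section clunie.
Variable R : realType.
Implicit Types (E : set R) (f g : R[i] -> R[i]) (z w a : R[i]) (r c d : R) (D : diffpoly R).

Lemma littleo_offP E (u g : R -> R) : u =o_ (infty_off E) g <->
  forall e, 0 < e -> exists M, forall x, M < x -> ~ E x -> `|u x| <= e * `|g x|.
Proof.
split=> [/eqoP H e e0|H].
  have [M [_ HM]] : \forall x \near infty_off E, `|u x| <= e * `|g x| by exact: H.
  by exists M => x Mx; exact: HM.
apply/eqoP => e e0; have [M HM] := H e e0.
by exists M; split; [exact: num_real | move=> x Mx; exact: HM].
Qed.

(** The majorant given by [logp_sum] and [logpM]. Only nonzero terms and nonzero exponents enter, so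
    that only shifts counted by [dp_maxshift] are ever estimated. *)
Definition clunie_bound D f z : R :=
  ln (size (dp_terms D)).+1%:R + \sum_(l <- dp_terms D)
    (logp (normc (dp_coef l z)) +
     \sum_(j < dp_size D | l j != 0%N) (l j)%:R * logp (normc (f (z + dp_shift j) / f z))).

(** A coefficient that is zero as a meromorphic function may still have stray values; this excludes
    them at [z]. *)
Definition vanishing_coefs D z :=
  forall l, l \in dp_supp D -> l \notin dp_terms D -> dp_coef l z = 0.

Definition dp_sum D f z :=
  \sum_(l <- dp_terms D) dp_coef l z * \prod_(j < dp_size D) f (z + dp_shift j) ^+ l j.

Lemma dp_evalE D f z : vanishing_coefs D z -> dp_eval D f z = dp_sum D f z.
Proof.
move=> H; rewrite /dp_sum /dp_eval /dp_terms big_filter [RHS]big_mkcond !big_seq; apply: eq_bigr => l ls.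
case: ifPn => // nl; rewrite H ?mul0r// /dp_terms mem_filter negb_and nl //.
Qed.

(* To be used with [u = 1] if [|f z| <= 1] and with [u = |f z| ^- n] otherwise. *)
Lemma dp_eval_logp D f z (u : R) : f z != 0 -> vanishing_coefs D z -> 0 <= u ->
  (forall l, l \in dp_terms D -> normc (f z) ^+ (\sum_(j < dp_size D) l j) * u <= 1) ->
  logp (normc (dp_eval D f z) * u) <= clunie_bound D f z.
Proof.
move=> fz vD u0 Hu; rewrite (dp_evalE _ vD) /dp_sum.
have nz : normc (f z) != 0 by rewrite gt_eqF// normc_gt0.
set F := fun l : {ffun 'I_(dp_size D) -> nat} => dp_coef l z * \prod_(j < dp_size D) f (z + dp_shift j) ^+ l j.
have nF l : normc (F l) * u = normc (dp_coef l z) *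
    \prod_(j < dp_size D | l j != 0%N) normc (f (z + dp_shift j) / f z) ^+ l j *
      (normc (f z) ^+ (\sum_(j < dp_size D) l j) * u).
  rewrite /F normcM mulrA -!mulrA; congr (_ * _); rewrite mulrA; congr (_ * _).
  rewrite normc_prod (bigID (fun j => l j != 0%N))/= [X in _ * X]big1 ?mulr1; last first.
    by move=> j; rewrite negbK => /eqP->; rewrite expr0 normc1.
  have -> : (\sum_(j < dp_size D) l j = \sum_(j < dp_size D | l j != 0) l j)%N.
    by rewrite [LHS](bigID (fun j => l j != 0%N))/= [X in (_ + X)%N]big1 ?addn0// => j; rewrite negbK => /eqP.
  rewrite -prodrXr -big_split/=; apply: eq_bigr => j _.
  by rewrite normcX -exprMn normcM normcV divfK.
apply: (@le_trans _ _ (logp (\sum_(l <- dp_terms D) normc (F l) * u))).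
  apply: le_logp; rewrite -mulr_suml ler_wpM2r//.
  by elim/big_rec2: _ => [|l x y _ H]; [rewrite normc0 | rewrite (le_trans (normcD _ _))// lerD2l].
apply: (le_trans (logp_sum _ _)); first by move=> l; rewrite mulr_ge0 ?normc_ge0.
rewrite /clunie_bound lerD2l !big_seq; apply: ler_sum => l lD.
have p0 : 0 <= \prod_(j < dp_size D | l j != 0%N) normc (f (z + dp_shift j) / f z) ^+ l j.
  by apply: prodr_ge0 => j _; rewrite exprn_ge0// normc_ge0.
rewrite nF; apply: (@le_trans _ _ (logp (normc (dp_coef l z) *
    \prod_(j < dp_size D | l j != 0%N) normc (f (z + dp_shift j) / f z) ^+ l j))).
  by apply: le_logp; rewrite ler_piMr ?mulr_ge0 ?normc_ge0// Hu.
apply: (le_trans (logpM _ _)) => //; first exact: normc_ge0.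
rewrite lerD2l; have := @logp_prod R _ [seq j <- index_enum 'I_(dp_size D) | l j != 0%N]
   (fun j => normc (f (z + dp_shift j) / f z) ^+ l j).
rewrite !big_filter => /(_ (fun j => exprn_ge0 _ (normc_ge0 _)))/le_trans; apply.
by apply: ler_sum => j _; apply: logpX; exact: normc_ge0.
Qed.

Lemma clunie_pointwise (P Q : diffpoly R) f z n : f z != 0 ->
  vanishing_coefs P z -> vanishing_coefs Q z -> (dp_degree Q <= n)%N ->
  f z ^+ n * dp_eval P f z = dp_eval Q f z ->
  logp (normc (dp_eval P f z)) <= clunie_bound P f z + clunie_bound Q f z.
Proof.
move=> fz vP vQ dQ eq.
have cb0 D : 0 <= clunie_bound D f z.
  rewrite addr_ge0 ?ln_ge0 ?ler1n// sumr_ge0// => l _; rewrite addr_ge0 ?logp_ge0//.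
  by rewrite sumr_ge0// => j _; rewrite mulr_ge0 ?logp_ge0.
have nz : 0 < normc (f z) by rewrite normc_gt0.
have [f1|f1] := leP (normc (f z)) 1.
  rewrite -[X in logp X]mulr1 (le_trans (dp_eval_logp fz vP ler01 _)) ?lerDl// => l _.
  by rewrite mulr1 exprn_ile1 ?normc_ge0.
have -> : normc (dp_eval P f z) = normc (dp_eval Q f z) * (normc (f z) ^+ n)^-1.
  by rewrite -eq normcM normcX mulrC mulKf// expf_neq0// gt_eqF.
rewrite (le_trans (dp_eval_logp fz vQ _ _)) ?lerDr ?invr_ge0 ?exprn_ge0 ?normc_ge0// => l lQ.
rewrite ler_pdivrMr ?exprn_gt0// mul1r ler_weXn2l ?(ltW f1)//.
apply: leq_trans dQ; rewrite /dp_degree.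
exact: (@leq_bigmax_seq _ _ predT (fun l : {ffun _} => \sum_(j < dp_size Q) l j)%N).
Qed.

Lemma dp_maxshift_le D (l : {ffun 'I_(dp_size D) -> nat}) (j : 'I_(dp_size D)) :
  l \in dp_terms D -> l j != 0%N -> normc (dp_shift j) <= dp_maxshift D.
Proof.
move=> lD lj; rewrite /dp_maxshift.
have hj : has (fun l : {ffun _} => l j != 0%N) (dp_terms D) by apply/hasP; exists l.
by rewrite (bigD1 j)//= le_max lexx.
Qed.

Lemma dp_maxshift_ge0 D : 0 <= dp_maxshift D.
Proof. by rewrite /dp_maxshift; elim/big_rec: _ => // j x _ x0; rewrite le_max x0 orbT. Qed.

Lemma dp_terms_nz f D (l : {ffun 'I_(dp_size D) -> nat}) : is_diffpoly f D -> l \in dp_terms D ->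
  nz_mero (dp_coef l).
Proof.
move=> HD; rewrite mem_filter => /andP[/asboolP nl ls]; have [ml _] := HD l ls.
apply: mero_identity => //; apply: contrapT => H; apply: nl => z0.
apply/dcnearP; apply: contrapT => nz; apply: H; exists z0 => zz; apply: nz.
exact: zz.
Qed.

Lemma nonconst_nz_mero f : meromorphic f -> (~ exists c : R[i], mero_eq f (cst c)) -> nz_mero f.
Proof.
move=> mf nc; apply: mero_identity => //; apply: contrapT => H; apply: nc; exists 0 => z0.
apply/dcnearP; apply: contrapT => nz; apply: H; exists z0 => zz; apply: nz; exact: zz.
Qed.

(** [E] collects the radii where a nonzero coefficient or a shift of [f] is irregular, or a zero
    coefficient has a stray value. The bound [K] for the shift quotients is left abstract because it
    varies with [r], whereas [C] does not. *)
Lemma clunie_bound_mean f c D : nz_mero f -> is_diffpoly f D -> dp_maxshift D <= c ->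
  exists2 E, finite_log_measure E &
  exists2 C, 0 <= C & forall r (K : R), 1 <= r -> ~ E r -> 0 <= K ->
   (forall a, normc a <= c -> (forall z, normc z = r -> reg f (z + a)) ->
      circ_cont (fun z => logp (normc (f (z + a) / f z))) r /\
      cmean (fun z => logp (normc (f (z + a) / f z))) r <= K) ->
   [/\ forall z, normc z = r -> vanishing_coefs D z,
     circ_cont (fun z => logp (normc (dp_sum D f z))) r,
     circ_cont (clunie_bound D f) r &
     cmean (clunie_bound D f) r <= C * (1 + K) + \sum_(l <- dp_terms D) characteristic (dp_coef l) r].
Proof.
move=> lf HD Dc.
pose P (l : {ffun 'I_(dp_size D) -> nat}) (E : set R) := forall r, 1 <= r -> ~ E r -> forall z, normc z = r ->
  if l \in dp_terms D then reg (dp_coef l) z else dp_coef l z = 0.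
have [||E1 fE1 HE1] := @flm_bigU R _ (dp_supp D) P.
- move=> l ls; pose Q z := if l \in dp_terms D then reg (dp_coef l) z else dp_coef l z = 0.
  have [|E fE HE] := @flm_bad R Q 0.
    move=> z0; rewrite /Q; have [lD|nD] := boolP (l \in dp_terms D).
      exact: nz_mero_reg (dp_terms_nz HD lD) z0.
    apply/dcnearP; move: nD; rewrite mem_filter ls andbT => /asboolPn/contrapT; exact.
  exists E => // r r1 nE z zr; apply: (HE r) => //; first exact: lt_le_trans r1.
  by rewrite addr0.
- by move=> l A B AB H r r1 nB; apply: H => // /AB.
pose P' (j : 'I_(dp_size D)) (E : set R) := forall r, 1 <= r -> ~ E r -> forall z, normc z = r ->
  reg f (z + dp_shift j).
have [||E2 fE2 HE2] := @flm_bigU R _ (index_enum 'I_(dp_size D)) P'.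
- move=> j _; have [E fE HE] := flm_bad 0 (shift_punct (dp_shift j) (nz_mero_reg lf)).
  exists E => // r r1 nE z zr; apply: (HE r) => //; first exact: lt_le_trans r1.
  by rewrite addr0.
- by move=> l A B AB H r r1 nB; apply: H => // /AB.
exists (E1 `|` E2); first exact: flmU.
pose S : R := \sum_(l <- dp_terms D) \sum_(j < dp_size D | l j != 0%N) (l j)%:R.
have S0 : 0 <= S by apply: sumr_ge0 => l _; apply: sumr_ge0.
pose N : R := ln (size (dp_terms D)).+1%:R.
have N0 : 0 <= N by rewrite ln_ge0// ler1n.
exists (N + S); first by rewrite addr_ge0.
move=> r K r1 nE K0 HK; have r0 : 0 <= r by rewrite (le_trans ler01).
have nE1 : ~ E1 r by move=> ?; apply: nE; left.
have nE2 : ~ E2 r by move=> ?; apply: nE; right.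
have sub (l : {ffun 'I_(dp_size D) -> nat}) : l \in dp_terms D -> l \in dp_supp D by rewrite mem_filter => /andP[].
have [|cS mS] := @le_cmean_sum R _ (dp_terms D) (fun (l : {ffun 'I_(dp_size D) -> nat}) z => logp (normc (dp_coef l z)) +
     \sum_(j < dp_size D | l j != 0%N) (l j)%:R * logp (normc (f (z + dp_shift j) / f z)))
   (fun l => characteristic (dp_coef l) r + (\sum_(j < dp_size D | l j != 0%N) (l j)%:R) * K) r r0.
- move=> l lD; have gl : good (dp_coef l) r.
    by move=> z zr; have := HE1 l (sub l lD) r r1 nE1 z zr; rewrite lD.
  have [|cJ mJ] := @le_cmean_sum R _ [seq j <- index_enum 'I_(dp_size D) | l j != 0%N]
     (fun j z => (l j)%:R * logp (normc (f (z + dp_shift j) / f z))) (fun j => (l j)%:R * K) r r0.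
    move=> j; rewrite mem_filter => /andP[lj _].
    have [||cj mj] := HK (dp_shift j); first exact: le_trans (dp_maxshift_le lD lj) Dc.
      by move=> z zr; exact: (HE2 j (mem_index_enum j) r r1 nE2 z zr).
    by split; [exact: circ_contZ | rewrite cmeanZ// ler_wpM2l].
  have E z : \sum_(j <- [seq j <- index_enum 'I_(dp_size D) | l j != 0%N]) (l j)%:R * logp (normc (f (z + dp_shift j) / f z))
     = \sum_(j < dp_size D | l j != 0%N) (l j)%:R * logp (normc (f (z + dp_shift j) / f z)) by rewrite big_filter.
  rewrite (funext E) in cJ mJ; rewrite big_filter -mulr_suml in mJ.
  have cl := circ_logp (good_cont gl).
  split; first by move=> w wr; apply: rcontD; [exact: cl | exact: cJ].
  rewrite cmeanD// lerD// -proximityE; exact: proximity_le_characteristic (dp_terms_nz HD lD) r1.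
split.
- move=> z zr l ls nl; have := HE1 l ls r r1 nE1 z zr; by rewrite (negbTE nl).
- apply: circ_logp => z zr.
  (* [ccont_sum] requires continuity for every index, not just those in the list; the conditional
     supplies it. *)
  have -> : dp_sum D f = fun w => \sum_(l <- dp_terms D) if l \in dp_terms D then
      dp_coef l w * \prod_(j < dp_size D) f (w + dp_shift j) ^+ l j else 0.
    by apply/funext => w; rewrite /dp_sum !big_seq; apply: eq_bigr => l ->.
  apply: ccont_sum => l; have [lD|_] := boolP (l \in dp_terms D); last exact: ccont_cst.
  apply: ccontM.
    by have := HE1 l (sub l lD) r r1 nE1 z zr; rewrite lD => /cnear_self[/cdiff_cont].
  apply: ccont_prod => j; apply: ccontX.
  by have [/cdiff_cont] := cnear_self (reg_shift (HE2 j (mem_index_enum j) r r1 nE2 z zr)).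
- by move=> w wr; apply: rcontD; [exact: rcont_cst | exact: cS].
rewrite /clunie_bound cmeanD//; last by move=> w _; exact: rcont_cst.
rewrite cmean_cst -/N; apply: (le_trans (lerD (lexx N) mS)).
rewrite big_split/= -mulr_suml -/S [X in _ + X]addrC addrA lerD2r.
by rewrite mulrDr mulr1 mulrDl; move: (mulr_ge0 N0 K0) S0; move: (N * K) (S * K) => x y; lra.
Qed.

Lemma littleo_offS E E' (u g : R -> R) : E `<=` E' ->
  u =o_ (infty_off E) g -> u =o_ (infty_off E') g.
Proof.
move=> EE /littleo_offP H; apply/littleo_offP => e /H[M HM]; exists M => x Mx nE.
by apply: HM => // /EE.
Qed.

Lemma littleo_off_sum (I : eqType) (s : seq I) E (F : I -> R -> R) (g : R -> R) :
  (forall i, i \in s -> F i =o_ (infty_off E) g) ->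
  (fun r => \sum_(i <- s) F i r) =o_ (infty_off E) g.
Proof.
elim: s => [|i s IH] H; apply/littleo_offP => e e0.
  by exists 0 => x _ _; rewrite big_nil normr0 mulr_ge0// ltW.
have e20 : 0 < e / 2 by rewrite divr_gt0.
have /littleo_offP/(_ _ e20)[M1 H1] := H i (mem_head _ _).
have /littleo_offP/(_ _ e20)[M2 H2] : (fun r => \sum_(i <- s) F i r) =o_ (infty_off E) g.
  by apply: IH => j js; apply: H; rewrite inE js orbT.
exists (Num.max M1 M2) => x; rewrite gt_max => /andP[x1 x2] nE; rewrite big_cons.
apply: (le_trans (ler_normD _ _)); apply: (le_trans (lerD (H1 x x1 nE) (H2 x x2 nE))).
by rewrite -mulrDl -splitr.
Qed.

Lemma expR_ln_decay (A k e : R) : 0 <= A -> 0 < k -> 0 < e ->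
  exists2 M, 1 <= M & forall x, M < x -> A * expR (- k * ln x) <= e.
Proof.
move=> A0 k0 e0; have Ae : 0 < (A + 1) / e by rewrite divr_gt0// ltr_wpDl.
exists (Num.max 1 (expR (ln ((A + 1) / e) / k))); first by rewrite le_max lexx.
move=> x; rewrite gt_max => /andP[x1 xk]; have x0 : 0 < x by exact: lt_trans x1.
rewrite mulNr expRN ler_pdivrMr ?expR_gt0//.
have : expR (ln ((A + 1) / e)) <= expR (k * ln x).
  rewrite ler_expR -ler_pdivrMl// mulrC -[X in X <= _]expRK ler_ln ?posrE ?expR_gt0//.
  exact: ltW.
rewrite lnK ?posrE// ler_pdivrMr// [_ * e]mulrC; apply: le_trans.
by rewrite lerDl.
Qed.

End clunie.

Theorem theorem3p1 (R : realType) (f : R[i] -> R[i]) (n : nat)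
    (P Q : diffpoly R) (delta eps : R)
    (f_mero : meromorphic f)
    (f_nonconst : ~ exists c : R[i], mero_eq f (cst c))
    (n_gt0 : (0 < n)%N)
    (P_dp : is_diffpoly f P) (Q_dp : is_diffpoly f Q)
    (f_sol : mero_eq (fun z => f z ^+ n * dp_eval P f z) (dp_eval Q f))
    (delta_lt1 : delta < 1) (eps_gt0 : 0 < eps)
    (degQ : (dp_degree Q <= n)%N) :
  let c := Num.max (dp_maxshift P) (dp_maxshift Q) in
  exists2 E : set R, finite_log_measure E &
    exists u v : R -> R,
      [/\ forall r, proximity (dp_eval P f) r = u r + v r,
          u =o_ (infty_off E)
            (fun r => characteristic f (r + c) `^ (1 + eps) / r `^ delta) &
          v =o_ (infty_off E) characteristic f].
Proof.
move=> c; have lf := nonconst_nz_mero f_mero f_nonconst.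
have c0 : 0 <= c by rewrite le_max dp_maxshift_ge0.
have Pc : dp_maxshift P <= c by rewrite le_max lexx.
have Qc : dp_maxshift Q <= c by rewrite le_max lexx orbT.
(* [shift_proximity] needs [0 < d < 1], while [delta] may be negative; [delta < d] later yields the
   decay [r^-(d - delta)]. *)
pose d := (Num.max delta 0 + 1) / 2.
have [d01 dd] : 0 < d < 1 /\ delta < d.
  have m0 : 0 <= Num.max delta 0 by rewrite le_max lexx orbT.
  have m1 : Num.max delta 0 < 1 by rewrite gt_max delta_lt1 ltr01.
  have md : delta <= Num.max delta 0 by rewrite le_max lexx.
  by rewrite /d; move: (Num.max delta 0) m0 m1 md => m *; split; [apply/andP; split; lra | lra].
have [E1 fE1 [C1 C10 [r1 r11 H1]]] := shift_proximity lf f_nonconst f_mero c0 d01 eps_gt0.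
have [E2 fE2 [CP CP0 HP]] := clunie_bound_mean lf P_dp Pc.
have [E3 fE3 [CQ CQ0 HQ]] := clunie_bound_mean lf Q_dp Qc.
(* The equation holds off a discrete set; radii whose circle meets that set are discarded. *)
have [|E4 fE4 H4] := @flm_bad R (fun z => f z ^+ n * dp_eval P f z = dp_eval Q f z) 0.
  by move=> z0; apply/dcnearP; exact: f_sol.
have coefs D : is_diffpoly f D -> exists2 E, finite_log_measure E &
    forall l, l \in dp_terms D -> characteristic (dp_coef l) =o_ (infty_off E) characteristic f.
  move=> HD; apply: flm_bigU => [l|l A B AB]; last exact: littleo_offS.
  by rewrite mem_filter => /andP[_ /HD[_ [E]]]; exists E.
have [E5 fE5 H5] := coefs P P_dp; have [E6 fE6 H6] := coefs Q Q_dp.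
pose E := E1 `|` E2 `|` E3 `|` E4 `|` E5 `|` E6.
have nE r : ~ E r -> [/\ ~ E1 r, ~ E2 r, ~ E3 r & ~ E4 r].
  by move=> H; split=> ?; apply: H; do 2 left; [do 3 left|do 2 left; right|left; right|right].
exists E; first by do 5?apply: flmU.
pose m := proximity (dp_eval P f).
pose X r := expR ((1 + eps) * ln (characteristic f (r + c))) * expR (- d * ln r).
pose U r := (CP + CQ) * (C1 * X r).
pose V r := CP + CQ + (\sum_(l <- dp_terms P) characteristic (dp_coef l) r +
                       \sum_(l <- dp_terms Q) characteristic (dp_coef l) r).
have U0 r : 0 <= U r by rewrite !mulr_ge0 ?addr_ge0 ?expR_ge0.
have m0 r : 0 <= m r by exact: proximity_ge0.
have main r : r1 <= r -> ~ E r -> m r <= U r + V r.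
  move=> rr /nE[n1 n2 n3 n4]; have [gr X1 HK] := H1 r rr n1.
  have r1' : 1 <= r by rewrite (le_trans r11).
  have r0 : 0 <= r by rewrite (le_trans ler01).
  have K0 : 0 <= C1 * X r by rewrite !mulr_ge0 ?expR_ge0.
  have [vP sP cP mP] := HP r (C1 * X r) r1' n2 K0 HK.
  have [vQ _ cQ mQ] := HQ r (C1 * X r) r1' n3 K0 HK.
  have -> : U r + V r = (CP * (1 + C1 * X r) + \sum_(l <- dp_terms P) characteristic (dp_coef l) r) +
     (CQ * (1 + C1 * X r) + \sum_(l <- dp_terms Q) characteristic (dp_coef l) r).
    rewrite /U /V; move: (\sum_(l <- dp_terms P) _) (\sum_(l <- dp_terms Q) _) (X r) => x y k; ring.
  apply: le_trans (lerD mP mQ).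
  have -> : m r = cmean (fun z => logp (normc (dp_sum P f z))) r.
    by rewrite /m proximityE; apply: eq_cmean => // z zr; rewrite dp_evalE//; exact: vP.
  rewrite -cmeanD//; apply: le_cmean => //.
    by move=> w wr; apply: rcontD; [exact: cP | exact: cQ].
  move=> z zr; rewrite -dp_evalE; last exact: vP.
  have [_ fz] := cnear_self (gr z zr).
  apply: (clunie_pointwise fz (vP z zr) (vQ z zr) degQ).
  by apply: (H4 r) => //; [exact: lt_le_trans r1' | rewrite addr0].
(* [m <= U + V] holds only for large [r] off [E], but the decomposition must be exact for all [r].
   Truncating [U] at [m] gives a first part at most [U] and a remainder that is 0 or
   [m - U <= V]. *)
exists (fun r => Num.min (m r) (U r)), (fun r => m r - Num.min (m r) (U r)); split.
- by move=> r; rewrite addrC subrK.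
- apply/littleo_offP => e e0.
  have [||M M1 HM] := @expR_ln_decay R ((CP + CQ) * C1) (d - delta) e _ _ e0.
  + by rewrite mulr_ge0// addr_ge0.
  + by rewrite subr_gt0.
  exists (Num.max M r1) => r; rewrite gt_max => /andP[Mr rr] nEr.
  have [n1 _ _ _] := nE r nEr; have [_ X1 _] := H1 r (ltW rr) n1.
  have rp : 0 < r by rewrite (lt_trans _ Mr)// (lt_le_trans ltr01).
  have Xp : 0 < characteristic f (r + c) by rewrite (lt_le_trans ltr01).
  rewrite ger0_norm; last by rewrite le_min m0 U0.
  rewrite ger0_norm; last by rewrite divr_ge0// powR_ge0.
  apply: (@le_trans _ _ (U r)); first by rewrite ge_min lexx orbT.
  rewrite /powR (gt_eqF Xp) (gt_eqF rp).
  have Y : expR (- d * ln r) = expR (- (d - delta) * ln r) / expR (delta * ln r).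
    by rewrite -expRN -expRD; congr expR; ring.
  have -> : U r = (CP + CQ) * C1 * expR (- (d - delta) * ln r) *
      (expR ((1 + eps) * ln (characteristic f (r + c))) / expR (delta * ln r)).
    rewrite /U /X Y; move: (expR (_ * ln (characteristic _ _))) (expR (- _ * _)) (expR _)^-1 => x y k; ring.
  by rewrite ler_wpM2r ?divr_ge0 ?expR_ge0// HM.
(* A quarter of [e] goes to each coefficient sum, and half to the constant [CP + CQ], absorbed
   because the characteristic tends to infinity along good radii. *)
apply/littleo_offP => e e0; have e40 : 0 < e / 4 by rewrite divr_gt0.
have oS D s E' : (forall l, l \in dp_terms D -> characteristic (dp_coef l) =o_ (infty_off E') characteristic f) ->
    E' `<=` E -> s = dp_terms D -> exists M, forall r, M < r -> ~ E r ->
      `|\sum_(l <- s) characteristic (dp_coef l) r| <= e / 4 * `|characteristic f r|.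
  move=> H EE ->; have /littleo_offP/(_ _ e40) := littleo_offS EE (littleo_off_sum H); exact.
have [M1 HM1] := oS P _ E5 H5 ltac:(by move=> x; left; right) erefl.
have [M2 HM2] := oS Q _ E6 H6 ltac:(by move=> x; right) erefl.
have [r2 r21 HT] := characteristic_infty lf f_nonconst f_mero ((CP + CQ) / (e / 2)).
exists (Num.max (Num.max M1 M2) (Num.max r1 r2)) => r.
rewrite !gt_max => /andP[/andP[q1 q2] /andP[q3 q4]] nEr.
have [n1 _ _ _] := nE r nEr; have [gr _ _] := H1 r (ltW q3) n1.
have T1 := HT r (ltW q4) gr.
have e20 : 0 < e / 2 by rewrite divr_gt0.
rewrite ler_pdivrMr// in T1.
have S1 := HM1 r q1 nEr; have S2 := HM2 r q2 nEr.
have T0 : 0 <= characteristic f r by apply: characteristic_ge0 lf _; rewrite (le_trans r21)// ltW.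
have mr := main r (ltW q3) nEr.
have CC : 0 <= CP + CQ by rewrite addr_ge0.
rewrite (ger0_norm T0) in S1 S2 *.
rewrite ger0_norm; last by rewrite subr_ge0 ge_min lexx.
have [mU|Um] := leP (m r) (U r); first by rewrite subrr mulr_ge0// ltW.
have V1 := ler_norm (\sum_(l <- dp_terms P) characteristic (dp_coef l) r).
have V2 := ler_norm (\sum_(l <- dp_terms Q) characteristic (dp_coef l) r).
move: mr V1 V2 S1 S2 T1; rewrite /V.
move: (\sum_(l <- dp_terms P) characteristic (dp_coef l) r) (\sum_(l <- dp_terms Q) characteristic (dp_coef l) r).
move: (characteristic f r) (m r) (U r) (CP + CQ); clear.
by move=> t k u q x y; move: (`|x|) (`|y|) => ax ay *; lra.
Qed.
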